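(* Let $m>3$ be an integer and let $\eta_0^{+},\eta_0^{-}:\mathbb{T}\to\mathbb{R}$ be odd functions with $\rho_2^{1/2}\partial_\theta\eta_0^{\pm}\in H^m(\mathbb{T})$, and let $(\eta^{+},\eta^{-})$ be the unique classical odd solution of the linearized system \[ \partial_t\eta^{+}=L^{+}\eta^{+}=\Big\{\tfrac12\eta^{+}+v^{+},\ \sin(2\theta)\Big\},\qquad \partial_t\eta^{-}=\Big\{\tfrac12\eta^{-}-v^{-},\ \sin(2\theta)\Big\},\qquad \partial_\theta v^{\pm}=H\eta^{\pm},\ v^{\pm}(t,0)=0, \] with $\eta^{\pm}(0)=\eta_0^{\pm}$ (which exists globally, with $\rho_2^{1/2}\partial_\theta\eta^{\pm}\in C([0,T];H^m)\cap C^2([0,T];H^{m-2})$ for every $T>0$). Assume moreover that $\|\eta_0^{+}\|_{\mathcal{H}_2}\neq0$ and $\langle L^{+}\eta_0^{+},\eta_0^{+}\rangle_{\mathcal{H}_2}\ge 0$. Then there exists an absolute constant $\lambda_1>0$ such that \[ \|\eta^{+}(t)\|_{\mathcal{H}_2}+\|\eta^{-}(t)\|_{\mathcal{H}_2}>E_1^{1/2}(t)>0\qquad\text{for all } t>0, \] where \[ E_1(t)=\frac{\langle\eta_0^{+},\eta_0^{+}\rangle_{\mathcal{H}_2}+\frac{1}{\sqrt{\lambda_1}}\langle L^{+}\eta_0^{+},\eta_0^{+}\rangle_{\mathcal{H}_2}}{2}\,e^{2\sqrt{\lambda_1}t}+\frac{\langle\eta_0^{+},\eta_0^{+}\rangle_{\mathcal{H}_2}-\frac{1}{\sqrt{\lambda_1}}\langle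 L^{+}\eta_0^{+},\eta_0^{+}\rangle_{\mathcal{H}_2}}{2}\,e^{-2\sqrt{\lambda_1}t}. \]
   Context: $\mathbb{T}=[-\pi,\pi]$ with periodic identification. $H$ is the Hilbert transform on $\mathbb{T}$: $Hf(\theta)=\frac{1}{2\pi}\,\mathrm{p.v.}\int_{-\pi}^{\pi}\cot\big(\frac{\theta-\vartheta}{2}\big)f(\vartheta)\,d\vartheta$. The Lie bracket is $\{f,g\}=f\,\partial_\theta g-g\,\partial_\theta f$. $\rho_2(\theta)=\frac{1}{4\pi\sin^2\theta}$. For a function $f$, $v(f)$ denotes the function with $\partial_\theta v(f)=Hf$, $v(f)(0)=0$, and $L^{+}f=\{\tfrac12 f+v(f),\sin(2\theta)\}$. $\mathcal{H}_2$ is the Hilbert space of odd $\eta\in H^1(\mathbb{T})$ with $\int_{\mathbb{T}}|\partial_\theta\eta|^2/\sin^2\theta\,d\theta<\infty$, with inner product $\langle\xi,\eta\rangle_{\mathcal{H}_2}=\int_{-\pi}^{\pi}\rho_2\,\partial_\theta\xi\,\partial_\theta\eta\,d\theta$ and norm $\|\eta\|_{\mathcal{H}_2}=\|\rho_2^{1/2}\partial_\theta\eta\|_{L^2}$. *)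

(* Defs.v *)
(* Functions on the torus T = [-pi,pi] are
   represented as 2*pi-periodic functions R -> R. *)
From HB Require Import structures.
From mathcomp Require Import all_boot all_order all_algebra.
From mathcomp Require Import all_classical all_reals all_analysis.
Set Implicit Arguments. Unset Strict Implicit. Unset Printing Implicit Defensive.
Import Order.TTheory GRing.Theory Num.Theory.
Import numFieldNormedType.Exports.
Local Open Scope classical_set_scope.
Local Open Scope ring_scope.

Section Defs.
Variable R : realType.
Local Notation leb := (@lebesgue_measure R).

Definition Tdom : set R := `[(- pi)%R, pi]%classic.

Definition periodic2pi (f : R -> R) : Prop := forall x, f (x + 2 * pi) = f x.
Definition oddfun (f : R -> R) : Prop := forall x, f (- x) = - f x.

Definition rho2 (x : R) : R := (4 * pi * (sin x) ^+ 2)^-1.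

Definition dth (f : R -> R) : R -> R := derive1 f.

(* Hilbert transform on the torus, as a principal value:
   Hf(theta) = 1/(2 pi) p.v. int_{-pi}^{pi} cot((theta - th')/2) f(th') dth'
             = lim_{e -> 0+} 1/(2 pi) int_{e <= |s| <= pi} cot(s/2) f(theta - s) ds
   (substitution th' = theta - s, using 2 pi-periodicity of the integrand). *)
Definition hilbert (f : R -> R) (x : R) : R :=
  lim ((fun e : R => (2 * pi)^-1 *
          \int[leb]_(s in [set s : R | e <= `|s| <= pi])
             (cos (s / 2) / sin (s / 2) * f (x - s))) @ 0^'+).

Definition vfun (f : R -> R) (x : R) : R :=
  if 0 <= x then \int[leb]_(s in `[0, x]) hilbert f s
  else - \int[leb]_(s in `[x, 0]) hilbert f s.

Definition bracket (f g : R -> R) (x : R) : R := f x * dth g x - g x * dth f x.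

Definition sin2 (x : R) : R := sin (2 * x).

Definition Lplus (f : R -> R) : R -> R :=
  bracket (fun x => f x / 2 + vfun f x) sin2.
Definition Lminus (f : R -> R) : R -> R :=
  bracket (fun x => f x / 2 - vfun f x) sin2.

Definition ipH2 (xi eta : R -> R) : R :=
  \int[leb]_(x in Tdom) (rho2 x * dth xi x * dth eta x).
Definition normH2 (eta : R -> R) : R :=
  Num.sqrt (\int[leb]_(x in Tdom) (rho2 x * (dth eta x) ^+ 2)).

Definition wder (eta : R -> R) (x : R) : R := Num.sqrt (rho2 x) * dth eta x.

Definition fcos (g : R -> R) (k : nat) : R :=
  \int[leb]_(x in Tdom) (g x * cos (k%:R * x)).
Definition fsin (g : R -> R) (k : nat) : R :=
  \int[leb]_(x in Tdom) (g x * sin (k%:R * x)).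
Definition sob_sum (m : nat) (g : R -> R) : \bar R :=
  (\sum_(0 <= k <oo)
     ((1 + (k%:R : R) ^+ 2) ^+ m * (fcos g k ^+ 2 + fsin g k ^+ 2))%:E)%E.
Definition in_Hm (m : nat) (g : R -> R) : Prop :=
  [/\ periodic2pi g, measurable_fun Tdom g,
      leb.-integrable Tdom (fun x => (g x ^+ 2)%:E) & (sob_sum m g < +oo)%E].
Definition Hm_norm (m : nat) (g : R -> R) : R := Num.sqrt (fine (sob_sum m g)).

Definition cont_Hm (m : nat) (u : R -> R -> R) (T : R) : Prop :=
  (forall t, 0 <= t <= T -> in_Hm m (u t)) /\
  (forall t, 0 <= t <= T -> forall e, 0 < e -> exists2 d, 0 < d &
     forall s, 0 <= s <= T -> `|s - t| < d ->
       Hm_norm m (fun x => u s x - u t x) < e).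

Definition deriv_Hm (m : nat) (u u' : R -> R -> R) (T : R) : Prop :=
  forall t, 0 <= t <= T -> forall e, 0 < e -> exists2 d, 0 < d &
     forall s, 0 <= s <= T -> s != t -> `|s - t| < d ->
       Hm_norm m (fun x => (u s x - u t x) / (s - t) - u' t x) < e.

Definition C2_Hm (m : nat) (u : R -> R -> R) (T : R) : Prop :=
  exists u1 u2 : R -> R -> R,
    [/\ cont_Hm m u T, cont_Hm m u1 T, cont_Hm m u2 T,
        deriv_Hm m u u1 T & deriv_Hm m u1 u2 T].

Definition init_datum (m : nat) (eta0 : R -> R) : Prop :=
  [/\ oddfun eta0, periodic2pi eta0, (forall x, derivable eta0 x 1)
    & in_Hm m (wder eta0)].

Definition lin_solution (m : nat) (eta0p eta0m : R -> R)
    (etap etam : R -> R -> R) : Prop :=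
  [/\ etap 0 = eta0p, etam 0 = eta0m,
      (forall t, 0 <= t ->
         [/\ oddfun (etap t), periodic2pi (etap t)
            & forall x, derivable (etap t) x 1] /\
         [/\ oddfun (etam t), periodic2pi (etam t)
            & forall x, derivable (etam t) x 1]),
      (forall t x, 0 < t ->
         [/\ derivable (fun s => etap s x) t 1,
             derivable (fun s => etam s x) t 1,
             derive1 (fun s => etap s x) t = Lplus (etap t) x &
             derive1 (fun s => etam s x) t = Lminus (etam t) x]) &
      (forall T, 0 < T ->
         [/\ cont_Hm m (fun t => wder (etap t)) T,
             cont_Hm m (fun t => wder (etam t)) T,
             C2_Hm (m - 2) (fun t => wder (etap t)) T &
             C2_Hm (m - 2) (fun t => wder (etam t)) T])].

Definition E1 (lam1 : R) (eta0p : R -> R) (t : R) : R :=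
  (ipH2 eta0p eta0p + (Num.sqrt lam1)^-1 * ipH2 (Lplus eta0p) eta0p) / 2
    * expR (2 * Num.sqrt lam1 * t)
  + (ipH2 eta0p eta0p - (Num.sqrt lam1)^-1 * ipH2 (Lplus eta0p) eta0p) / 2
    * expR (- (2 * Num.sqrt lam1 * t)).

End Defs.

(* Main.v *)
(* Write eta' = |sin| g with g even, and let C_n be the sine coefficients of g on
   [0, pi]. Since H maps sin (n x) to - cos (n x), the operator L^+ acts on the C_n by
     D_n = mu_n C_n + (d_(n+1) C_(n+2) - d_(n-1) C_(n-2)) / 2,
   a diagonal matrix M plus a skew one S. By Parseval, y = |eta|^2, z = <L eta, eta>
   in H_2 satisfy y' = 2 z and
     z' = |LC|^2 + C . L^2 C = 2 MC . (M + S) C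
        = sum_n 2 mu_n^2 C_n^2 + off-diagonal terms,
   up to a normalisation; since mu_n is close to -1/2 the diagonal dominates, so
   z' >= y / 5. Comparison with the solution of Y'' = 4 lambda_1 Y, lambda_1 = 1/25,
   having the same initial data gives y > E_1.
   The matrix entries are unbounded (d_n grows like n / 2): the boundary terms of the partial
   sums are O(n) times a summable sequence, hence small along a subsequence.
   Only Sobolev regularity of g is given, so that g is identified almost everywhere
   with its absolutely convergent cosine series, and eta is recovered from it because
   an everywhere differentiable function with derivative 0 almost everywhere is
   constant. *)
Require Import Defs.
From HB Require Import structures.
From mathcomp Require Import all_boot all_order all_algebra.
From mathcomp Require Import all_classical all_reals all_analysis.
From mathcomp Require Import measurable_realfun ring lra.
Set Implicit Arguments. Unset Strict Implicit. Unset Printing Implicit Defensive.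
Import Order.TTheory GRing.Theory Num.Theory.
Import numFieldNormedType.Exports.
Local Open Scope classical_set_scope.
Local Open Scope ring_scope.

(** * Calculus on intervals *)

Section Calculus.
Variable R : realType.
Local Notation mu := (@lebesgue_measure R).
Implicit Types (f g F G : R -> R) (a b c x y : R).

(** Writing eta' = |sin| g turns the weighted inner product into the plain L^2 product of g on
    [0, pi], divided by 2 pi. Sine coefficients of g appear because k times the k-th sine
    coefficient of eta is the integral of sin x g cos (k x), that is (C_(k+1) - C_(k-1)) / 2. As g
    need not vanish at 0 and pi, its sine series is controlled only in L^2, so no decay rate of C_n
    is at hand for the boundary terms. The relation between C and the second time derivative is not
    obtained by applying L^+ twice to eta. The identity D = LC is differentiated in time row by row,
    each row having three terms, which gives E = LD for the coefficients E of the second derivative.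
    The equation is given for t > 0 only; D = LC reaches t = 0 by continuity, and this identifies
    z(0) with the inner product of L^+ eta_0 and eta_0. The bound z' >= y / 5 would allow a rate up
    to 1/10; the smaller 1/25 leaves the room that makes the comparison strict and has a rational
    square root. *)

Definition itg a b f : R := \int[mu]_(x in `[a, b]) f x.

Definition antideriv F f := forall x, is_derive x (1 : R) F (f x).

Lemma continuous_integrable_itv f a b : continuous f ->
  mu.-integrable `[a, b] (EFin \o f).
Proof.
move=> cf; apply: continuous_compact_integrable; first exact: segment_compact.
exact: continuous_subspaceT.
Qed.

Lemma continuous_add f g : continuous f -> continuous g ->
  continuous (fun x => f x + g x).
Proof. by move=> cf cg x; exact: (continuousD (cf x) (cg x)). Qed.

Lemma continuous_mul f g : continuous f -> continuous g ->
  continuous (fun x => f x * g x).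
Proof. by move=> cf cg x; exact: (continuousM (cf x) (cg x)). Qed.

Lemma continuous_const (k : R) : continuous ((fun=> k) : R -> R).
Proof. by move=> x; exact: cvg_cst. Qed.

Lemma continuous_scale k f : continuous f -> continuous (fun x => k * f x).
Proof. by move=> cf; apply: continuous_mul => //; exact: continuous_const. Qed.

Lemma continuous_sub f g : continuous f -> continuous g ->
  continuous (fun x => f x - g x).
Proof. by move=> cf cg x; exact: (continuousB (cf x) (cg x)). Qed.

Lemma continuous_compose f g : continuous f -> continuous g ->
  continuous (fun x => f (g x)).
Proof. by move=> cf cg x; apply: continuous_comp; [exact: cg|exact: cf]. Qed.

Lemma continuous_id_real : continuous ((fun x => x) : R -> R).
Proof. by move=> x; exact: cvg_id. Qed.

Lemma continuous_sin_scale k : continuous (fun x => sin (k * x)).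
Proof.
apply: (@continuous_compose _ (fun x => k * x)); first exact: continuous_sin.
exact: continuous_scale continuous_id_real.
Qed.

Lemma continuous_cos_scale k : continuous (fun x => cos (k * x)).
Proof.
apply: (@continuous_compose _ (fun x => k * x)); first exact: continuous_cos.
exact: continuous_scale continuous_id_real.
Qed.

Lemma antideriv_continuous F f : antideriv F f -> continuous F.
Proof.
move=> FD x; apply: differentiable_continuous; apply/derivable1_diffP.
by case: (FD x).
Qed.

Lemma antideriv_ext F G f g : antideriv F f -> F =1 G -> f =1 g -> antideriv G g.
Proof. by move=> Ff /funext <- /funext <-. Qed.

Lemma antiderivD F G f g : antideriv F f -> antideriv G g ->
  antideriv (fun x => F x + G x) (fun x => f x + g x).
Proof. by move=> Ff Gg x; apply: is_deriveD; [exact: Ff|exact: Gg]. Qed.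

Lemma antiderivZ F f k : antideriv F f ->
  antideriv (fun x => k * F x) (fun x => k * f x).
Proof.
move=> Ff x; have Fx := Ff x.
by apply: (is_derive_eq (is_deriveZ k Fx)).
Qed.

Lemma antiderivM F G f g : antideriv F f -> antideriv G g ->
  antideriv (fun x => F x * G x) (fun x => f x * G x + F x * g x).
Proof.
move=> Ff Gg x; have Fx := Ff x; have Gx := Gg x.
apply: (is_derive_eq (is_deriveM Fx Gx)).
by rewrite /GRing.scale/=; ring.
Qed.

Lemma antideriv_cst k : antideriv (fun=> k) (fun=> 0).
Proof. by move=> x; exact: is_derive_cst. Qed.

Lemma antideriv_comp F G f g : antideriv F f -> antideriv G g ->
  antideriv (fun x => F (G x)) (fun x => g x * f (G x)).
Proof.
move=> Ff Gg x; have Fx := Ff (G x); have Gx := Gg x.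
by apply: (is_derive_eq (is_derive1_comp Fx Gx)); rewrite mulrC.
Qed.

Lemma antideriv_affine k c : antideriv (fun x => k * x + c) (fun=> k).
Proof.
have := antiderivD (@antiderivZ (fun x => x) (fun=> 1) k (fun x => is_derive_id x 1)) (antideriv_cst c).
by move/antideriv_ext; apply=> // x; rewrite mulr1 addr0.
Qed.

Lemma antideriv_shift F f k c : antideriv F f ->
  antideriv (fun x => F (k * x + c)) (fun x => k * f (k * x + c)).
Proof. by move=> Ff; apply: (antideriv_comp Ff); exact: antideriv_affine. Qed.

Lemma antideriv_sin k : antideriv (fun x => sin (k * x)) (fun x => k * cos (k * x)).
Proof.
have /(antideriv_shift k 0) : antideriv (@sin R) cos by move=> x; exact: is_derive_sin.
by move/antideriv_ext; apply=> x; rewrite addr0.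
Qed.

Lemma antideriv_cos k : antideriv (fun x => cos (k * x)) (fun x => - (k * sin (k * x))).
Proof.
have /(antideriv_shift k 0) : antideriv (@cos R) (fun x => - sin x) by move=> x; exact: is_derive_cos.
by move/antideriv_ext; apply=> x; rewrite addr0// mulrN.
Qed.

Lemma ftc2 F f a b : a <= b -> antideriv F f -> continuous f ->
  itg a b f = F b - F a.
Proof.
rewrite le_eqVlt => /predU1P[<- _ _|ab Ff cf].
  by rewrite subrr /itg set_itv1 Rintegral_set1.
rewrite /itg /Rintegral (@continuous_FTC2 _ f F)//.
- exact: continuous_subspaceT.
- have cF := antideriv_continuous Ff; split.
  + by move=> x _; case: (Ff x).
  + exact/cvg_at_right_filter/cF.
  + exact/cvg_at_left_filter/cF.
- by move=> x _; rewrite derive1E; case: (Ff x).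
Qed.

Lemma antideriv0_cst F a b : antideriv F (fun=> 0) -> F a = F b.
Proof. by move=> F0; exact: is_derive_0_is_cst. Qed.

Lemma itgE f a b : itg a b f = \int[mu]_(x in `[a, b]) f x.
Proof. by []. Qed.

Lemma itg_chasles f a b c : a <= b -> b <= c -> mu.-integrable `[a, c] (EFin \o f) ->
  itg a c f = itg a b f + itg b c f.
Proof.
move=> ab bc fi; apply/eqP; rewrite addrC -subr_eq; apply/eqP.
rewrite /itg (@Rintegral_itvB _ f (BLeft a) (BRight c) b) ?bnd_simp//.
rewrite Rintegral_itv_obnd_cbnd//.
by apply: integrableS fi => //; apply: subset_itv; rewrite ?bnd_simp.
Qed.

(** The same split on the sign of [x] as in [vfun]: once the Hilbert transform is identified,
    [vfun eta] is a [prim]. *)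
Definition prim f x : R := if 0 <= x then itg 0 x f else - itg x 0 f.

Lemma prim_antideriv f : continuous f -> antideriv (prim f) f.
Proof.
(* A base point below both 0 and [x] makes [prim f] near [x] a single integral from [c], up to a
   constant, whatever the sign of [x]. *)
move=> cf x; pose c : R := - (`|x| + 1).
have c0 : c < 0 by rewrite oppr_lt0 ltr_wpDl.
have cx : c < x by rewrite ltrNl (le_lt_trans (ler_norm _))// normrN ltrDl.
pose I0 y := itg c y f.
have pE y : c < y -> prim f y = I0 y - itg c 0 f.
  move=> cy; rewrite /I0 /prim; case: ifPn => [y0|]; last rewrite -ltNge => y0.
    have -> := itg_chasles (ltW c0) y0 (@continuous_integrable_itv f c y cf).
    by rewrite [LHS]/=; ring.
  have -> := itg_chasles (ltW cy) (ltW y0) (@continuous_integrable_itv f c 0 cf).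
  by rewrite [LHS]/=; ring.
have [d1 d2] : derivable I0 x 1 /\ derive1 I0 x = f x.
  by apply: (@continuous_FTC1_closed _ f c x (x + 1)) => //; [rewrite ltrDl|exact: continuous_integrable_itv|exact: cf].
move: (itg c 0 f) I0 pE d1 d2 => k I pE d1 d2.
have dI : is_derive x (1:R) I (f x).
  by apply: DeriveDef; [exact: d1|rewrite -derive1E].
have dB : is_derive x (1:R) (fun y => I y - k) (f x).
  by apply: (is_derive_eq (is_deriveB dI (is_derive_cst k x 1))); rewrite subr0.
apply: (near_eq_is_derive _ dB).
near=> y; apply: esym; apply: pE; near: y; exact: lt_nbhsr.
Unshelve. all: by end_near. Qed.

Lemma prim0 f : prim f 0 = 0.
Proof. by rewrite /prim lexx /itg set_itv1 Rintegral_set1. Qed.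

Lemma itg_primE f a b : continuous f -> a <= b -> itg a b f = prim f b - prim f a.
Proof. by move=> cf ab; apply: ftc2 => //; exact: prim_antideriv. Qed.

Lemma eq_itg f g a b : (forall x, a <= x <= b -> f x = g x) -> itg a b f = itg a b g.
Proof. by move=> fg; apply: eq_Rintegral => x; rewrite inE/= in_itv/=; exact: fg. Qed.

Lemma itgD f g a b : continuous f -> continuous g ->
  itg a b (fun x => f x + g x) = itg a b f + itg a b g.
Proof. by move=> cf cg; rewrite /itg RintegralD//; exact: continuous_integrable_itv. Qed.

Lemma itgB f g a b : continuous f -> continuous g ->
  itg a b (fun x => f x - g x) = itg a b f - itg a b g.
Proof. by move=> cf cg; rewrite /itg RintegralB//; exact: continuous_integrable_itv. Qed.

Lemma itgZ k f a b : continuous f -> itg a b (fun x => k * f x) = k * itg a b f.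
Proof. by move=> cf; rewrite /itg RintegralZl//; exact: continuous_integrable_itv. Qed.

Lemma itg_cst k a b : a <= b -> itg a b (fun=> k) = k * (b - a).
Proof.
move=> ab; rewrite (@ftc2 (fun x => k * x + 0) (fun=> k)) ?addr0//.
- by rewrite mulrBr.
- exact: antideriv_affine.
- by exact: continuous_const.
Qed.

Lemma le_itg f g a b : continuous f -> continuous g ->
  (forall x, a <= x <= b -> f x <= g x) -> itg a b f <= itg a b g.
Proof.
move=> cf cg fg; apply: le_Rintegral; [by []|exact: continuous_integrable_itv|exact: continuous_integrable_itv|].
by move=> x /=; rewrite in_itv/=; exact: fg.
Qed.

Lemma itg_ge0 f a b : (forall x, a <= x <= b -> 0 <= f x) -> 0 <= itg a b f.
Proof. by move=> f0; apply: Rintegral_ge0 => x /=; rewrite in_itv/=; exact: f0. Qed.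

Lemma itg_bound f M a b : a <= b -> continuous f ->
  (forall x, a <= x <= b -> `|f x| <= M) -> `|itg a b f| <= M * (b - a).
Proof.
move=> ab cf fM; rewrite -itg_cst// ler_norml; apply/andP; split.
  rewrite -mulN1r -itgZ; last by exact: continuous_const.
  apply: le_itg => //; first by exact: continuous_const.
  by move=> x /fM; rewrite ler_norml mulN1r => /andP[].
by apply: le_itg => //; [exact: continuous_const|move=> x /fM; rewrite ler_norml => /andP[]].
Qed.

Lemma itg_by_parts F G f g a b : a <= b -> antideriv F f -> antideriv G g ->
  continuous f -> continuous g ->
  itg a b (fun x => F x * g x) = F b * G b - F a * G a - itg a b (fun x => f x * G x).
Proof.
move=> ab Ff Gg cf cg.
have cF := antideriv_continuous Ff; have cG := antideriv_continuous Gg.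
have c1 := continuous_mul cf cG; have c2 := continuous_mul cF cg.
rewrite -(ftc2 ab (antiderivM Ff Gg) (continuous_add c1 c2)) itgD//.
by rewrite addrAC subrr add0r.
Qed.

Lemma itg_opp f a b : a <= b -> continuous f ->
  itg (- b) (- a) f = itg a b (fun x => f (- x)).
Proof.
move=> ab cf; have pf := prim_antideriv cf.
rewrite itg_primE ?lerN2//.
have := antiderivZ (-1) (antideriv_shift (-1) 0 pf).
move/antideriv_ext => /(_ (fun x => - prim f (- x)) (fun x => f (- x))) H.
rewrite (ftc2 ab (H _ _))//; last 3 first.
- by move=> x; rewrite !mulN1r addr0.
- by move=> x; rewrite !mulN1r addr0 opprK.
- by move=> x; apply: continuous_comp; [exact: oppr_continuous|exact: cf].
by rewrite opprK addrC.
Qed.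

End Calculus.

(** * Trigonometric polynomials and polynomial approximation of the sign *)

Section TrigPoly.
Variable R : realType.
Implicit Types (f g : R -> R) (a b c x y : R) (k l n : nat).

Inductive cospoly : (R -> R) -> Prop :=
| cospoly_cos k : cospoly (fun x => cos (k%:R * x))
| cospolyD f g : cospoly f -> cospoly g -> cospoly (fun x => f x + g x)
| cospolyZ c f : cospoly f -> cospoly (fun x => c * f x).

Inductive sinpoly : (R -> R) -> Prop :=
| sinpoly_sin k : sinpoly (fun x => sin (k%:R * x))
| sinpolyD f g : sinpoly f -> sinpoly g -> sinpoly (fun x => f x + g x)
| sinpolyZ c f : sinpoly f -> sinpoly (fun x => c * f x).

Lemma cospoly_ext f g : cospoly f -> f =1 g -> cospoly g.
Proof. by move=> + /funext <-. Qed.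

Lemma sinpoly_ext f g : sinpoly f -> f =1 g -> sinpoly g.
Proof. by move=> + /funext <-. Qed.

Lemma cospoly_cst c : cospoly (fun=> c).
Proof.
by apply: cospoly_ext (cospolyZ c (cospoly_cos 0)) _ => x; rewrite mul0r cos0 mulr1.
Qed.

Lemma cospoly_continuous f : cospoly f -> continuous f.
Proof.
elim=> [k|{}f g _ cf _ cg|c {}f _ cf]; first exact: continuous_cos_scale.
- exact: continuous_add.
- exact: continuous_scale.
Qed.

Lemma sinpoly_continuous f : sinpoly f -> continuous f.
Proof.
elim=> [k|{}f g _ cf _ cg|c {}f _ cf]; first exact: continuous_sin_scale.
- exact: continuous_add.
- exact: continuous_scale.
Qed.

Lemma cos_mul_cos a b : cos a * cos b = 2^-1 * (cos (a + b) + cos (a - b)) :> R.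
Proof. by rewrite cosB cosD; field. Qed.

Lemma sin_mul_cos a b : sin a * cos b = 2^-1 * (sin (a + b) + sin (a - b)) :> R.
Proof. by rewrite sinB sinD; field. Qed.

Lemma sin_mul_sin a b : sin a * sin b = 2^-1 * (cos (a - b) - cos (a + b)) :> R.
Proof. by rewrite cosB cosD; field. Qed.

Lemma cospoly_cosB k l : cospoly (fun x => cos (k%:R * x - l%:R * x)).
Proof.
have [kl|/ltnW kl] := leqP l k.
  by apply: cospoly_ext (cospoly_cos (k - l)) _ => x; rewrite natrB// mulrBl.
by apply: cospoly_ext (cospoly_cos (l - k)) _ => x; rewrite natrB// mulrBl -cosN opprB.
Qed.

Lemma sinpoly_sinB k l : sinpoly (fun x => sin (k%:R * x - l%:R * x)).
Proof.
have [kl|/ltnW kl] := leqP l k.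
  by apply: sinpoly_ext (sinpoly_sin (k - l)) _ => x; rewrite natrB// mulrBl.
apply: sinpoly_ext (sinpolyZ (-1) (sinpoly_sin (l - k))) _ => x.
by rewrite natrB// mulrBl mulN1r -sinN opprB.
Qed.

Lemma cospolyM f g : cospoly f -> cospoly g -> cospoly (fun x => f x * g x).
Proof.
move=> + cg; elim=> [k|{}f1 f2 _ IH1 _ IH2|c {}f _ IH]; last 2 first.
- by apply: cospoly_ext (cospolyD IH1 IH2) _ => x; rewrite mulrDl.
- by apply: cospoly_ext (cospolyZ c IH) _ => x; rewrite mulrA.
elim: cg => [l|g1 g2 _ IH1 _ IH2|c {}g _ IH].
- apply: cospoly_ext (cospolyZ 2^-1 (cospolyD (cospoly_cos (k + l)) (cospoly_cosB k l))) _ => x.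
  by rewrite cos_mul_cos natrD mulrDl.
- by apply: cospoly_ext (cospolyD IH1 IH2) _ => x; rewrite mulrDr.
- by apply: cospoly_ext (cospolyZ c IH) _ => x; rewrite mulrCA.
Qed.

Lemma sinpolyM f g : sinpoly f -> cospoly g -> sinpoly (fun x => f x * g x).
Proof.
move=> + cg; elim=> [k|{}f1 f2 _ IH1 _ IH2|c {}f _ IH]; last 2 first.
- by apply: sinpoly_ext (sinpolyD IH1 IH2) _ => x; rewrite mulrDl.
- by apply: sinpoly_ext (sinpolyZ c IH) _ => x; rewrite mulrA.
elim: cg => [l|g1 g2 _ IH1 _ IH2|c {}g _ IH].
- apply: sinpoly_ext (sinpolyZ 2^-1 (sinpolyD (sinpoly_sin (k + l)) (sinpoly_sinB k l))) _ => x.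
  by rewrite sin_mul_cos natrD mulrDl.
- by apply: sinpoly_ext (sinpolyD IH1 IH2) _ => x; rewrite mulrDr.
- by apply: sinpoly_ext (sinpolyZ c IH) _ => x; rewrite mulrCA.
Qed.

Lemma sinpoly_sinpolyM f g : sinpoly f -> sinpoly g -> cospoly (fun x => f x * g x).
Proof.
move=> + cg; elim=> [k|{}f1 f2 _ IH1 _ IH2|c {}f _ IH]; last 2 first.
- by apply: cospoly_ext (cospolyD IH1 IH2) _ => x; rewrite mulrDl.
- by apply: cospoly_ext (cospolyZ c IH) _ => x; rewrite mulrA.
elim: cg => [l|g1 g2 _ IH1 _ IH2|c {}g _ IH].
- apply: cospoly_ext (cospolyZ 2^-1 (cospolyD (cospoly_cosB k l) (cospolyZ (-1) (cospoly_cos (k + l))))) _ => x.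
  by rewrite sin_mul_sin natrD mulrDl mulN1r.
- by apply: cospoly_ext (cospolyD IH1 IH2) _ => x; rewrite mulrDr.
- by apply: cospoly_ext (cospolyZ c IH) _ => x; rewrite mulrCA.
Qed.

(* Newton's iteration for the sign function: polynomials in y converging to
   the sign of y on [-1, 1] while staying bounded by 1 there. *)
Fixpoint sgn_iter j y : R :=
  if j is j'.+1 then let p := sgn_iter j' y in p * (2^-1 * (3 - p * p)) else y.

Lemma sgn_iterN j y : sgn_iter j (- y) = - sgn_iter j y.
Proof. by elim: j => //= j ->; rewrite mulNr mulrN mulNr opprK. Qed.

Lemma sgn_iter0 j : sgn_iter j 0 = 0.
Proof. by elim: j => //= j ->; rewrite mul0r. Qed.

(** One iteration sends [1 - p] to [(1 - p)^2 (2 + p) / 2]; as [p >= y], the error shrinks at least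
    by the factor [1 - y / 2]. *)
Lemma sgn_iter_pos j y : 0 < y <= 1 ->
  y <= sgn_iter j y <= 1 /\ 1 - sgn_iter j y <= (1 - y / 2) ^+ j.
Proof.
move=> /andP[y0 y1]; elim: j => [|j [/andP[IH1 IH2] IH3]] /=; first by rewrite lexx y1 expr0; split => //; lra.
set p := sgn_iter j y in IH1 IH2 IH3 *.
have p0 : 0 < p by exact: lt_le_trans IH1.
have e : 1 - p * (2^-1 * (3 - p * p)) = (1 - p) * ((1 - p) * (2 + p) / 2) by field.
have pp : p * p <= 1 by rewrite -[leRHS]mulr1; apply: ler_pM => //; exact: ltW.
have b1 : 0 <= (1 - p) * (2 + p) / 2.
  by rewrite mulr_ge0// mulr_ge0//; lra.
have b2 : (1 - p) * (2 + p) / 2 <= 1 - y / 2.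
  have := mulr_gt0 p0 p0; lra.
split; last first.
  rewrite e exprS mulrC; apply: ler_pM => //; lra.
apply/andP; split.
  apply: le_trans IH1 _; rewrite -[leLHS]mulr1 ler_pM2l//; lra.
have : 0 <= (1 - p) * ((1 - p) * (2 + p) / 2) by rewrite mulr_ge0//; lra.
by rewrite -e subr_ge0.
Qed.

Lemma sgn_iter_le1 j y : `|y| <= 1 -> `|sgn_iter j y| <= 1.
Proof.
move=> y1; have [y0|y0|->] := ltgtP y 0; last by rewrite sgn_iter0 normr0.
- have := @sgn_iter_pos j (- y); rewrite oppr_gt0 y0 sgn_iterN /=.
  rewrite ltr0_norm// in y1 => /(_ y1) [/andP[h1 h2] _]; rewrite -normrN ger0_norm//.
  by rewrite (le_trans _ h1)// oppr_ge0 ltW.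
- have := @sgn_iter_pos j y; rewrite y0 /=.
  rewrite gtr0_norm// in y1 => /(_ y1) [/andP[h1 h2] _]; rewrite ger0_norm//.
  by rewrite (le_trans _ h1)// ltW.
Qed.

Lemma sgn_iter_cvg_pos y : 0 < y <= 1 -> sgn_iter j y @[j --> \oo] --> (1 : R).
Proof.
move=> /andP[y0 y1].
have h : (1 - y / 2) ^+ j @[j --> \oo] --> (0 : R).
  by apply: cvg_expr; rewrite ger0_norm; lra.
have : 1 - (1 - y / 2) ^+ j @[j --> \oo] --> (1 - 0 : R).
  by apply: cvgB => //; exact: cvg_cst.
rewrite subr0 => h1; apply: (squeeze_cvgr (h := fun=> 1) _ h1); last exact: cvg_cst.
apply: nearW => j; have [|/andP[_ ->]] := @sgn_iter_pos j y; first by rewrite y0.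
by rewrite andbT lerBlDr addrC -lerBlDr.
Qed.

Lemma sgn_iter_cvg y : `|y| <= 1 -> sgn_iter j y @[j --> \oo] --> Num.sg y.
Proof.
move=> y1; have [y0|y0|->] := ltgtP y 0; last first.
- by rewrite sgr0; under eq_fun do rewrite sgn_iter0; exact: cvg_cst.
- by rewrite gtr0_sg//; apply: sgn_iter_cvg_pos; rewrite y0 (le_trans (ler_norm _)).
- rewrite ltr0_sg//.
  have h : sgn_iter j (- y) @[j --> \oo] --> (1 : R).
    by apply: sgn_iter_cvg_pos; rewrite oppr_gt0 y0 (le_trans (ler_norm _))// normrN.
  have -> : sgn_iter ^~ y = (fun j => - sgn_iter j (- y)).
    by apply/funext => j; rewrite sgn_iterN opprK.
  exact: cvgN.
Qed.

Lemma cospoly_sgn_iter j f : cospoly f -> cospoly (fun x => sgn_iter j (f x)).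
Proof.
move=> cf; elim: j => //= j IH; apply: cospolyM => //; apply: cospolyZ.
apply: cospolyD; first exact: cospoly_cst.
by apply: cospoly_ext (cospolyZ (-1) (cospolyM IH IH)) _ => x; rewrite mulN1r.
Qed.

(** Each iteration multiplies [p] by a polynomial in [p^2], and the square of a sine polynomial is a
    cosine polynomial. *)
Lemma sinpoly_sgn_iter j f : sinpoly f -> sinpoly (fun x => sgn_iter j (f x)).
Proof.
move=> cf; elim: j => //= j IH; apply: sinpolyM => //; apply: cospolyZ.
apply: cospolyD; first exact: cospoly_cst.
by apply: cospoly_ext (cospolyZ (-1) (sinpoly_sinpolyM IH IH)) _ => x; rewrite mulN1r.
Qed.

End TrigPoly.

(** * Uniqueness of Fourier coefficients *)

Section Uniqueness.
Variable R : realType.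
Local Notation mu := (@lebesgue_measure R).
Implicit Types (f g q F : R -> R) (a b c x y : R).

Lemma ae_mono (P Q : R -> Prop) : (forall x, P x -> Q x) ->
  {ae mu, forall x, P x} -> {ae mu, forall x, Q x}.
Proof.
move=> PQ [A [mA A0 sA]]; exists A; split => // x nQ.
by apply: sA => Px; apply: nQ; exact: PQ.
Qed.

Lemma continuous_bounded_itv q a b : continuous q ->
  exists2 M, 0 < M & forall x, a <= x <= b -> `|q x| <= M.
Proof.
move=> cq; have : compact (q @` `[a, b]).
  by apply: continuous_compact; [exact: continuous_subspaceT|exact: segment_compact].
move=> /compact_bounded[M [_ HM]]; exists (`|M| + 1); first by rewrite ltr_wpDl.
move=> x xab; apply: (HM (`|M| + 1)); first by rewrite ltr_pwDr// ler_norm.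
by exists x => //=; rewrite in_itv.
Qed.

Lemma integrable_mul_continuous f q a b : mu.-integrable `[a, b] (EFin \o f) ->
  continuous q -> mu.-integrable `[a, b] (EFin \o (fun x => f x * q x)).
Proof.
move=> fi cq.
have [M M0 qM] := @continuous_bounded_itv q a b cq.
have mq : measurable_fun `[a, b] q.
  by apply: measurable_funTS; exact: continuous_measurable_fun.
have bq : [bounded q x | x in `[a, b]%classic].
  exists M; split; first by rewrite num_real.
  move=> y My x /=; rewrite in_itv/= => xab.
  by rewrite (le_trans (qM _ xab))// ltW.
have := @integrableMl _ _ _ mu _ (measurable_itv _) _ _ fi mq bq.
by apply: eq_integrable.
Qed.

Lemma itg_dct (f_ : nat -> R -> R) f g a b :
  (forall n, measurable_fun `[a, b] (f_ n)) ->
  mu.-integrable `[a, b] (EFin \o g) ->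
  (forall x, a <= x <= b -> f_ n x @[n --> \oo] --> f x) ->
  (forall n x, a <= x <= b -> `|f_ n x| <= g x) ->
  mu.-integrable `[a, b] (EFin \o f) /\
  itg a b (f_ n) @[n --> \oo] --> itg a b f.
Proof.
move=> mf_ gi ff_ f_g.
have mf : measurable_fun `[a, b] f.
  by apply: (measurable_fun_cvg mf_) => x; rewrite /= in_itv/=; exact: ff_.
have [] := @dominated_convergence _ _ _ mu `[a, b]%classic (measurable_itv _)
  (fun n => EFin \o f_ n) (EFin \o f) (EFin \o g).
- by move=> n; apply/measurable_EFinP; exact: mf_.
- by apply/measurable_EFinP.
- apply: aeW => x; rewrite /= in_itv/= => xab.
  by apply: cvg_EFin; [exact: nearW|exact: ff_].
- exact: gi.
- apply: aeW => x n; rewrite /= in_itv/= => xab.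
  by rewrite lee_fin; exact: f_g.
move=> fi _ h; split => //.
apply: fine_cvg; rewrite fineK; last exact: integrable_fin_num.
exact: h.
Qed.

Lemma itgDint f g a b : mu.-integrable `[a, b] (EFin \o f) -> mu.-integrable `[a, b] (EFin \o g) ->
  itg a b (fun x => f x + g x) = itg a b f + itg a b g.
Proof. by move=> fi gi; rewrite /itg RintegralD. Qed.

Lemma itgZint k f a b : mu.-integrable `[a, b] (EFin \o f) ->
  itg a b (fun x => k * f x) = k * itg a b f.
Proof. by move=> fi; rewrite /itg RintegralZl. Qed.

Lemma itg_cospoly0 f : mu.-integrable `[0, pi] (EFin \o f) ->
  (forall k : nat, itg 0 pi (fun x => f x * cos (k%:R * x)) = 0) ->
  forall q, cospoly q -> itg 0 pi (fun x => f x * q x) = 0.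
Proof.
move=> fi f0 q; elim=> [//|q1 q2 c1 IH1 c2 IH2|k q1 c1 IH1].
  under eq_itg do rewrite mulrDr.
  rewrite itgDint ?IH1 ?IH2 ?addr0//; apply: integrable_mul_continuous => //; exact: cospoly_continuous.
under eq_itg do rewrite mulrCA.
rewrite itgZint ?IH1 ?mulr0//; apply: integrable_mul_continuous => //; exact: cospoly_continuous.
Qed.

Lemma cos_anti x y : 0 <= x -> x < y -> y <= pi -> cos y < cos x :> R.
Proof.
move=> x0 xy ypi; rewrite ltr_cos// in_itv/= ?x0 ?ypi ?andbT/=.
  by rewrite (le_trans _ ypi)// ltW.
by rewrite (le_trans x0)// ltW.
Qed.

Lemma eq_itg_oc f g a b : mu.-integrable `[a, b] (EFin \o f) -> mu.-integrable `[a, b] (EFin \o g) ->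
  (forall x, a <= x < b -> f x = g x) -> itg a b f = itg a b g.
Proof.
move=> fi gi fg; rewrite /itg -!Rintegral_itv_bndo_bndc.
- by apply: eq_Rintegral => x; rewrite inE/= in_itv/=; exact: fg.
- by apply: integrableS gi => //; apply: subset_itvl; rewrite bnd_simp.
- by apply: integrableS fi => //; apply: subset_itvl; rewrite bnd_simp.
Qed.

Lemma eq_itg_co f g a b : mu.-integrable `[a, b] (EFin \o f) -> mu.-integrable `[a, b] (EFin \o g) ->
  (forall x, a < x <= b -> f x = g x) -> itg a b f = itg a b g.
Proof.
move=> fi gi fg; rewrite /itg -!Rintegral_itv_obnd_cbnd.
- by apply: eq_Rintegral => x; rewrite inE/= in_itv/=; exact: fg.
- by apply: integrableS gi => //; apply: subset_itvr; rewrite bnd_simp.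
- by apply: integrableS fi => //; apply: subset_itvr; rewrite bnd_simp.
Qed.

Lemma integrable_subitv f a b c d : a <= c -> d <= b ->
  mu.-integrable `[a, b] (EFin \o f) -> mu.-integrable `[c, d] (EFin \o f).
Proof. by move=> ac db; apply: integrableS => //; apply: subset_itv; rewrite bnd_simp. Qed.

(* The indicator of [0, r] is (1 + sgn (cos x - cos r)) / 2, a bounded pointwise
   limit of cosine polynomials. *)
Lemma itg_cos0_itg0 f r : mu.-integrable `[0, pi] (EFin \o f) ->
  (forall k : nat, itg 0 pi (fun x => f x * cos (k%:R * x)) = 0) ->
  0 <= r <= pi -> itg 0 r f = 0.
Proof.
move=> fi f0 /andP[r0 rpi].
(* cos decreases on [0, pi], so [q] is positive before [r] and negative after it; the factor 1/2
   keeps [q] in [-1, 1], where the iteration converges. *)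
pose q x : R := 2^-1 * (cos (1%:R * x) + (- cos r)).
have cq : cospoly q.
  by apply: cospolyZ; apply: cospolyD; [exact: cospoly_cos|exact: cospoly_cst].
have q1 x : `|q x| <= 1.
  rewrite /q; have := cos_max (1%:R * x); have := cos_max r.
  by rewrite !ler_norml; lra.
have cf n := cospoly_continuous (cospoly_sgn_iter n cq).
have [hi hc] : mu.-integrable `[0, pi] (EFin \o (fun x => f x * Num.sg (q x))) /\
    itg 0 pi (fun x => f x * sgn_iter n (q x)) @[n --> \oo] -->
    itg 0 pi (fun x => f x * Num.sg (q x)).
  apply: (itg_dct (f_ := fun n x => f x * sgn_iter n (q x)) (g := fun x => `|f x|)).
  - move=> n; apply: measurable_funM; first by move/integrableP : fi => [/measurable_EFinP].
    by apply: measurable_funTS; exact: continuous_measurable_fun.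
  - exact: (integrable_norm fi).
  - by move=> x _; apply: cvgM; [exact: cvg_cst|exact: sgn_iter_cvg].
  - by move=> n x _; rewrite normrM ler_piMr// sgn_iter_le1.
have {}hc : itg 0 pi (fun x => f x * Num.sg (q x)) = 0.
  apply/esym; move: hc; rewrite (_ : (fun n => _) = fun=> 0).
    by move=> /cvg_lim <-//; rewrite lim_cst.
  by apply/funext => n; apply: itg_cospoly0 => //; exact: cospoly_sgn_iter.
have hf : itg 0 pi f = 0.
  by apply: etrans (f0 0%N); apply: eq_itg => x _; rewrite mul0r cos0 mulr1.
have hs : itg 0 pi (fun x => f x + f x * Num.sg (q x)) = 0.
  by rewrite itgDint// hf hc addr0.
have si : mu.-integrable `[0, pi] (EFin \o (fun x => f x + f x * Num.sg (q x))).
  by have := @integrableD _ _ _ mu `[0, pi]%classic (measurable_itv _) _ _ fi hi; apply: eq_integrable.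
rewrite (itg_chasles r0 rpi si) in hs.
have e1 : itg 0 r (fun x => f x + f x * Num.sg (q x)) = itg 0 r (fun x => 2 * f x).
  apply: eq_itg_oc.
  - exact: integrable_subitv si.
  - have := @integrable_mul_continuous f (fun=> 2) 0 r (integrable_subitv (lexx 0) rpi fi) (@continuous_const R 2).
    by apply: eq_integrable => // x _ /=; rewrite mulrC.
  move=> x /andP[x0 xr]; rewrite gtr0_sg; first by rewrite mulr1 mulr_natl mulr2n.
  by rewrite /q mul1r mulr_gt0// subr_gt0 cos_anti.
have e2 : itg r pi (fun x => f x + f x * Num.sg (q x)) = itg r pi (fun=> 0).
  apply: eq_itg_co.
  - exact: integrable_subitv si.
  - exact: continuous_integrable_itv (@continuous_const R 0).
  move=> x /andP[rx xpi]; rewrite ltr0_sg; first by rewrite mulrN1 subrr.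
  by rewrite /q mul1r pmulr_rlt0// subr_lt0 cos_anti.
move: hs; rewrite e1 e2 itg_cst// mul0r addr0 itgZint; last exact: integrable_subitv fi.
by move/eqP; rewrite mulf_eq0 pnatr_eq0/= => /eqP.
Qed.

(** Lebesgue differentiation: [f] is almost everywhere the derivative of its primitive, which is
    zero here. The cut-off [g] makes it integrable on every interval starting at 0. *)
Lemma itg0_ae0 f (b : R) : 0 <= b -> mu.-integrable `[0, b] (EFin \o f) ->
  (forall r, 0 <= r <= b -> itg 0 r f = 0) ->
  {ae mu, forall x, 0 < x < b -> f x = 0}.
Proof.
move=> b0 fi f0.
pose g := f \_ `[0, b].
have gi y : mu.-integrable `[0, y] (EFin \o g).
  rewrite /g -restrict_EFin; apply/integrable_restrict => //.
  by apply: integrableS fi => //; exact: measurableI.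
have := @FTC1 R g (BLeft 0) gi (integrable_locally (measurable_itv _) fi).
apply: ae_mono => x H /andP[x0 xb].
have [_ +] := H x0.
rewrite /g patchE mem_set/=; last by rewrite in_itv/= !ltW.
move=> <-.
rewrite (_ : (fun y => _) = fun=> 0); first by rewrite derive1_cst.
apply/funext => y; have [y0|y0] := leP 0 y; last first.
  by rewrite set_itv_ge ?Rintegral_set0// bnd_simp -ltNge.
have e z : 0 <= z <= b -> \int[mu]_(t in `[0, z]) g t = 0.
  move=> /andP[z0 zb]; apply: etrans (f0 z _); rewrite ?z0//; apply: eq_itg => t /andP[t0 tz].
  by rewrite /g patchE mem_set//= in_itv/= t0 (le_trans tz).
have [yb|/ltW yb] := leP y b; first by rewrite e// y0.
rewrite -itgE (itg_chasles b0 yb (gi y)) itgE e ?b0 ?lexx// add0r.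
rewrite (@eq_itg_co g (fun=> 0) b y).
- by rewrite itg_cst// mul0r.
- exact: integrable_subitv (gi y).
- exact: continuous_integrable_itv (@continuous_const R 0).
move=> t /andP[bt _]; rewrite /g patchE memNset//= in_itv/= => /andP[_].
by rewrite leNgt bt.
Qed.

(** Reduction to cosines: sin x cos (k x) is a sine polynomial, so f sin is orthogonal to all
    cosines and its primitive vanishes. By continuity f sin = 0 at every point, and sin > 0
    inside. *)
Lemma sine_uniqueness f : continuous f ->
  (forall k : nat, itg 0 pi (fun x => f x * sin (k%:R * x)) = 0) ->
  forall x, 0 < x < pi -> f x = 0.
Proof.
move=> cf f0 x /andP[x0 xpi].
pose h y := f y * sin (1%:R * y).
have ch : continuous h by apply: continuous_mul => //; exact: continuous_sin_scale.
have sp q : sinpoly q -> itg 0 pi (fun x => f x * q x) = 0.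
  elim=> [//|q1 q2 c1 IH1 c2 IH2|k q1 c1 IH1].
    under eq_itg do rewrite mulrDr.
    by rewrite itgD ?IH1 ?IH2 ?addr0//; apply: continuous_mul => //; exact: sinpoly_continuous.
  under eq_itg do rewrite mulrCA.
  by rewrite itgZ ?IH1 ?mulr0//; apply: continuous_mul => //; exact: sinpoly_continuous.
have h0 r : 0 <= r <= pi -> itg 0 r h = 0.
  apply: itg_cos0_itg0; first exact: continuous_integrable_itv.
  move=> k; apply: etrans (sp (fun x => sin (1%:R * x) * cos (k%:R * x)) _).
    by apply: eq_itg => y _; rewrite mulrA.
  by apply: sinpolyM; [exact: sinpoly_sin|exact: cospoly_cos].
have : is_derive x (1:R) (prim h) (h x) by exact: prim_antideriv.
have : is_derive x (1:R) (prim h) 0.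
  apply: (near_eq_is_derive _ (is_derive_cst 0 x 1)).
  near=> y; rewrite /prim ifT ?h0//=.
    by apply/andP; split; apply: ltW; near: y; [exact: lt_nbhsr|exact: lt_nbhsl].
  by apply: ltW; near: y; exact: lt_nbhsr.
move=> [_ +] [_]; move=> -> /eqP; rewrite /h mul1r eq_sym mulf_eq0 => /orP[/eqP//|/eqP s0].
by have := sin_gt0_pi (_ : 0 < x < pi); rewrite x0 xpi s0 ltxx => /(_ isT).
Unshelve. all: by end_near. Qed.

End Uniqueness.

(** * Uniform limits of cosine polynomials and absolutely convergent cosine series *)

Section CosSeries.
Variable R : realType.
Implicit Types (f g q : R -> R) (a : nat -> R) (x y : R) (k n N : nat).

(** The uniform closure, on the whole line, of the cosine polynomials: evenness, periodicity and
    continuity all pass to the limit. *)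
Definition ucos f := forall e : R, 0 < e ->
  exists2 q, cospoly q & forall x, `|f x - q x| <= e.

Lemma ucos_continuous f : ucos f -> continuous f.
Proof.
move=> uf x; apply/cvgrPdist_le => e e0.
have e3 : 0 < e / 3 by rewrite divr_gt0.
have [q cq qf] := uf _ e3.
have cq' : continuous q := cospoly_continuous cq.
have /cvgrPdist_le/(_ _ e3) h := cq' x.
near=> y.
have h1 : `|q x - q y| <= e / 3 by near: y.
have := qf x; have := qf y; move: h1.
by rewrite !ler_norml; lra.
Unshelve. all: by end_near. Qed.

Lemma ler_eps_eq x y : (forall e, 0 < e -> `|x - y| <= e) -> x = y.
Proof.
move=> h; apply/eqP; rewrite -subr_eq0 -normr_le0; apply/ler_addgt0Pl => e e0.
by rewrite addr0; exact: h.
Qed.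

Lemma ucos_stable f (s : R -> R) : ucos f -> (forall k x, cos (k%:R * s x) = cos (k%:R * x)) ->
  forall x, f (s x) = f x.
Proof.
move=> uf hs x; apply: ler_eps_eq => e e0.
have e2 : 0 < e / 2 by rewrite divr_gt0.
have [q cq qf] := uf _ e2.
have : q (s x) = q x by elim: cq {qf} => [k|q1 q2 _ -> _ ->|c q1 _ ->].
by move=> h; have := qf x; have := qf (s x); rewrite h !ler_norml; lra.
Qed.

Lemma ucos_even f : ucos f -> forall x, f (- x) = f x.
Proof. by move=> uf; apply: (ucos_stable uf) => k x; rewrite mulrN cosN. Qed.

Lemma cosDn2pi n x : cos (x + n%:R * (2 * pi)) = cos x.
Proof.
elim: n => [|n IH]; first by rewrite mul0r addr0.
by rewrite -natr1 mulrDl mul1r addrA {2}(mulr_natl pi 2) cosD2pi IH.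
Qed.

Lemma ucos_periodic f : ucos f -> periodic2pi f.
Proof. by move=> uf; apply: (ucos_stable uf) => k x; rewrite mulrDr cosDn2pi. Qed.

Lemma ucosZ c f : ucos f -> ucos (fun x => c * f x).
Proof.
move=> uf e e0; have c0 : 0 < `|c| + 1 by rewrite ltr_wpDl.
have [|q cq qf] := uf (e / (`|c| + 1)); first by rewrite divr_gt0.
exists (fun x => c * q x); first exact: cospolyZ.
move=> x; rewrite -mulrBr normrM (le_trans (ler_wpM2l _ (qf x)))//.
by rewrite mulrA ler_pdivrMr// mulrC ler_wpM2l ?lerDl// ltW.
Qed.

Definition cosser a x := limn (series (fun k => a k * cos (k%:R * x))).

Lemma cospoly_series a n : cospoly (fun x => series (fun k => a k * cos (k%:R * x)) n).
Proof.
elim: n => [|n IH].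
  by apply: cospoly_ext (cospoly_cst 0) _ => x; rewrite /series /= big_geq.
apply: cospoly_ext (cospolyD IH (cospolyZ (a n) (cospoly_cos _ n))) _ => x.
by rewrite /series /= big_nat_recr.
Qed.

Section Abs.
Variable a : nat -> R.
Hypothesis ca : cvgn (series (fun k => `|a k|)).
Local Notation A := (limn (series (fun k => `|a k|))).

Lemma cosser_cvg x : series (fun k => a k * cos (k%:R * x)) @ \oo --> cosser a x.
Proof.
have : cvgn [normed series (fun k => a k * cos (k%:R * x))].
  apply: series_le_cvg ca => // k; rewrite /= ?normr_ge0//.
  by rewrite normrM ler_piMr// cos_max.
exact: normed_cvg.
Qed.

Lemma cosser_tail n x : `|cosser a x - series (fun k => a k * cos (k%:R * x)) n|
  <= A - series (fun k => `|a k|) n.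
Proof.
apply/ler_addgt0Pl => e e0.
have /cvgrPdist_le/(_ _ e0)[m _ h] := @cosser_cvg x.
have {}h := h (maxn m n) (leq_maxl _ _).
have nM : (n <= maxn m n)%N by exact: leq_maxr.
move: (maxn m n) nM h => M nM h; rewrite /= in h.
rewrite -(subrK (series (fun k => a k * cos (k%:R * x)) M) (cosser a x)) -addrA.
rewrite (le_trans (ler_normD _ _))// lerD//.
rewrite sub_series_geq// (le_trans (ler_norm_sum _ _ _))//.
apply: (@le_trans _ _ (series (fun k => `|a k|) M - series (fun k => `|a k|) n)).
  rewrite sub_series_geq//; apply: ler_sum => k _.
  by rewrite normrM ler_piMr// cos_max.
rewrite lerD2r; apply: (nondecreasing_cvgn_le _ ca).
by apply/nondecreasing_seqP => k; rewrite /series /= big_nat_recr//= lerDl.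
Qed.

Lemma cosser_bound x : `|cosser a x| <= A.
Proof. by have := cosser_tail 0 x; rewrite /series /= !big_geq// !subr0. Qed.

Lemma cosser_unif e : 0 < e -> exists N, forall n, (N <= n)%N ->
  forall x, `|cosser a x - series (fun k => a k * cos (k%:R * x)) n| <= e.
Proof.
move=> e0; have /cvgrPdist_le/(_ _ e0)[N _ h] := ca.
exists N => n Nn x; rewrite (le_trans (cosser_tail n x))// (le_trans (ler_norm _))//.
exact: h.
Qed.

Lemma cosser_ucos : ucos (cosser a).
Proof.
move=> e /cosser_unif[N h]; exists (fun x => series (fun k => a k * cos (k%:R * x)) N).
  exact: cospoly_series.
by move=> x; exact: h.
Qed.

Lemma sinpin k : sin (k%:R * pi) = 0 :> R.
Proof.
elim: k => [|k IH]; first by rewrite mul0r sin0.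
by rewrite -natr1 mulrDl mul1r sinDpi IH oppr0.
Qed.

Lemma itg_cos k : (0 < k)%N -> itg 0 pi (fun x => cos (k%:R * x)) = 0 :> R.
Proof.
move=> k0; have k0' : k%:R != 0 :> R by rewrite pnatr_eq0 -lt0n.
have := antiderivZ (k%:R^-1) (@antideriv_sin R k%:R).
move/antideriv_ext => /(_ _ (fun x => cos (k%:R * x)) (fun x => erefl)) H.
rewrite (ftc2 (pi_ge0 R) (H _)).
- by rewrite sinpin !mulr0 sin0 mulr0 subrr.
- by move=> x; rewrite mulrA mulVf// mul1r.
- exact: continuous_cos_scale.
Qed.

(** The square of the norm of cos (k x) in L^2(0, pi). *)
Definition cosnorm k : R := if k == 0%N then pi else pi / 2.

Lemma itg_cos_cosB k l : itg 0 pi (fun x => cos (k%:R * x - l%:R * x)) = if k == l then pi else 0 :> R.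
Proof.
case: eqVneq => [->|kl].
  under eq_itg do rewrite subrr cos0.
  by rewrite itg_cst ?pi_ge0// mul1r subr0.
have [h|h] := ltnP l k.
  apply: etrans (itg_cos (k := k - l) _); rewrite ?subn_gt0//.
  by apply: eq_itg => x _; rewrite natrB 1?ltnW// mulrBl.
apply: etrans (itg_cos (k := l - k) _); rewrite ?subn_gt0 ?ltn_neqAle ?kl//.
by apply: eq_itg => x _; rewrite natrB// mulrBl -cosN opprB.
Qed.

Lemma itg_cos_cosD k l : itg 0 pi (fun x => cos (k%:R * x + l%:R * x)) =
  if (k + l == 0)%N then pi else 0 :> R.
Proof.
case: eqVneq => [/eqP|kl].
  rewrite addn_eq0 => /andP[/eqP -> /eqP ->].
  under eq_itg do rewrite !mul0r addr0 cos0.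
  by rewrite itg_cst ?pi_ge0// mul1r subr0.
apply: etrans (itg_cos (k := k + l) _); rewrite ?lt0n//.
by apply: eq_itg => x _; rewrite natrD mulrDl.
Qed.

Lemma continuous_cosDB (k l : R) : continuous (fun x => cos (k * x + l * x)).
Proof. by have := @continuous_cos_scale R (k + l); under eq_fun do rewrite mulrDl. Qed.

Lemma continuous_cosBB (k l : R) : continuous (fun x => cos (k * x - l * x)).
Proof. by have := @continuous_cos_scale R (k - l); under eq_fun do rewrite mulrBl. Qed.

Lemma itg_coscos k l : itg 0 pi (fun x => cos (k%:R * x) * cos (l%:R * x)) =
  if k == l then cosnorm k else 0 :> R.
Proof.
under eq_itg do rewrite cos_mul_cos.
have c1 := @continuous_cosDB k%:R l%:R; have c2 := @continuous_cosBB k%:R l%:R.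
rewrite itgZ ?itgD ?itg_cos_cosB ?itg_cos_cosD//; last exact: continuous_add.
rewrite addn_eq0 /cosnorm; case: (eqVneq k l) => [<-|kl].
  by rewrite andbb; case: eqP => _; field.
rewrite (_ : _ && _ = false) ?addr0 ?mulr0//.
by apply: contra_neqF kl => /andP[/eqP -> /eqP ->].
Qed.

Lemma itg_sinsin k l : itg 0 pi (fun x => sin (k%:R * x) * sin (l%:R * x)) =
  if (k == l) && (k != 0)%N then pi / 2 else 0 :> R.
Proof.
under eq_itg do rewrite sin_mul_sin.
have c1 := @continuous_cosDB k%:R l%:R; have c2 := @continuous_cosBB k%:R l%:R.
rewrite itgZ ?itgB ?itg_cos_cosB ?itg_cos_cosD//; last exact: continuous_sub.
rewrite addn_eq0; case: (eqVneq k l) => [<-|kl].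
  by rewrite andbb; case: eqP => _; rewrite ?subrr ?mulr0 ?subr0// mulrC.
rewrite (_ : _ && _ = false) ?subr0 ?mulr0//.
by apply: contra_neqF kl => /andP[/eqP -> /eqP ->].
Qed.

(** By orthogonality a partial sum that includes index [k] already has this coefficient, and the
    series converges uniformly. *)
Lemma itg_cosser k : itg 0 pi (fun x => cosser a x * cos (k%:R * x)) = a k * cosnorm k.
Proof.
have cc := @continuous_cos_scale R k%:R.
have S n : (k < n)%N -> itg 0 pi (fun x => series (fun k => a k * cos (k%:R * x)) n * cos (k%:R * x))
    = a k * cosnorm k.
  have St m : itg 0 pi (fun x => series (fun k => a k * cos (k%:R * x)) m * cos (k%:R * x)) =
      if (k < m)%N then a k * cosnorm k else 0.
    elim: m => [|m IH].
      rewrite -[RHS](mul0r (pi - 0)) -itg_cst ?pi_ge0//; apply: eq_itg => x _.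
      by rewrite /series /= big_geq// mul0r.
    have -> : itg 0 pi (fun x => series (fun k => a k * cos (k%:R * x)) m.+1 * cos (k%:R * x)) =
      itg 0 pi (fun x => series (fun k => a k * cos (k%:R * x)) m * cos (k%:R * x) +
                a m * (cos (m%:R * x) * cos (k%:R * x))).
      by apply: eq_itg => x _; rewrite /series /= big_nat_recr//= mulrDl mulrA.
    have c1 : continuous (fun x => series (fun k => a k * cos (k%:R * x)) m * cos (k%:R * x)).
      by apply: continuous_mul => //; exact/cospoly_continuous/cospoly_series.
    have c2 : continuous (fun x => cos (m%:R * x) * cos (k%:R * x)).
      by apply: continuous_mul => //; exact: continuous_cos_scale.
    rewrite itgD//; last exact: continuous_scale.
    rewrite itgZ// IH itg_coscos ltnS.
    by case: ltngtP => [||->]; rewrite ?mulr0 ?addr0 ?add0r.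
  by move=> kn; rewrite St kn.
have cf : continuous (fun x => cosser a x * cos (k%:R * x)).
  by apply: continuous_mul => //; exact/ucos_continuous/cosser_ucos.
apply: ler_eps_eq => e e0.
have [|N hN] := @cosser_unif (e / pi); first by rewrite divr_gt0 ?pi_gt0.
have cs : continuous (fun x => series (fun k => a k * cos (k%:R * x)) (maxn N k.+1) * cos (k%:R * x)).
  by apply: continuous_mul => //; exact/cospoly_continuous/cospoly_series.
rewrite -(S (maxn N k.+1)) ?leq_maxr// -itgB//.
rewrite (_ : e = e / pi * (pi - 0)); last by rewrite subr0 divfK// gt_eqF// pi_gt0.
apply: itg_bound; [exact: pi_ge0|exact: continuous_sub|].
move=> x _; rewrite -mulrBl normrM -[leRHS]mulr1; apply: ler_pM => //.
  by apply: hN; exact: leq_maxl.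
exact: cos_max.
Qed.

End Abs.
End CosSeries.

(** * Parseval for sine series on [0, pi] *)

Section Parseval.
Variable R : realType.
Local Notation mu := (@lebesgue_measure R).
Implicit Types (f g q r : R -> R) (x y e : R) (k n N : nat).

Definition sincoef f n : R := itg 0 pi (fun x => f x * sin (n%:R * x)).

(** The sign of sin is 1 on (0, pi), so the constant 1 is an L^2 limit of sine polynomials, although
    these all vanish at 0 and pi. *)
Lemma sgn_sin_L2 e : 0 < e -> exists j, itg 0 pi (fun x => (1 - sgn_iter j (sin x)) ^+ 2) <= e.
Proof.
move=> e0.
have cs j : continuous (fun x => (1 - sgn_iter j (sin x)) ^+ 2 : R).
  have : sinpoly (fun x => sgn_iter j (sin (1%:R * x)) : R) by apply/sinpoly_sgn_iter/sinpoly_sin.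
  move=> /sinpoly_continuous c.
  have c' : continuous (fun x => sgn_iter j (sin x) : R) by move=> x; have := c x; under eq_fun do rewrite mul1r.
  have c'' := continuous_sub (@continuous_const R 1) c'.
  exact: continuous_mul.
pose h x : R := (1 - Num.sg (sin x)) ^+ 2.
have [hi hc] : mu.-integrable `[0, pi] (EFin \o h) /\
    itg 0 pi (fun x => (1 - sgn_iter j (sin x)) ^+ 2) @[j --> \oo] --> itg 0 pi h.
  apply: (itg_dct (g := fun=> 4)).
  - by move=> n; apply: measurable_funTS; exact: continuous_measurable_fun.
  - exact: continuous_integrable_itv (@continuous_const R 4).
  - move=> x _; apply: cvgM; apply: cvgB; try exact: cvg_cst;
      by apply: sgn_iter_cvg; rewrite sin_max.
  - move=> n x _; have := @sgn_iter_le1 R n _ (sin_max x).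
    by rewrite ler_norml normrX => /andP[h1 h2]; rewrite ger0_norm; nra.
have h0 : itg 0 pi h = 0.
  (* [h] vanishes except at 0 and pi; cutting at pi / 2 leaves one exceptional endpoint in each
     half. *)
  have p20 : (0 : R) <= pi / 2 by rewrite divr_ge0 ?pi_ge0.
  have p21 : pi / 2 <= pi :> R by have := pi_ge0 R; lra.
  rewrite (itg_chasles p20 p21 hi).
  have ci : forall a b : R, mu.-integrable `[a, b] (EFin \o (fun=> 0)).
    by move=> a b; exact: continuous_integrable_itv (@continuous_const R 0).
  rewrite (@eq_itg_co _ h (fun=> 0) 0 (pi / 2)) ?itg_cst ?mul0r ?add0r//; last 2 first.
  - exact: integrable_subitv hi.
  - move=> x /andP[x0 x1]; rewrite /h gtr0_sg ?subrr ?expr0n//.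
    by apply: sin_gt0_pi; have := pi_gt0 R; lra.
  rewrite (@eq_itg_oc _ h (fun=> 0) (pi / 2) pi) ?itg_cst ?mul0r//.
  - exact: integrable_subitv hi.
  - move=> x /andP[x0 x1]; rewrite /h gtr0_sg ?subrr ?expr0n//.
    by apply: sin_gt0_pi; have := pi_gt0 R; lra.
rewrite h0 in hc; have /cvgrPdist_le/(_ _ e0)[N _ H] := hc.
by exists N; have := H N (leqnn N); rewrite /= sub0r normrN; apply: le_trans; exact: ler_norm.
Qed.

(** With [p] a sine polynomial close to 1 in L^2 and [q0] a cosine polynomial uniformly close to
    [f], the error is [f (1 - p) + p (f - q0)], where |p| <= 1. *)
Lemma ucos_sinpoly_approx f e : ucos f -> 0 < e ->
  exists2 q, sinpoly q & itg 0 pi (fun x => (f x - q x) ^+ 2) <= e.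
Proof.
move=> uf e0; have cf := ucos_continuous uf.
have [M M0 fM] := @continuous_bounded_itv R f 0 pi cf.
have p0 := pi_gt0 R.
have [j hj] := @sgn_sin_L2 (e / (4 * M ^+ 2)) (divr_gt0 e0 (mulr_gt0 (ltr0n _ 4) (exprn_gt0 _ M0))).
(* [d <= 1] lets [d] majorize its square; the other bound makes the integral of [2 * d] at most e /
   2. *)
pose d : R := Num.min 1 (e / (4 * pi)).
have d0 : 0 < d by rewrite /d lt_min ltr01 divr_gt0// mulr_gt0.
have d1 : d <= 1 by rewrite /d ge_min lexx.
have d2 : d <= e / (4 * pi) by rewrite /d ge_min lexx orbT.
have [q0 cq0 hq0] := uf _ d0.
pose p x : R := sgn_iter j (sin (1%:R * x)).
have sp : sinpoly p by apply/sinpoly_sgn_iter/sinpoly_sin.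
have spq := sinpolyM sp cq0.
exists (fun x => p x * q0 x) => //.
have cp := sinpoly_continuous sp.
have cpq := sinpoly_continuous spq.
have c1 : continuous (fun x => (1 - p x) ^+ 2).
  by have c := continuous_sub (@continuous_const R 1) cp; exact: (continuous_mul c c).
have cl : continuous (fun x => (f x - p x * q0 x) ^+ 2).
  by have c := continuous_sub cf cpq; exact: (continuous_mul c c).
have cr := continuous_add (@continuous_scale R (2 * M ^+ 2) _ c1) (@continuous_const R (2 * d)).
apply: (le_trans (le_itg cl cr _)).
  move=> x /fM; have := hq0 x; have := @sgn_iter_le1 R j _ (sin_max (1%:R * x)).
  rewrite -/(p x); move: (p x) (f x) (q0 x) => p1 f1 q1 h1 h2 h3.
  have -> : f1 - p1 * q1 = f1 * (1 - p1) + p1 * (f1 - q1) by ring.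
  have s1 : (f1 * (1 - p1) + p1 * (f1 - q1)) ^+ 2 <= 2 * (f1 * (1 - p1)) ^+ 2 + 2 * (p1 * (f1 - q1)) ^+ 2.
    by have := sqr_ge0 (f1 * (1 - p1) - p1 * (f1 - q1)); lra.
  apply: (le_trans s1); apply: lerD.
    rewrite exprMn mulrA ler_wpM2r ?sqr_ge0// ler_pM2l//.
    by rewrite -[f1 ^+ 2]real_normK ?num_real// lerXn2r// nnegrE ltW.
  rewrite ler_pM2l// -real_normK ?num_real// normrM.
  have : `|p1| * `|f1 - q1| <= 1 * d by apply: ler_pM.
  rewrite mul1r => h; apply: (@le_trans _ _ (d ^+ 2)); first by rewrite lerXn2r// nnegrE ?mulr_ge0// ltW.
  by rewrite expr2 ler_piMr// ltW.
rewrite itgD ?itgZ ?itg_cst ?pi_ge0// ?subr0//; last 2 first.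
- exact: continuous_scale.
- exact: continuous_const.
have hj' : itg 0 pi (fun x => (1 - p x) ^+ 2) <= e / (4 * M ^+ 2).
  have -> // : itg 0 pi (fun x => (1 - p x) ^+ 2) = itg 0 pi (fun x => (1 - sgn_iter j (sin x)) ^+ 2).
  by apply: eq_itg => x _; rewrite /p mul1r.
have h1 : 2 * M ^+ 2 * itg 0 pi (fun x => (1 - p x) ^+ 2) <= e / 2.
  apply: (le_trans (ler_wpM2l _ hj')); first by rewrite mulr_ge0// sqr_ge0.
  by rewrite le_eqVlt; apply/orP; left; apply/eqP; field; rewrite gt_eqF.
have h2 : 2 * d * pi <= e / 2.
  rewrite mulrAC; apply: (le_trans (ler_wpM2l _ d2)); first by rewrite mulr_ge0// ltW.
  by rewrite le_eqVlt; apply/orP; left; apply/eqP; move: (@pi R) (pi_gt0 R) => P P0; field; rewrite gt_eqF.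
lra.
exact: continuous_const.
Qed.

Section Projection.
Variable f : R -> R.
Hypothesis cf : continuous f.

Definition sinsum N x : R := \sum_(n < N) (2 / pi * sincoef f n) * sin (n%:R * x).

Lemma sinsum_sinpoly N : sinpoly (sinsum N).
Proof.
elim: N => [|N IH].
  by apply: sinpoly_ext (sinpolyZ 0 (sinpoly_sin _ 0)) _ => x; rewrite /sinsum big_ord0 mul0r.
apply: sinpoly_ext (sinpolyD IH (sinpolyZ (2 / pi * sincoef f N) (sinpoly_sin _ N))) _ => x.
by rewrite /sinsum big_ord_recr.
Qed.

Lemma sinsum_continuous N : continuous (sinsum N).
Proof. exact: sinpoly_continuous (sinsum_sinpoly N). Qed.

Lemma itg_sinsum g N : continuous g ->
  itg 0 pi (fun x => sinsum N x * g x) = 2 / pi * \sum_(n < N) sincoef f n * sincoef g n.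
Proof.
move=> cg; elim: N => [|N IH].
  rewrite big_ord0 mulr0 -[RHS](mul0r (pi - 0)) -itg_cst ?pi_ge0//; apply: eq_itg => x _.
  by rewrite /sinsum big_ord0 mul0r.
rewrite big_ord_recr/= mulrDr -IH.
have -> : itg 0 pi (fun x => sinsum N.+1 x * g x) =
  itg 0 pi (fun x => sinsum N x * g x + (2 / pi * sincoef f N) * (g x * sin (N%:R * x))).
  by apply: eq_itg => x _; rewrite /sinsum big_ord_recr/= mulrDl; congr (_ + _); ring.
have cN := @sinsum_continuous N; have cs := @continuous_sin_scale R N%:R.
have c1 := continuous_mul cN cg; have c2 := continuous_mul cg cs.
rewrite itgD//; last exact: continuous_scale.
by rewrite itgZ// mulrA.
Qed.

Lemma sincoef_sinsum N k : (k < N)%N -> sincoef (sinsum N) k = sincoef f k.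
Proof.
move=> kN; rewrite /sincoef itg_sinsum; last exact: continuous_sin_scale.
rewrite (bigD1 (Ordinal kN))//= big1 ?addr0.
  rewrite {2}/sincoef itg_sinsin eqxx /=; case: eqVneq => [->|k0] /=.
    rewrite mulr0 mulr0 /sincoef -[LHS](mul0r (pi - 0)) -itg_cst ?pi_ge0//; apply: eq_itg => x _.
    by rewrite mul0r sin0 mulr0.
  rewrite -/(sincoef f k); move: (sincoef f k) (@pi R) (pi_gt0 R) => c P P0.
  by field; apply: lt0r_neq0.
move=> i ik; rewrite {2}/sincoef itg_sinsin.
have -> : (k == i :> nat) = false by apply/negbTE; apply: contra_neq ik => ki; apply: val_inj => /=; exact: esym.
by rewrite eq_sym /= mulr0.
Qed.

End Projection.

Lemma sinpoly_orth f q : continuous f -> sinpoly q -> exists N0, forall N, (N0 <= N)%N ->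
  itg 0 pi (fun x => (f x - sinsum f N x) * q x) = 0.
Proof.
move=> cf; have cr N : continuous (fun x => f x - sinsum f N x).
  by apply: continuous_sub => //; exact: sinsum_continuous.
elim=> [k|q1 q2 s1 [N1 IH1] s2 [N2 IH2]|c q1 s1 [N1 IH1]].
- exists k.+1 => N kN.
  have cs := @continuous_sin_scale R k%:R; have cN := @sinsum_continuous f N.
  under eq_itg do rewrite mulrBl.
  by rewrite itgB; [rewrite -/(sincoef f k) -/(sincoef (sinsum f N) k) sincoef_sinsum// subrr|exact: continuous_mul..].
- exists (maxn N1 N2) => N; rewrite geq_max => /andP[h1 h2].
  have c1 := sinpoly_continuous s1; have c2 := sinpoly_continuous s2.
  under eq_itg do rewrite mulrDr.
  by rewrite itgD ?IH1 ?IH2 ?addr0//; exact: continuous_mul.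
- exists N1 => N h1; have c1 := sinpoly_continuous s1.
  under eq_itg do rewrite mulrCA.
  by rewrite itgZ ?IH1 ?mulr0//; exact: continuous_mul.
Qed.

Lemma sinsum_orth f N : continuous f ->
  itg 0 pi (fun x => (f x - sinsum f N x) * sinsum f N x) = 0.
Proof.
move=> cf; have cN := @sinsum_continuous f N.
under eq_itg do rewrite mulrC mulrBr.
rewrite itgB; [|exact: continuous_mul..].
rewrite !itg_sinsum//; apply/eqP; rewrite subr_eq0; apply/eqP; congr (_ * _).
by apply: eq_bigr => i _; rewrite sincoef_sinsum.
Qed.

(* The sine polynomials p_j(sin x) q(x), with q a cosine polynomial close to f,
   approximate f in L^2(0, pi). *)
Lemma sine_parseval f g : ucos f -> continuous g ->
  2 / pi * (\sum_(n < N) sincoef f n * sincoef g n) @[N --> \oo] --> itg 0 pi (fun x => f x * g x).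
Proof.
move=> uf cg; have cf := ucos_continuous uf.
apply/cvgrPdist_le => e e0.
have cgg := continuous_mul cg cg.
set G := itg 0 pi (fun x => g x * g x) + 1.
have G0 : 0 < G by rewrite ltr_wpDl// itg_ge0// => x _; rewrite -expr2 sqr_ge0.
have d0 : 0 < e / G by rewrite divr_gt0.
have [q sq hq] := ucos_sinpoly_approx uf (mulr_gt0 d0 e0).
have cq := sinpoly_continuous sq.
have [N0 hN] := sinpoly_orth cf sq.
exists N0 => // N NN; rewrite /= -itg_sinsum//.
have cN := @sinsum_continuous f N.
have cr := continuous_sub cf cN.
have cfg := continuous_mul cf cg; have cNg := continuous_mul cN cg.
rewrite -itgB//.
have [d dE] : {d | d = e / G} by exists (e / G).
rewrite -dE in d0 hq.
set r := fun x => f x - sinsum f N x.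
have crr := continuous_mul cr cr.
have crs : forall q', continuous q' -> continuous (fun x => r x * q' x) by move=> q' c'; exact: continuous_mul.
have r2 : itg 0 pi (fun x => r x * r x) <= d * e.
  apply: le_trans hq.
  (* The residual is orthogonal to the partial sum and, for N large, to [q]; so the partial sum
     approximates at least as well as [q]. *)
  have e1 : itg 0 pi (fun x => r x * r x) = itg 0 pi (fun x => r x * (f x - q x)).
    have -> : itg 0 pi (fun x => r x * r x) = itg 0 pi (fun x => r x * f x - r x * sinsum f N x).
      by apply: eq_itg => x _; rewrite -mulrBr.
    under [RHS]eq_itg do rewrite mulrBr.
    by rewrite !itgB; [rewrite sinsum_orth// hN|exact: crs..].
  have cfq := continuous_sub cf cq; have cfq2 := continuous_mul cfq cfq.
  have : itg 0 pi (fun x => r x * (f x - q x)) <=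
      itg 0 pi (fun x => 2^-1 * (r x * r x) + 2^-1 * ((f x - q x) * (f x - q x))).
    apply: le_itg; [exact: crs| |].
      by apply: continuous_add; exact: continuous_scale.
    by move=> x _; have := sqr_ge0 (r x - (f x - q x)); lra.
  rewrite itgD ?itgZ//; [|exact: continuous_scale..].
  rewrite -e1 (_ : itg 0 pi (fun x => (f x - q x) * (f x - q x)) = itg 0 pi (fun x => (f x - q x) ^+ 2)).
    by lra.
  by apply: eq_itg => x _; rewrite expr2.
have -> : itg 0 pi (fun x => f x * g x - sinsum f N x * g x) = itg 0 pi (fun x => r x * g x).
  by apply: eq_itg => x _; rewrite -mulrBl.
(* Young's inequality with weight [d] in place of Cauchy-Schwarz: |r|^2 <= d e makes the first term
   at most e / 2, and d = e / G does the same for the second. *)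
have bnd s : s = 1 \/ s = -1 -> s * itg 0 pi (fun x => r x * g x) <= e.
  move=> hs; rewrite -itgZ; last exact: crs.
  have : itg 0 pi (fun x => s * (r x * g x)) <=
      itg 0 pi (fun x => (2 * d)^-1 * (r x * r x) + d / 2 * (g x * g x)).
    apply: le_itg; [by apply: continuous_scale; exact: crs| |].
      by apply: continuous_add; exact: continuous_scale.
    move=> x _; have := sqr_ge0 (r x - d * (s * g x)).
    have ss : s * s = 1 by case: hs => ->; lra.
    have -> : (r x - d * (s * g x)) ^+ 2 = r x * r x - 2 * d * (s * (r x * g x)) + d ^+ 2 * (s * s) * (g x * g x) by ring.
    rewrite ss mulr1 => h.
    have -> : (2 * d)^-1 * (r x * r x) + d / 2 * (g x * g x) =
      (2 * d)^-1 * (r x * r x + d ^+ 2 * (g x * g x)) by field; rewrite gt_eqF.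
    by rewrite [leRHS]mulrC ler_pdivlMr ?mulr_gt0//; lra.
  move/le_trans; apply; rewrite itgD ?itgZ//; [|exact: continuous_scale..].
  have h1 : (2 * d)^-1 * itg 0 pi (fun x => r x * r x) <= e / 2.
    rewrite mulrC ler_pdivrMr ?mulr_gt0// (le_trans r2)//.
    by lra.
  have h2 : d / 2 * itg 0 pi (fun x => g x * g x) <= e / 2.
    have h : itg 0 pi (fun x => g x * g x) <= G by rewrite lerDl.
    apply: (le_trans (ler_wpM2l _ h)); first by rewrite divr_ge0// ltW.
    by rewrite dE le_eqVlt; apply/orP; left; apply/eqP; field; apply: lt0r_neq0.
  lra.
rewrite ler_norml; have := bnd 1 (or_introl erefl); have := bnd (-1) (or_intror erefl); lra.
Qed.

End Parseval.

(** * Functions with almost everywhere vanishing derivative *)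

Section NullDerivative.
Variable R : realType.
Local Notation mu := (@lebesgue_measure R).
Implicit Types (f : R -> R) (a b c x y e : R) (U N : set R).

Lemma measure_lt_itv_cap U a x e : measurable U -> (mu U < e%:E)%E ->
  exists2 r, (mu (U `&` `]a, x])) = r%:E & 0 <= r <= e.
Proof.
move=> mU Ue.
have h : (mu (U `&` `]a, x]) <= mu U)%E.
  by apply: le_measure; rewrite ?inE//; exact: measurableI.
have h0 : (0 <= mu (U `&` `]a, x]))%E by exact: measure_ge0.
have hf : mu (U `&` `]a, x]) \is a fin_num.
  by rewrite ge0_fin_numE// (le_lt_trans h)// (lt_trans Ue)// ltry.
exists (fine (mu (U `&` `]a, x]))); first by rewrite fineK.
rewrite fine_ge0//= -lee_fin fineK//; exact: le_trans h (ltW Ue).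
Qed.

Definition cap_length U a x : R := fine (mu (U `&` `]a, x])).

Lemma cap_length_diff U a x y e : measurable U -> (mu U < e%:E)%E -> a <= x -> x <= y ->
  exists2 r, mu (U `&` `]x, y]) = r%:E & cap_length U a y = cap_length U a x + r /\ 0 <= r.
Proof.
move=> mU Ue ax xy.
have [r rE /andP[r0 re]] := measure_lt_itv_cap x y mU Ue.
have [r1 r1E _] := measure_lt_itv_cap a x mU Ue.
exists r => //; split => //; rewrite /cap_length r1E/=.
rewrite (_ : `]a, y]%classic = `]a, x] `|` `]x, y]); last first.
  by rewrite -itv_bndbnd_setU// bnd_simp.
rewrite setIUr (_ : mu _ = (r1%:E + r%:E)%E)//.
rewrite -r1E -rE; apply: measureU; try exact: measurableI.
by apply/seteqP; split => // z [[_ /=]]; rewrite in_itv/= => /andP[_ zx] [_ /=]; rewrite in_itv/= ltNge zx.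
Qed.

Lemma sum_geo_le e M : 0 <= e -> \sum_(n < M) e / 2 ^+ n.+1 <= e.
Proof.
move=> e0.
suff -> : \sum_(n < M) e / 2 ^+ n.+1 = e - e / 2 ^+ M by rewrite gerBl divr_ge0// exprn_ge0.
elim: M => [|M IH]; first by rewrite big_ord0 expr0 divr1 subrr.
rewrite big_ord_recr/= IH exprS; field.
by rewrite expf_neq0.
Qed.

(* On the null set, f' is dominated by a weighted sum of measures of small open
   neighbourhoods, one for each bound n on f'; the increment of f is then
   controlled by real induction. *)
Lemma ae_derive0_le f a b e : a < b -> 0 < e -> (forall x, derivable f x 1) ->
  {ae mu, forall x, a < x < b -> derive1 f x = 0} -> f b - f a <= e * (b - a) + e.
Proof.
move=> ab e0 df [A [mA A0 sA]].
have {mA A0 sA} {A} [A [mA A0 sA]] : exists A : set R, [/\ measurable A, mu A = 0 &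
  ~` [set x | a < x < b -> derive1 f x = 0] `<=` A] by exists A.
(* The hypothesis says nothing about [a], where the induction starts; so [a] is counted as
   exceptional. *)
pose N := A `|` [set a].
have mN : measurable N by apply: measurableU => //; exact: measurable_set1.
have N0 : mu N = 0.
  have h : mu.-negligible N -> mu N = 0.
    by move=> [B [mB B0 NB]]; apply/eqP; rewrite eq_le measure_ge0 andbT -B0; apply: le_measure; rewrite ?inE.
  apply: h; apply: negligibleU; first by exists A; split.
  by exists [set a]; split => //; exact: lebesgue_measure_set1.
have offN x : a <= x < b -> ~ N x -> derive1 f x = 0.
  move=> /andP[ax xb] nN; move: ax; rewrite le_eqVlt => /predU1P[ax|ax].
    by case: nN; right; rewrite ax.
  apply: contrapT => h; apply: nN; left; apply: sA => /= H; apply: h.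
  by apply: H; rewrite ax xb.
(* With these weights the sum of (n + 1) times the measure of [G n] stays below e. *)
pose w n : R := e / 2 ^+ n.+1 / n.+1%:R.
have w0 n : 0 < w n by rewrite !divr_gt0// exprn_gt0.
have Gex n : exists U, [/\ open U, N `<=` U & (mu U < (w n)%:E)%E].
  have hN : (mu N < +oo)%E by rewrite N0.
  have [U [oU NU hU]] := lebesgue_regularity_outer mN hN (w0 n).
  exists U; split => //; have mU := open_measurable oU.
  have e1 : mu U = (mu (U `\` N) + mu (U `&` N))%E := @measureDI _ _ _ mu U N mU mN.
  rewrite e1; apply: le_lt_trans hU.
  rewrite -[leRHS]adde0 leeD2l// -N0; apply: le_measure; rewrite ?inE//.
  - exact: measurableI.
have [G HG] := choice Gex.
have mG n : measurable (G n) by case: (HG n) => /open_measurable.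
have Gw n : (mu (G n) < (w n)%:E)%E by case: (HG n).
pose S M x : R := \sum_(n < M) n.+1%:R * cap_length (G n) a x.
have Sb M x : S M x <= e.
  apply: le_trans (sum_geo_le M (ltW e0)); apply: ler_sum => n _.
  have [r rE /andP[_ re]] := measure_lt_itv_cap a x (mG n) (Gw n).
  rewrite /cap_length rE/= (le_trans (ler_wpM2l _ re))// /w.
  by rewrite mulrC divfK// pnatr_eq0.
have S0 x M : 0 <= S M x.
  apply: sumr_ge0 => n _; apply: mulr_ge0 => //.
  by have [r rE /andP[r0 _]] := measure_lt_itv_cap a x (mG n) (Gw n); rewrite /cap_length rE.
have Smono M x y : a <= x -> x <= y -> S M x <= S M y.
  move=> ax xy; apply: ler_sum => n _; apply: ler_wpM2l => //.
  by have [r _ [-> r0]] := cap_length_diff (mG n) (Gw n) ax xy; rewrite lerDl.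
have Snd x : {homo S^~ x : M M' / (M <= M')%N >-> M <= M'}.
  apply/nondecreasing_seqP => M; rewrite /S big_ord_recr/= lerDl mulr_ge0//.
  by have [r rE /andP[r0 _]] := measure_lt_itv_cap a x (mG M) (Gw M); rewrite /cap_length rE.
have Scv x : cvgn (S^~ x).
  by apply: nondecreasing_is_cvgn => //; exists e => _ [M _ <-].
pose P x := limn (S^~ x).
have Pb x : P x <= e by apply: limr_le => //; exact: nearW.
have Pmono x y : a <= x -> x <= y -> P x <= P y.
  by move=> ax xy; apply: ler_lim => //; apply: nearW => M; exact: Smono.
have P0 x : 0 <= P x by apply: limr_ge => //; exact: nearW.
(* Inside [G m], [P] rises with slope at least m + 1: this pays for a derivative smaller than m + 1
   at a point of the exceptional set. *)
have Pinc m x y : a <= x -> x <= y -> `]x, y]%classic `<=` G m -> P x + m.+1%:R * (y - x) <= P y.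
  move=> ax xy sG.
  have cm : (fun M => S M x + m.+1%:R * (y - x)) @ \oo --> P x + m.+1%:R * (y - x).
    by apply: cvgD; [exact: Scv|exact: cvg_cst].
  rewrite -(cvg_lim _ cm)//; apply: ler_lim => //; first by apply/cvg_ex; eexists; exact: cm.
  exists m.+1 => // M /= mM.
  have -> : m = Ordinal mM :> nat by [].
  rewrite /S (bigD1 (Ordinal mM))//= [leRHS](bigD1 (Ordinal mM))//= addrAC lerD//.
    rewrite -mulrDr ler_wpM2l//.
    have [r rE [-> _]] := cap_length_diff (mG m) (Gw m) ax xy.
    rewrite lerD2l -lee_fin -rE (setIidr sG) lebesgue_measure_itv/= lte_fin.
    by move: xy; rewrite le_eqVlt => /predU1P[->|->]; rewrite ?ltxx ?subrr// EFinN EFinB.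
  apply: ler_sum => n _; apply: ler_wpM2l => //.
  by have [r _ [-> r0]] := cap_length_diff (mG n) (Gw n) ax xy; rewrite lerDl.
have fc : continuous f.
  by move=> x; apply: differentiable_continuous; exact/derivable1_diffP.
(* The supremum [c] of [E] lies in [E] by continuity of [f] and monotonicity of [P]; if [c < b], the
   bound can be pushed past [c]. *)
pose E := [set x | a <= x <= b /\ f x - f a <= e * (x - a) + P x].
have Ea : E a by rewrite /E/= lexx (ltW ab) !subrr mulr0 add0r.
have hE : has_sup E by split; [exists a|exists b => x [/andP[]]].
pose c := sup E.
have ac : a <= c by apply: ub_le_sup => //; exact: hE.2.
have cb : c <= b by apply: ge_sup; [exists a|move=> x [/andP[]]].
have Ec : E c.
  split; first by rewrite ac cb.
  apply/ler_addgt0Pl => d d0.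
  have /cvgrPdist_lt/(_ _ d0)/nbhs_ballP[r /= r0 hr] := fc c.
  have [x Ex cx] := sup_adherent r0 hE.
  have xc : x <= c by apply: ub_le_sup => //; exact: hE.2.
  have [/andP[ax xb] hx] := Ex.
  have : ball c r x.
    by rewrite /ball/= ger0_norm ?subr_ge0// -/c in cx *; rewrite ltrBlDl -ltrBlDr.
  move=> /hr; rewrite ltr_norml => /andP[_ h].
  have h1 := Pmono _ _ ax xc.
  have h2 : e * (x - a) <= e * (c - a) by rewrite ler_pM2l// lerD2r.
  by lra.
suff cE : c = b by move: Ec => [_]; rewrite cE; have := Pb b; lra.
apply/eqP; rewrite eq_le cb /= leNgt; apply/negP => {}cb.
have dfc : is_derive c (1:R) f (derive1 f c) by rewrite derive1E; exact: derivableP.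
have step k : derive1 f c < k -> exists2 r, 0 < r & forall y, c < y < c + r -> f y - f c <= k * (y - c).
  move=> ck.
  have : h^-1 *: (f (h *: (1:R) + c) - f c) @[h --> 0^'] --> derive1 f c.
    have := df c; rewrite derive1E => hd; exact: hd.
  move=> /cvgrPdist_lt/(_ (k - derive1 f c)); rewrite subr_gt0 => /(_ ck).
  move=> /nbhs_ballP[r /= r0 hr]; exists r => // y /andP[cy ycr].
  have yc0 : 0 < y - c by rewrite subr_gt0.
  have := hr (y - c); rewrite /ball/= sub0r normrN gtr0_norm// ltrBlDl => /(_ ycr).
  rewrite gt_eqF// => /(_ isT).
  rewrite /GRing.scale/= mulr1 subrK ltr_norml => /andP[h _].
  have : (y - c)^-1 * (f y - f c) < k by lra.
  by rewrite mulrC ltr_pdivrMr// => /ltW.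
have key y : c < y -> y <= b -> f y - f c <= e * (y - c) + (P y - P c) -> False.
  move=> cy yb hy; suff : y <= c by rewrite leNgt cy.
  apply: ub_le_sup; first exact: hE.2.
  split; first by rewrite yb (le_trans ac (ltW cy)).
  by move: Ec => [_]; lra.
(* Off [N] the derivative is 0, so slope e suffices just after [c]. On [N] a slope m + 1 above the
   derivative is absorbed by the growth of [P]. *)
have [Nc|nNc] := pselect (N c); last first.
  have [|r r0 hr] := step e; first by rewrite offN// ac cb.
  pose y := Num.min (c + r / 2) b.
  have cy : c < y by rewrite /y lt_min cb andbT ltrDl divr_gt0.
  have yb : y <= b by rewrite /y ge_min lexx orbT.
  have yr : y < c + r by rewrite /y gt_min ltrD2l ltr_pdivrMr// mulr2n mulrDr mulr1 ltrDl r0.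
  apply: (key y) => //; have := hr y; rewrite cy yr => /(_ isT).
  by have := Pmono _ _ ac (ltW cy); lra.
pose m := Num.truncn `|derive1 f c|.
have hm : derive1 f c < m.+1%:R by rewrite (le_lt_trans (ler_norm _))// Num.Theory.truncnS_gt.
have [r r0 hr] := step _ hm.
have [oG NG _] := HG m.
have /nbhs_ballP[r' /= r'0 hr'] : nbhs c (G m) by apply: open_nbhs_nbhs; split => //; exact: NG.
pose y := Num.min (Num.min (c + r / 2) (c + r' / 2)) b.
have cy : c < y by rewrite /y !lt_min cb andbT !ltrDl !divr_gt0.
have yb : y <= b by rewrite /y ge_min lexx orbT.
have yr : y < c + r by rewrite /y !gt_min ltrD2l ltr_pdivrMr// mulr2n mulrDr mulr1 ltrDl r0.
have yr' : y < c + r' by rewrite /y !gt_min !ltrD2l !ltr_pdivrMr// !mulr2n !mulrDr !mulr1 !ltrDl r'0 orbT.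
apply: (key y) => //; have := hr y; rewrite cy yr => /(_ isT) h.
have hi : P c + m.+1%:R * (y - c) <= P y.
  apply: Pinc => //; first exact: ltW.
  move=> z /=; rewrite in_itv/= => /andP[cz zy]; apply: hr'.
  by rewrite /ball/= ltr0_norm ?subr_lt0// opprB ltrBlDl (le_lt_trans zy).
have : 0 <= e * (y - c) by rewrite mulr_ge0// ?subr_ge0 ltW.
lra.
Qed.

Lemma ae_derive0_cst f a b : a <= b -> (forall x, derivable f x 1) ->
  {ae mu, forall x, a < x < b -> derive1 f x = 0} -> f b = f a.
Proof.
rewrite le_eqVlt => /predU1P[->//|ab] df f0.
have aux (g : R -> R) : (forall x, derivable g x 1) -> {ae mu, forall x, a < x < b -> derive1 g x = 0} -> g b <= g a.
  move=> dg g0; rewrite -subr_le0; apply/ler_addgt0Pl => e e0; rewrite addr0.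
  have ba : 0 < b - a + 1 by rewrite ltr_wpDl// subr_ge0 ltW.
  (* With this choice the two error terms, proportional to b - a and to 1, add up to e. *)
  have := @ae_derive0_le g a b (e / (b - a + 1)) ab (divr_gt0 e0 ba) dg g0.
  move/le_trans; apply; rewrite -[X in _ + X]mulr1 -mulrDr divfK// gt_eqF//.
apply/eqP; rewrite eq_le aux//= -lerN2.
apply: (aux (fun x => - f x)).
  by move=> x; exact: derivableN.
apply: ae_mono f0 => x fx xab; rewrite derive1E.
have dfx : is_derive x (1:R) f 0 by rewrite -(fx xab) derive1E; exact: derivableP.
by have := is_deriveN dfx => -[_ ->]; rewrite oppr0.
Qed.

End NullDerivative.

(** * Bounded measurable functions: reflection and exchange of integrals *)

Section MeasurableBounded.
Variable R : realType.
Local Notation mu := (@lebesgue_measure R).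
Implicit Types (f : R -> R) (a b c d x y : R).

Lemma lebesgue_itv_fin a b : (mu `[a, b] < +oo)%E.
Proof. by rewrite lebesgue_measure_itv/=; case: ifP => // _; exact: ltry. Qed.

Lemma bounded_measurable_integrable f a b M : measurable_fun `[a, b] f ->
  (forall x, a <= x <= b -> `|f x| <= M) -> mu.-integrable `[a, b] (EFin \o f).
Proof.
move=> mf fM; apply: measurable_bounded_integrable => //.
  exact: lebesgue_itv_fin.
exists M; split; first by rewrite num_real.
by move=> y My x /=; rewrite in_itv/= => xab; rewrite (le_trans (fM _ xab))// ltW.
Qed.

Lemma itg_norm_le f a b M : a <= b -> measurable_fun `[a, b] f ->
  (forall x, a <= x <= b -> `|f x| <= M) -> `|itg a b f| <= M * (b - a).
Proof.
move=> ab mf fM; have fi := bounded_measurable_integrable mf fM.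
rewrite -itg_cst//; apply: le_trans (le_normr_Rintegral _ fi) _ => //.
apply: le_Rintegral => //.
- exact: (integrable_norm fi).
- exact: continuous_integrable_itv (@continuous_const R M).
Qed.

Lemma itg_opp_measurable f a b : measurable_fun `[- b, - a] f ->
  mu.-integrable `[a, b] (EFin \o (fun x => f (- x))) ->
  itg (- b) (- a) f = itg a b (fun x => f (- x)).
Proof.
move=> mf fi; rewrite /itg /Rintegral; congr fine.
pose g := f \_ `[- b, - a].
have mg : measurable_fun setT g by apply: (measurable_restrictT _ _).1.
have pre : (-%R : R -> measurableTypeR R) @^-1` `[- b, - a]%classic = `[a, b]%classic.
  by apply/seteqP; split => x /=; rewrite !in_itv/= !lerN2 andbC.
have ge x : `[a, b]%classic x -> g (- x) = f (- x).
  by rewrite /= in_itv/= => /andP[ax xb]; rewrite /g patchE mem_set//= in_itv/= !lerN2 ax xb.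
transitivity (\int[mu]_(x in `[(- b)%R, (- a)%R]) (EFin \o g) x)%E.
  by apply: eq_integral => x xD; rewrite /= /g patchE xD.
transitivity (\int[pushforward mu (-%R : R -> measurableTypeR R)]_(x in `[(- b)%R, (- a)%R]) (EFin \o g) x)%E.
  by apply: eq_measure_integral => A mA _; apply/esym; exact: lebesgue_measureN.
rewrite integral_pushforward//=.
- by rewrite pre; apply: eq_integral => x; rewrite inE => xD; rewrite /= ge.
- exact/measurable_EFinP.
- by rewrite pre; apply: eq_integrable fi => // x; rewrite inE => xD; rewrite /= ge.
Qed.

(** A bounded kernel is integrable on a rectangle of finite measure; extended by zero, it falls
    under Fubini on the whole plane. *)
Lemma itg_fubini (k : R * R -> R) a b c d M : measurable_fun setT k ->
  (forall x s, a <= x <= b -> c <= s <= d -> `|k (x, s)| <= M) ->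
  itg a b (fun x => itg c d (fun s => k (x, s))) =
  itg c d (fun s => itg a b (fun x => k (x, s))).
Proof.
move=> mk kM.
pose A := `[a, b]%classic `*` `[c, d]%classic.
have mA : measurable A by exact: measurableX.
have ki : (mu \x mu)%E.-integrable setT ((EFin \o k) \_ A).
  apply/integrable_restrict => //; rewrite setTI.
  apply: measurable_bounded_integrable => //.
  - suff : ((mu \x mu) A < +oo)%E by [].
    by rewrite /A product_measure1E// lte_mul_pinfty// ?ge0_fin_numE// lebesgue_itv_fin.
  - exact: measurable_funTS.
  - exists M; split; first by rewrite num_real.
    move=> y My [x s] [/=]; rewrite !in_itv/= => xab scd.
    by rewrite (le_trans (kM _ _ xab scd))// ltW.
have mk1 x : measurable_fun setT (fun s => k (x, s)) by apply: (measurableT_comp mk); exact: pair1_measurable.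
have mk2 s : measurable_fun setT (fun x => k (x, s)) by apply: (measurableT_comp mk); exact: pair2_measurable.
have := Fubini ki.
have -> : (\int[mu]_x \int[mu]_y ((EFin \o k) \_ A) (x, y) =
    \int[mu]_(x in `[a, b]) (itg c d (fun s => k (x, s)))%:E)%E.
  rewrite [RHS]integral_mkcond; apply: eq_integral => x _.
  rewrite patchE; case: ifPn => xab.
    have xab' : a <= x <= b by move: xab; rewrite inE/= in_itv.
    rewrite /itg /Rintegral fineK; last first.
      apply: integrable_fin_num => //; apply: (@bounded_measurable_integrable _ c d M).
        exact: measurable_funTS.
      by move=> s; exact: kM.
    rewrite [RHS]integral_mkcond; apply: eq_integral => s _.
    rewrite !patchE; case: ifPn => sA; case: ifPn => sB //.
      by move: sA sB; rewrite inE => -[_ /=] h; rewrite notin_setE.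
    by move: sA; rewrite notin_setE; case; split; [rewrite inE in xab|rewrite inE in sB].
  apply: integral0_eq => s _; rewrite patchE; case: ifPn => // sA.
  by move: sA xab; rewrite inE => -[h _]; rewrite notin_setE.
have -> : (\int[mu]_y \int[mu]_x ((EFin \o k) \_ A) (x, y) =
    \int[mu]_(s in `[c, d]) (itg a b (fun x => k (x, s)))%:E)%E.
  rewrite [RHS]integral_mkcond; apply: eq_integral => s _.
  rewrite patchE; case: ifPn => scd.
    have scd' : c <= s <= d by move: scd; rewrite inE/= in_itv.
    rewrite /itg /Rintegral fineK; last first.
      apply: integrable_fin_num => //; apply: (@bounded_measurable_integrable _ a b M).
        exact: measurable_funTS.
      by move=> x xab; exact: kM.
    rewrite [RHS]integral_mkcond; apply: eq_integral => x _.
    rewrite !patchE; case: ifPn => sA; case: ifPn => sB //.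
      by move: sA sB; rewrite inE => -[h _ /=]; rewrite notin_setE.
    by move: sA; rewrite notin_setE; case; split; [rewrite inE in sB|rewrite inE in scd].
  apply: integral0_eq => x _; rewrite patchE; case: ifPn => // sA.
  by move: sA scd; rewrite inE => -[_ h]; rewrite notin_setE.
by rewrite /itg /Rintegral => ->.
Qed.

End MeasurableBounded.

(** * The kernel cot (s / 2) *)

Section Hilbert.
Variable R : realType.
Local Notation mu := (@lebesgue_measure R).
Implicit Types (x y s u : R) (j n : nat).

Definition cothalf s : R := cos (s / 2) / sin (s / 2).

(** A pointwise limit of the continuous functions cos sin / (sin^2 + 1 / (n + 1)) at s / 2; where
    the sine vanishes, the limit 0 is also the junk value of the quotient. *)
Lemma cothalf_measurable : measurable_fun setT cothalf.
Proof.
have cs : continuous (fun s : R => sin (s / 2)).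
  by have := @continuous_sin_scale R 2^-1; under eq_fun do rewrite mulrC.
have cc : continuous (fun s : R => cos (s / 2)).
  by have := @continuous_cos_scale R 2^-1; under eq_fun do rewrite mulrC.
pose den n s : R := sin (s / 2) * sin (s / 2) + n.+1%:R^-1.
have den0 n s : 0 < den n s by rewrite ltr_wpDl// -expr2 sqr_ge0.
have cden n : continuous (den n).
  by apply: continuous_add; [exact: continuous_mul|exact: continuous_const].
apply: (measurable_fun_cvg (h := fun n s => cos (s / 2) * sin (s / 2) * (den n s)^-1)).
  move=> n; apply: continuous_measurable_fun.
  have cV : continuous (fun s => (den n s)^-1).
    by move=> s; apply: (continuousV _ (cden n s)); rewrite gt_eqF.
  exact: (continuous_mul (continuous_mul cc cs) cV).
move=> s _; rewrite /cothalf; have [s0|s0] := eqVneq (sin (s / 2)) 0.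
  by rewrite s0 invr0 !mulr0; under eq_fun do rewrite mul0r; exact: cvg_cst.
have -> : cos (s / 2) / sin (s / 2) = cos (s / 2) * sin (s / 2) * (sin (s / 2) * sin (s / 2) + 0)^-1.
  by rewrite addr0; field.
apply: cvgM; first exact: cvg_cst.
apply: cvgV; first by rewrite addr0 mulf_neq0.
by apply: cvgD; [exact: cvg_cst|exact: cvg_harmonic].
Qed.

(** The derivative of sin v - v cos v is v sin v, nonnegative on [0, pi]. At u = s / 2 this gives
    cot (s / 2) <= 2 / s. *)
Lemma mul_cos_le_sin u : 0 <= u <= pi -> u * cos u <= sin u.
Proof.
move=> /andP[u0 upi].
have hd : antideriv (fun v : R => sin (1 * v) + (-1) * ((1 * v + 0) * cos (1 * v))) (fun v => v * sin (1 * v)).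
  apply: antideriv_ext (antiderivD (@antideriv_sin R 1) (antiderivZ (-1) (antiderivM (@antideriv_affine R 1 0) (@antideriv_cos R 1)))) _ _ => v //=.
  by ring.
have cd : continuous (fun v : R => v * sin (1 * v)).
  by apply: continuous_mul; [exact: continuous_id_real|exact: continuous_sin_scale].
have e := ftc2 u0 hd cd; rewrite !(mul1r, mulr0, addr0, sin0, mul0r, subr0) in e.
have : 0 <= itg 0 u (fun v => v * sin (1 * v)).
  apply: itg_ge0 => v /andP[v0 vu]; rewrite mul1r mulr_ge0// sin_ge0_pi// v0.
  exact: le_trans upi.
by rewrite e; lra.
Qed.

Lemma cothalf_bound s : 0 < s <= pi -> `|cothalf s| <= 2 / s.
Proof.
move=> /andP[s0 spi]; have p0 := pi_gt0 R.
have h2 : 0 < sin (s / 2) by apply: sin_gt0_pi; lra.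
have c0 : 0 <= cos (s / 2) by apply: cos_ge0_pihalf; lra.
rewrite /cothalf ger0_norm; last by rewrite divr_ge0// ltW.
rewrite ler_pdivrMr// mulrAC ler_pdivlMr//.
have := @mul_cos_le_sin (s / 2); have -> : 0 <= s / 2 <= pi by apply/andP; split; lra.
by move=> /(_ isT); lra.
Qed.

Lemma cothalfN s : cothalf (- s) = - cothalf s.
Proof. by rewrite /cothalf mulNr cosN sinN invrN mulrN. Qed.

Lemma continuous_reflect (f : R -> R) x : continuous f -> continuous (fun s => f (x - s)).
Proof.
move=> cf; apply: (@continuous_compose _ f (fun s => x - s)) => //.
by apply: continuous_sub; [exact: continuous_const|exact: continuous_id_real].
Qed.

Lemma continuous_translate (f : R -> R) x : continuous f -> continuous (fun s => f (x + s)).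
Proof.
move=> cf; apply: (@continuous_compose _ f (fun s => x + s)) => //.
by apply: continuous_add; [exact: continuous_const|exact: continuous_id_real].
Qed.

(** Telescoping: cot (s / 2) (sin ((n + 1) s) - sin (n s)) = cos ((n + 1) s) + cos (n s) for s > 0,
    and the right side integrates to pi for n = 0, to 0 afterwards. *)
Lemma itg_cothalf_sin j : mu.-integrable `[0, pi] (EFin \o (fun s => cothalf s * sin (j%:R * s))) /\
  itg 0 pi (fun s => cothalf s * sin (j%:R * s)) = if j == 0%N then 0 else pi.
Proof.
have p0 := pi_gt0 R.
have key n s : 0 < s <= pi -> cothalf s * sin (n.+1%:R * s) =
    cothalf s * sin (n%:R * s) + (cos (n.+1%:R * s) + cos (n%:R * s)).
  move=> /andP[s0 spi].
  have h2 : sin (s / 2) != 0 by rewrite gt_eqF//; apply: sin_gt0_pi; lra.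
  have e1 : n.+1%:R * s = (n%:R * s + s / 2) + s / 2 by rewrite -natr1; field.
  have e2 : n%:R * s = (n%:R * s + s / 2) - s / 2 by ring.
  rewrite e1 {2 4}e2; move: (n%:R * s + s / 2) => v.
  rewrite sinD sinB cosD cosB /cothalf; field => //.
elim: j => [|n [IHi IH]].
  have e : (fun s => cothalf s * sin (0%:R * s)) = fun=> 0 by apply/funext => s; rewrite mul0r sin0 mulr0.
  by rewrite e itg_cst ?mul0r ?ltW//; split => //; exact: continuous_integrable_itv (@continuous_const R 0).
have cc : continuous (fun s : R => cos (n.+1%:R * s) + cos (n%:R * s)).
  by apply: continuous_add; exact: continuous_cos_scale.
have ci := @continuous_integrable_itv R _ 0 pi cc.
have ri : mu.-integrable `[0, pi] (EFin \o (fun s => cothalf s * sin (n%:R * s) + (cos (n.+1%:R * s) + cos (n%:R * s)))).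
  by have := @integrableD _ _ _ mu `[0, pi]%classic (measurable_itv _) _ _ IHi ci; apply: eq_integrable.
have li : mu.-integrable `[0, pi] (EFin \o (fun s => cothalf s * sin (n.+1%:R * s))).
  have mf : measurable_fun `[0, pi] (fun s => cothalf s * sin (n.+1%:R * s)).
    apply: measurable_funM; first exact: measurable_funTS cothalf_measurable.
    by apply: measurable_funTS; apply: continuous_measurable_fun; exact: continuous_sin_scale.
  apply: (@bounded_measurable_integrable _ _ 0 pi (2 * n.+1%:R)) => // s /andP[s0 spi].
  move: s0; rewrite le_eqVlt => /predU1P[<-|s0].
    by rewrite mulr0 sin0 mulr0 normr0 mulr_ge0.
  have sp : `|sin (n.+1%:R * s)| <= n.+1%:R * s.
    have ns0 : 0 <= n.+1%:R * s by rewrite mulr_ge0// ltW.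
    have c1 := @continuous_cos_scale R 1.
    have h : antideriv (fun v : R => sin (1 * v)) (fun v => cos (1 * v)).
      by apply: antideriv_ext (@antideriv_sin R 1) _ _ => // v; rewrite mul1r.
    have := ftc2 ns0 h c1; rewrite !mul1r sin0 subr0 => <-.
    rewrite -[leRHS]mul1r -[X in _ <= 1 * X]subr0; apply: itg_bound => // v _; exact: cos_max.
  rewrite normrM; apply: (@le_trans _ _ (2 / s * (n.+1%:R * s))).
    by apply: ler_pM => //; apply: cothalf_bound; rewrite s0.
  by rewrite mulrACA mulrA mulfVK// gt_eqF.
split => //.
rewrite (eq_itg_co li ri (key n)) itgDint// IH itgD; [|exact: continuous_cos_scale..].
rewrite itg_cos//; case: n {IHi IH cc ci ri li} => [|n] /=.
  by under eq_itg do rewrite mul0r cos0; rewrite itg_cst ?ltW// mul1r subr0 !add0r.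
by rewrite itg_cos// !addr0.
Qed.

(** The increment of a primitive over one period is constant, its derivative being h (x + 2 pi) - h
    x = 0. *)
Lemma itg_periodic_shift (h : R -> R) c : continuous h -> periodic2pi h ->
  itg (- pi) pi (fun x => h (x + c)) = itg (- pi) pi h.
Proof.
move=> ch hp; have p0 := pi_gt0 R.
have Np : - pi <= pi :> R by lra.
have ph := prim_antideriv ch.
have a1 : antideriv (fun x => prim h (1 * x + c)) (fun x => h (x + c)).
  by apply: antideriv_ext (antideriv_shift 1 c ph) _ _ => x //; rewrite !mul1r.
have c1 : continuous (fun x => h (x + c)).
  by have := @continuous_translate h c ch; under eq_fun do rewrite addrC.
rewrite (ftc2 Np a1 c1) (ftc2 Np ph ch).
have a2 : antideriv (fun x => prim h (1 * x + 2 * pi) + (-1) * prim h (1 * x + 0)) (fun=> 0).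
  apply: antideriv_ext (antiderivD (antideriv_shift 1 (2 * pi) ph) (antiderivZ (-1) (antideriv_shift 1 0 ph))) _ _ => x //.
  by rewrite !mul1r addr0 hp; ring.
have := @antideriv0_cst R _ (c - pi) (- pi) a2; rewrite !mul1r !mulN1r !addr0.
have -> : c - pi + 2 * pi = pi + c by ring.
have -> : - pi + 2 * pi = pi :> R by ring.
by have -> : c - pi = - pi + c by ring.
Qed.

End Hilbert.

(** * Hilbert transform of differentiable odd functions *)

Section HilbertC1.
Variable R : realType.
Local Notation mu := (@lebesgue_measure R).
Variables (eta psi : R -> R) (M : R).
Hypothesis eta_psi : antideriv eta psi.
Hypothesis cpsi : continuous psi.
Hypothesis psiM : forall x, `|psi x| <= M.
Hypothesis eta_per : periodic2pi eta.
Hypothesis eta_odd : oddfun eta.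
Implicit Types (x y s e : R) (j : nat).

Let ceta : continuous eta := antideriv_continuous eta_psi.

Let M0 : 0 <= M. Proof. exact: le_trans (psiM 0). Qed.

(** The integrand at s and at - s folded together, cot being odd. The difference of values of eta is
    O(s) and cancels the singularity, so the principal value becomes an ordinary integral. *)
Definition hkernel x s : R := cothalf s * (eta (x - s) - eta (x + s)).

Lemma hkernel_measurable : measurable_fun setT (fun p : R * R => hkernel p.1 p.2).
Proof.
have me : measurable_fun setT eta by exact: continuous_measurable_fun.
apply: measurable_funM; first exact: (measurableT_comp (@cothalf_measurable R)).
apply: measurable_funB; apply: (measurableT_comp me).
  by apply: measurable_funB; [exact: measurable_fst|exact: measurable_snd].
by apply: measurable_funD; [exact: measurable_fst|exact: measurable_snd].
Qed.

Lemma hkernel_measurable1 x : measurable_fun setT (hkernel x).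
Proof. exact: (measurableT_comp hkernel_measurable (pair1_measurable x)). Qed.

Lemma hkernel_bound x s : 0 <= s <= pi -> `|hkernel x s| <= 4 * M.
Proof.
move=> /andP[+ spi]; rewrite le_eqVlt => /predU1P[<-|s0].
  by rewrite /hkernel subr0 addr0 subrr mulr0 normr0 mulr_ge0.
have h : `|eta (x - s) - eta (x + s)| <= M * (2 * s).
  have xs : x - s <= x + s by rewrite lerD2l; lra.
  rewrite distrC -(ftc2 xs eta_psi cpsi) (_ : 2 * s = (x + s) - (x - s)); last by ring.
  by apply: itg_bound.
rewrite /hkernel normrM; apply: (@le_trans _ _ (2 / s * (M * (2 * s)))).
  by apply: ler_pM => //; apply: cothalf_bound; rewrite s0.
rewrite (_ : 2 / s * _ = 4 * M)//; field; exact: lt0r_neq0.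
Qed.

Lemma hkernel_integrable x e : 0 <= e -> mu.-integrable `[e, pi] (EFin \o hkernel x).
Proof.
move=> e0; apply: (@bounded_measurable_integrable _ _ _ _ (4 * M)).
  exact: measurable_funTS (hkernel_measurable1 x).
by move=> s /andP[es spi]; apply: hkernel_bound; rewrite (le_trans e0).
Qed.

Definition hilC1 x : R := (2 * pi)^-1 * itg 0 pi (hkernel x).

Lemma truncated_hilbertE x e : 0 < e <= pi ->
  \int[mu]_(s in [set s : R | e <= `|s| <= pi]) (cos (s / 2) / sin (s / 2) * eta (x - s))
  = itg e pi (hkernel x).
Proof.
move=> /andP[e0 epi].
pose f s := cothalf s * eta (x - s).
have mf : measurable_fun setT f.
  apply: measurable_funM; first exact: cothalf_measurable.
  by apply: continuous_measurable_fun; exact: continuous_reflect.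
have setE : [set s : R | e <= `|s| <= pi] = `[- pi, - e] `|` `[e, pi].
  apply/seteqP; split => s /=; rewrite !in_itv/=.
    have [s0|s0] := leP 0 s; [rewrite ger0_norm// => ->; by right|].
    by rewrite ltr0_norm// => /andP[h1 h2]; left; lra.
  by case=> /andP[h1 h2]; [rewrite ler0_norm|rewrite ger0_norm]; lra.
have [B B0 hB] := @continuous_bounded_itv R (fun s => eta (x - s)) (- pi) pi (@continuous_reflect R eta x ceta).
have fb s : e <= `|s| <= pi -> `|f s| <= 2 / e * B.
  move=> /andP[es spi]; rewrite /f normrM; apply: ler_pM => //; last first.
    by apply: hB; rewrite ler_norml in spi.
  have -> : `|cothalf s| = `|cothalf `|s| |.
    by have [s0|s0] := leP 0 s; [rewrite (ger0_norm s0)|rewrite (ltr0_norm s0) cothalfN normrN].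
  apply: (@le_trans _ _ (2 / `|s|)).
    by apply: cothalf_bound; rewrite spi (lt_le_trans e0).
  by rewrite ler_pM2l// lef_pV2// posrE// (lt_le_trans e0).
have fi : mu.-integrable (`[- pi, - e] `|` `[e, pi]) (EFin \o f).
  rewrite -setE; have mS : measurable [set s : R | e <= `|s| <= pi].
    by rewrite setE; apply: measurableU.
  apply: measurable_bounded_integrable => //.
  - suff : (mu [set s : R | (e <= `|s| <= pi)%R] < +oo)%E by [].
    apply: le_lt_trans (lebesgue_itv_fin (- pi) pi).
    apply: le_measure; rewrite ?inE// => s /= /andP[_]; rewrite ler_norml in_itv//.
  - exact: measurable_funTS.
  - exists (2 / e * B); split; first by rewrite num_real.
    by move=> y My s /= hs; rewrite (le_trans (fb _ hs))// ltW.
have i1 : mu.-integrable `[- pi, - e] (EFin \o f).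
  by apply: integrableS fi => //; exact: measurableU.
have i2 : mu.-integrable `[e, pi] (EFin \o f).
  by apply: integrableS fi => //; exact: measurableU.
rewrite setE -[LHS]/(\int[mu]_(s in `[- pi, - e] `|` `[e, pi]) f s) Rintegral_setU//; last first.
  apply/disj_setPS => s [/=]; rewrite !in_itv/= => /andP[_ h1] /andP[h2 _].
  by exfalso; lra.
have i3 : mu.-integrable `[e, pi] (EFin \o (fun s => f (- s))).
  apply: (@bounded_measurable_integrable _ _ _ _ (2 / e * B)).
    by apply: measurable_funTS; apply: (measurableT_comp mf); exact: oppr_measurable.
  move=> s /andP[es spi]; apply: fb; rewrite normrN ger0_norm ?es//.
  exact: le_trans (ltW e0) es.
rewrite -!itgE itg_opp_measurable//; last exact: measurable_funTS.
rewrite -itgDint//; apply: eq_itg => s _.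
by rewrite /f /hkernel cothalfN opprK; ring.
Qed.

Lemma hilbertE x : hilbert eta x = hilC1 x.
Proof.
have p0 := pi_gt0 R.
apply/cvg_lim => //; apply/cvgrPdist_le => e e0.
(* The integral over [0, r] is at most 4 M r; the summand 1 keeps the denominator positive when M =
   0. *)
pose d : R := e * (2 * pi) / (4 * M + 1).
have d0 : 0 < d by rewrite /d divr_gt0// ?mulr_gt0// ltr_wpDl// mulr_ge0.
near=> r.
have r0 : 0 < r by near: r; exact: nbhs_right_gt.
have rpi : r <= pi by near: r; exact: nbhs_right_le.
have rd : r <= d by near: r; exact: nbhs_right_le.
rewrite truncated_hilbertE ?r0// /hilC1 -mulrBr.
rewrite (itg_chasles (ltW r0) rpi (hkernel_integrable x (lexx 0))) addrK.
rewrite normrM gtr0_norm ?invr_gt0 ?mulr_gt0//.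
have : `|itg 0 r (hkernel x)| <= 4 * M * (r - 0).
  apply: itg_norm_le; [exact: ltW|exact: measurable_funTS (hkernel_measurable1 x)|].
  by move=> s /andP[s0 sr]; apply: hkernel_bound; rewrite s0 (le_trans sr).
rewrite subr0 => h; rewrite mulrC ler_pdivrMr ?mulr_gt0//; apply: (le_trans h).
have : (4 * M + 1) * r <= (4 * M + 1) * d by rewrite ler_wpM2l// addr_ge0// mulr_ge0.
have -> : (4 * M + 1) * d = e * (2 * pi).
  by rewrite /d mulrC divfK// gt_eqF// ltr_wpDl// mulr_ge0.
by lra.
Unshelve. all: by end_near. Qed.

Lemma hilC1_continuous : continuous hilC1.
Proof.
apply: continuous_scale => x.
have := @continuity_under_integral _ _ _ mu hkernel `[0, pi]%classic (measurable_itv _) (x - 1) (x + 1)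
  _ _ (fun=> 4 * M) _ _ x; apply.
- by move=> y _; exact: hkernel_integrable.
- apply: aeW => s _ y _; apply: continuous_scale.
  apply: continuous_sub.
    by have := @continuous_translate R eta (- s) ceta; under eq_fun do rewrite addrC.
  by have := @continuous_translate R eta s ceta; under eq_fun do rewrite addrC.
- exact: continuous_integrable_itv (@continuous_const R (4 * M)).
- by move=> y _; apply: aeW => s; rewrite /= in_itv/=; exact: hkernel_bound.
- by rewrite inE/= in_itv/= gtrBl ltrDl ltr01.
Qed.

Lemma hilC1_even x : hilC1 (- x) = hilC1 x.
Proof.
rewrite /hilC1; congr (_ * _); apply: eq_itg => s _; rewrite /hkernel.
rewrite (_ : - x - s = - (x + s)); last by ring.
by rewrite (_ : - x + s = - (x - s)) ?eta_odd; ring.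
Qed.

Lemma itg_even_sym (f : R -> R) : continuous f -> (forall x, f (- x) = f x) ->
  itg (- pi) pi f = 2 * itg 0 pi f.
Proof.
move=> cf fe; have p0 := pi_ge0 R.
have Np : - pi <= 0 :> R by lra.
rewrite (itg_chasles Np p0 (@continuous_integrable_itv R f _ _ cf)).
have := @itg_opp R f 0 pi p0 cf; rewrite oppr0 => ->.
by under eq_itg do rewrite fe; ring.
Qed.

(** By periodicity the shifts by s and - s move from eta to the cosine, and cos (j (x + s)) - cos (j
    (x - s)) = - 2 sin (j x) sin (j s). *)
Lemma itg_hkernel_cos j s :
  itg (- pi) pi (fun x => hkernel x s * cos (j%:R * x)) =
  cothalf s * sin (j%:R * s) * (- 2 * itg (- pi) pi (fun x => eta x * sin (j%:R * x))).
Proof.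
have cj := @continuous_cos_scale R j%:R; have sj := @continuous_sin_scale R j%:R.
have shift c : continuous (fun x => eta (x + c)).
  by have := @continuous_translate R eta c ceta; under eq_fun do rewrite addrC.
have cshift c : continuous (fun x => cos (j%:R * (x + c))).
  by have := @continuous_translate R _ c cj; under eq_fun do rewrite addrC.
have c1 c : continuous (fun x => eta (x + c) * cos (j%:R * x)) by exact: continuous_mul.
have c2 c : continuous (fun x => eta x * cos (j%:R * (x + c))) by exact: continuous_mul.
have per c : periodic2pi (fun x => eta x * cos (j%:R * (x + c))).
  by move=> x; rewrite eta_per addrAC mulrDr cosDn2pi.
have e c d : c + d = 0 -> itg (- pi) pi (fun x => eta (x + c) * cos (j%:R * x)) =
    itg (- pi) pi (fun x => eta x * cos (j%:R * (x + d))).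
  move=> cd; rewrite -(@itg_periodic_shift R _ c (c2 d) (per d)).
  by apply: eq_itg => x _; rewrite -addrA cd addr0.
have -> : itg (- pi) pi (fun x => hkernel x s * cos (j%:R * x)) =
   itg (- pi) pi (fun x => cothalf s * (eta (x + - s) * cos (j%:R * x) - eta (x + s) * cos (j%:R * x))).
  by apply: eq_itg => x _; rewrite /hkernel -mulrBl mulrA.
rewrite itgZ; last exact: (continuous_sub (c1 (- s)) (c1 s)).
rewrite (@itgB R _ _ _ _ (c1 (- s)) (c1 s)) (e _ _ (addNr s)) (e _ _ (subrr s)).
rewrite -(@itgB R _ _ _ _ (c2 s) (c2 (- s))).
rewrite -mulrA; congr (_ * _).
rewrite mulrA -itgZ; last exact: continuous_mul.
apply: eq_itg => x _; rewrite mulrDr mulrBr cosD cosB; ring.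
Qed.

(** The coefficient form of H sin (j x) = - cos (j x). After Fubini, cot (s / 2) sin (j s) splits
    off; its integral pi, the factor - 2 and the prefactor 1 / (2 pi) multiply to - 1. For j = 0
    both sides vanish. *)
Lemma itg_hilC1_cos j : itg (- pi) pi (fun x => hilC1 x * cos (j%:R * x)) =
  - itg (- pi) pi (fun x => eta x * sin (j%:R * x)).
Proof.
have p0 := pi_gt0 R.
have ch : continuous (fun x => itg 0 pi (hkernel x)).
  have := @continuous_scale R (2 * pi) _ hilC1_continuous.
  by under eq_fun do rewrite /hilC1 mulrA divff ?mul1r ?gt_eqF ?mulr_gt0//.
have cj := @continuous_cos_scale R j%:R.
have cc := continuous_mul ch cj.
have -> : itg (- pi) pi (fun x => hilC1 x * cos (j%:R * x)) =
   (2 * pi)^-1 * itg (- pi) pi (fun x => itg 0 pi (hkernel x) * cos (j%:R * x)).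
  by rewrite -itgZ//; apply: eq_itg => x _; rewrite /hilC1 mulrA.
have -> : itg (- pi) pi (fun x => itg 0 pi (hkernel x) * cos (j%:R * x)) =
   itg (- pi) pi (fun x => itg 0 pi (fun s => hkernel x s * cos (j%:R * x))).
  apply: eq_itg => x _; rewrite mulrC -itgZint; last exact: hkernel_integrable.
  by apply: eq_itg => s _; rewrite mulrC.
rewrite (@itg_fubini R (fun p => hkernel p.1 p.2 * cos (j%:R * p.1)) _ _ _ _ (4 * M)); last 2 first.
- apply: measurable_funM; first exact: hkernel_measurable.
  have mc : measurable_fun setT (fun x : R => cos (j%:R * x)) by exact: continuous_measurable_fun.
  exact: (measurableT_comp mc measurable_fst).
- move=> x s _ hs; rewrite /= normrM -[leRHS]mulr1; apply: ler_pM => //.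
    exact: hkernel_bound.
  exact: cos_max.
under eq_itg do rewrite /= itg_hkernel_cos mulrC.
set S := itg (- pi) pi _.
case: j cj cc @S => [|j] cj cc S.
  have -> : S = 0.
    rewrite /S -[RHS](mul0r (pi - - pi)) -itg_cst; last by lra.
    by apply: eq_itg => x _; rewrite mul0r sin0 mulr0.
  rewrite oppr0 -[X in _ * X = _](_ : 0 = _) ?mulr0//.
  rewrite -[LHS](mul0r (pi - 0)) -itg_cst; last by lra.
  by apply: eq_itg => x _; rewrite mul0r.
have [ci cE] := itg_cothalf_sin R j.+1.
rewrite itgZint// cE /=.
by move: (S) (@pi R) p0 => s p p0; field; exact: lt0r_neq0.
Qed.

End HilbertC1.

(** * The matrix of the linearized operator *)

Section Recurrence.
Variable R : realType.
Implicit Types (C D E r : nat -> R) (n N k : nat).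

(** Half of it is a product of four factors attached to the k-th sine coefficient of eta: 1 / (2 k)
    from expressing it by C, (k - 2) / (2 k) = 1/2 - 1/k from forming eta / 2 + v, (k + 2) / 2 from
    the bracket, and 2 (k - 2) from going back to coefficients of the type of C. *)
Definition dcoef k : R := (k%:R - 2) ^+ 2 * (k%:R + 2) / (2 * k%:R ^+ 2).

(** With this diagonal, row n of the operator has the divergence form d_(n+1) / 2 (C_(n+2) - C_n) +
    d_(n-1) / 2 (C_n - C_(n-2)); hence a difference of two rows at distance 2 loses its middle
    term. *)
Definition mucoef n : R := (dcoef n.-1 - dcoef n.+1) / 2.

(* The action of L^+ on the sine coefficients of eta' / |sin|. Junk values: dcoef 0 = 0,
   and n - 2 is truncated, but only sequences with C 0 = C 1 = 0 are used. *)
Definition Lmat C n : R :=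
  mucoef n * C n + dcoef n.+1 / 2 * C n.+2 - dcoef n.-1 / 2 * C (n - 2)%N.

(** The coefficient of C_n C_(n+2) in 2 MC . (M + S) C. The difference of diagonal entries is O(1 /
    n^2), which beats the linear growth of [dcoef]. *)
Definition ocoef n : R := (mucoef n - mucoef n.+2) * dcoef n.+1.

(** A majorant of the absolute value of [ocoef] from index 2 on, and 0 below, where C vanishes.
    [ocoef 2] is about 0.306 and gets a bound of its own. *)
Definition hcoef n : R :=
  if n is n'.+2 then (if n' is 0 then 31 / 100 else 3 / 20) else 0.

Arguments hcoef : simpl never.

Lemma mucoefE n : mucoef n.+4 = - 2^-1 + 2 * (4 * (n%:R + 4) - (n%:R + 3) * (n%:R + 5))
     / ((n%:R + 3) * (n%:R + 5)) ^+ 2.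
Proof.
have n0 : 0 <= n%:R :> R by [].
rewrite /mucoef /dcoef /= -(@natr1 R n.+4) -(@natr1 R n.+3) -(@natr1 R n.+2) -(@natr1 R n.+1) -(@natr1 R n).
by field; do ?[apply/andP; split]; apply: lt0r_neq0; lra.
Qed.

Lemma dcoef_ge0 k : 0 <= dcoef k.
Proof.
by rewrite /dcoef divr_ge0// mulr_ge0// ?sqr_ge0// addr_ge0.
Qed.

Lemma dcoef_le k : dcoef k.+1 <= (k%:R + 3) / 2.
Proof.
have k0 : 0 <= k%:R :> R by [].
have e : dcoef k.+1 = (k%:R - 1) ^+ 2 / (k%:R + 1) ^+ 2 * ((k%:R + 3) / 2).
  by rewrite /dcoef -natr1; field; do ?[apply/andP; split]; apply: lt0r_neq0; lra.
rewrite e -[leRHS]mul1r; apply: ler_wpM2r; first by lra.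
rewrite ler_pdivrMr; last by nra.
nra.
Qed.

Lemma small_mucoef : [/\ mucoef 2 = 11 / 18, mucoef 3 = - (3 / 8) & mucoef 5 = - (37 / 72)].
Proof. by rewrite /mucoef /dcoef /=; split; field. Qed.

Lemma mucoef_bounds n : - (16 / 25) <= mucoef n.+4 <= - (49 / 100).
Proof.
have n0 : 0 <= n%:R :> R by [].
rewrite mucoefE; set x := n%:R in n0 *; set P := (x + 3) * (x + 5).
have P15 : 15 <= P by rewrite /P; nra.
have P2 : 0 < P ^+ 2 by nra.
apply/andP; split.
  suff : - (2 / 15) <= 2 * (4 * (x + 4) - P) / P ^+ 2 by lra.
  rewrite ler_pdivlMr// ; nra.
suff : 2 * (4 * (x + 4) - P) / P ^+ 2 <= 1 / 100 by lra.
rewrite ler_pdivrMr//; have : 4 * (x + 4) - P = 1 - 4 * x - x ^+ 2 by rewrite /P; ring.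
move=> ->; nra.
Qed.

(** Both diagonal entries lie between - 1/2 - 2 / p and - 1/2, with p = (x + 4) (x + 6), so the
    product is at most (x + 4) (x + 8) / (x + 6)^3. At x = 0 this is 4/27, just below 3/20. *)
Lemma ocoef_large n : `|ocoef n.+4.+1| <= 3 / 20.
Proof.
have n0 : 0 <= n%:R :> R by [].
set x : R := n%:R in n0 *.
have e1 : n.+1%:R = x + 1 :> R by rewrite -natr1.
have e3 : n.+3%:R = x + 3 :> R by rewrite -!natr1 /x; ring.
have e6 : n.+4.+2%:R = x + 6 :> R by rewrite -!natr1 /x; ring.
have P0 : 0 < (x + 4) * (x + 6) by nra.
have Q0 : 0 < (x + 6) * (x + 8) by nra.
pose p := (x + 4) * (x + 6); pose q := (x + 6) * (x + 8).
have m1 : mucoef n.+4.+1 = - 2^-1 + 2 * (4 * (x + 5) - p) / p ^+ 2.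
  by rewrite mucoefE e1 /p; congr (_ + 2 * _ / _); ring.
have m2 : mucoef n.+4.+3 = - 2^-1 + 2 * (4 * (x + 7) - q) / q ^+ 2.
  by rewrite mucoefE e3 /q; congr (_ + 2 * _ / _); ring.
have b1 : - (2 / p) <= 2 * (4 * (x + 5) - p) / p ^+ 2 <= 0.
  apply/andP; split; last first.
    by rewrite mulr_le0_ge0// ?invr_ge0 ?sqr_ge0// /p; nra.
  rewrite -mulNr ler_pdivrMr// mulrAC ler_pdivlMr ?exprn_gt0//; rewrite /p; nra.
have b2 : - (2 / p) <= 2 * (4 * (x + 7) - q) / q ^+ 2 <= 0.
  apply/andP; split; last first.
    by rewrite mulr_le0_ge0// ?invr_ge0 ?sqr_ge0// /q; nra.
  apply: (@le_trans _ _ (- (2 / q))).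
    by rewrite lerN2 ler_pM2l// lef_pV2 ?posrE// /p /q; nra.
  rewrite -mulNr ler_pdivrMr// mulrAC ler_pdivlMr ?exprn_gt0//; rewrite /q; nra.
have d6 : dcoef n.+4.+2 = (x + 4) ^+ 2 * (x + 8) / (2 * (x + 6) ^+ 2).
  by rewrite /dcoef e6; congr (_ ^+ 2 * _ / _); ring.
rewrite /ocoef normrM (ger0_norm (dcoef_ge0 _)).
apply: (@le_trans _ _ (2 / p * dcoef n.+4.+2)).
  rewrite ler_wpM2r ?dcoef_ge0//; have p0 : 0 <= 2 / p by rewrite divr_ge0// ltW.
  by move: b1 b2 => /andP[b1 b1'] /andP[b2 b2']; rewrite m1 m2 ler_norml; lra.
have -> : 2 / p * dcoef n.+4.+2 = (x + 4) * (x + 8) / (x + 6) ^+ 3.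
  by rewrite d6 /p; field; do ?[apply/andP; split]; apply: lt0r_neq0; lra.
rewrite ler_pdivrMr; last by rewrite exprn_gt0//; lra.
have -> : (x + 6) ^+ 3 = (x + 6) * ((x+4) * (x+8) + 4) by ring.
nra.
Qed.

Lemma ocoef_hcoef n : `|ocoef n.+2| <= hcoef n.+2.
Proof.
case: n => [|[|[|n]]]; last exact: ocoef_large.
- rewrite /ocoef (_ : mucoef 2 - mucoef 4 = 11 / 18 + 221 / 450); last by rewrite /mucoef /dcoef /=; field.
  by rewrite /hcoef (_ : dcoef 3 = 5 / 18); [rewrite ger0_norm; lra|rewrite /dcoef; field].
- rewrite /ocoef (_ : mucoef 3 - mucoef 5 = 10 / 72); last by case: small_mucoef => _ -> ->; field.
  by rewrite /hcoef (_ : dcoef 4 = 3 / 4); [rewrite ger0_norm; lra|rewrite /dcoef; field].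
- rewrite /ocoef (_ : mucoef 4 - mucoef 6 = - (221 / 450) + 1269 / 2450); last by rewrite /mucoef /dcoef /=; field.
  by rewrite /hcoef (_ : dcoef 5 = 63 / 50); [rewrite ger0_norm; lra|rewrite /dcoef; field].
Qed.

Lemma hcoef_le n : hcoef n <= 31 / 100.
Proof. by case: n => [|[|[|n]]]; rewrite /hcoef; lra. Qed.

(** Each coupling is shared equally by its two squares. The constant 1/5 is dictated by row 3, where
    mu = - 3/8 leaves 9/32 - 3/40 = 33/160. *)
Lemma diagonal_dominance n :
  1 / 5 <= 2 * mucoef n.+2 ^+ 2 - hcoef n / 2 - hcoef n.+2 / 2.
Proof.
case: n => [|[|n]].
- by case: small_mucoef => -> _ _; rewrite /hcoef; lra.
- by case: small_mucoef => _ -> _; rewrite /hcoef; lra.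
- have /andP[_ h] := mucoef_bounds n.
  have h1 := hcoef_le n.+2.
  have h2 : hcoef n.+4 = 3 / 20 by [].
  have : (49 / 100) ^+ 2 <= mucoef n.+4 ^+ 2 by rewrite -[leRHS]sqrrN ler_sqr ?nnegrE; lra.
  rewrite h2; lra.
Qed.

(* Telescoping remainder of the partial sums of D . D + C . E, where D = LC, E = LD. *)
Definition bdry C D n : R := dcoef n.+1 / 2 * (C n * D n.+2 + C n.+2 * D n)
  + mucoef n.+2 * dcoef n.+1 * C n * C n.+2.

Section Energy.
Variables C D E : nat -> R.
Hypotheses (C0 : C 0%N = 0) (C1 : C 1%N = 0) (D0 : D 0%N = 0) (D1 : D 1%N = 0).
Hypotheses (DE : forall n, D n.+2 = Lmat C n.+2) (EE : forall n, E n.+2 = Lmat D n.+2).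

(** Moving L from D onto C in C . LD costs only boundary terms and, S being skew, gives (L + L^T) C
    . D = 2 MC . D. Rows interact at distance 2, hence two boundary terms. *)
Lemma energy_partial_sum N :
  \sum_(n < N) (D n.+2 * D n.+2 + C n.+2 * E n.+2) =
  \sum_(n < N) (2 * mucoef n.+2 ^+ 2 * C n.+2 ^+ 2 + ocoef n.+2 * C n.+2 * C n.+4)
  + bdry C D N + bdry C D N.+1.
Proof.
elim: N => [|N IH]; first by rewrite !big_ord0 /bdry C0 C1 D0 D1; ring.
rewrite 2!big_ord_recr /= IH EE.
rewrite -!addrA; congr (_ + _); rewrite /bdry /ocoef !(DE N).
by rewrite /Lmat /= !subn2 /= !(DE N) /Lmat /= !subn2 /=; field.
Qed.

Lemma normrM_le_sqr (a b : R) : `|a * b| <= (a ^+ 2 + b ^+ 2) / 2.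
Proof. by have := sqr_ge0 (a - b); have := sqr_ge0 (a + b); rewrite ler_norml; lra. Qed.

(** The subtracted terms are the shares of the last two couplings that fall on squares beyond the
    truncation. *)
Lemma energy_partial_lower N :
  1 / 5 * (\sum_(n < N) C n.+2 ^+ 2) - hcoef N.+1 / 2 * C N.+3 ^+ 2 - hcoef N / 2 * C N.+2 ^+ 2
  <= \sum_(n < N) (2 * mucoef n.+2 ^+ 2 * C n.+2 ^+ 2 + ocoef n.+2 * C n.+2 * C n.+4).
Proof.
elim: N => [|N IH]; first by rewrite !big_ord0 /hcoef; lra.
rewrite 2!big_ord_recr /=.
have h0 : - (hcoef N.+2 / 2 * (C N.+2 ^+ 2 + C N.+4 ^+ 2)) <= ocoef N.+2 * C N.+2 * C N.+4.
  have : `|ocoef N.+2 * C N.+2 * C N.+4| <= hcoef N.+2 * ((C N.+2 ^+ 2 + C N.+4 ^+ 2) / 2).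
    rewrite -mulrA normrM; apply: ler_pM => //; first exact: ocoef_hcoef.
    exact: normrM_le_sqr.
  by rewrite ler_norml => /andP[+ _]; lra.
have h1 : 1 / 5 * C N.+2 ^+ 2 <= (2 * mucoef N.+2 ^+ 2 - hcoef N / 2 - hcoef N.+2 / 2) * C N.+2 ^+ 2.
  by rewrite ler_wpM2r ?sqr_ge0//; exact: diagonal_dominance.
lra.
Qed.

Definition sqblock n : R := C n ^+ 2 + C n.+2 ^+ 2 + D n ^+ 2 + D n.+2 ^+ 2.

Lemma sqblock_ge0 n : 0 <= sqblock n.
Proof. by rewrite /sqblock !addr_ge0// sqr_ge0. Qed.

Lemma normr_mucoef_le1 n : `|mucoef n.+2| <= 1.
Proof.
case: n => [|[|n]].
- by case: small_mucoef => -> _ _; rewrite ger0_norm; lra.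
- by case: small_mucoef => _ -> _; rewrite ler0_norm; lra.
- by have := mucoef_bounds n; rewrite ler_norml; lra.
Qed.

Lemma bdry_le n : `|bdry C D n| <= (n%:R + 3) / 2 * sqblock n.
Proof.
apply: (@le_trans _ _ (dcoef n.+1 * sqblock n)); last first.
  by rewrite ler_wpM2r ?sqblock_ge0//; exact: dcoef_le.
have -> : bdry C D n = dcoef n.+1 * ((C n * D n.+2 + C n.+2 * D n) / 2 + mucoef n.+2 * (C n * C n.+2)).
  by rewrite /bdry; ring.
rewrite normrM (ger0_norm (dcoef_ge0 _)) ler_wpM2l ?dcoef_ge0//.
rewrite (le_trans (ler_normD _ _))//.
have h1 : `|mucoef n.+2 * (C n * C n.+2)| <= 1 * ((C n ^+ 2 + C n.+2 ^+ 2) / 2).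
  rewrite normrM; apply: ler_pM => //; first exact: normr_mucoef_le1.
  exact: normrM_le_sqr.
have h2 : `|(C n * D n.+2 + C n.+2 * D n) / 2| <= sqblock n / 4.
  have := normrM_le_sqr (C n) (D n.+2); have := normrM_le_sqr (C n.+2) (D n).
  by rewrite !ler_norml /sqblock; lra.
have := sqr_ge0 (C n); have := sqr_ge0 (C n.+2).
by have := sqr_ge0 (D n); have := sqr_ge0 (D n.+2); move: h1 h2; rewrite /sqblock; lra.
Qed.

Lemma energy_sum_lower N :
  1 / 5 * (\sum_(n < N) C n.+2 ^+ 2) - (N%:R + 4) * (sqblock N + sqblock N.+1)
  <= \sum_(n < N) (D n.+2 * D n.+2 + C n.+2 * E n.+2).
Proof.
rewrite energy_partial_sum.
have h0 := energy_partial_lower N.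
have := bdry_le N; have := bdry_le N.+1; rewrite -natr1.
rewrite !ler_norml => /andP[h1 _] /andP[h2 _].
have hb k : hcoef k <= 1 by have := hcoef_le k; lra.
have h3 : hcoef N.+1 / 2 * C N.+3 ^+ 2 <= sqblock N.+1.
  have : hcoef N.+1 / 2 * C N.+3 ^+ 2 <= 1 * C N.+3 ^+ 2.
    by rewrite ler_wpM2r ?sqr_ge0//; have := hb N.+1; lra.
  have := sqr_ge0 (C N.+1); have := sqr_ge0 (D N.+1); have := sqr_ge0 (D N.+3).
  by rewrite /sqblock; lra.
have h4 : hcoef N / 2 * C N.+2 ^+ 2 <= sqblock N.
  have : hcoef N / 2 * C N.+2 ^+ 2 <= 1 * C N.+2 ^+ 2.
    by rewrite ler_wpM2r ?sqr_ge0//; have := hb N; lra.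
  have := sqr_ge0 (C N); have := sqr_ge0 (D N); have := sqr_ge0 (D N.+2).
  by rewrite /sqblock; lra.
have n0 : 0 <= N%:R :> R by [].
have := sqblock_ge0 N; have := sqblock_ge0 N.+1.
move: (sqblock N) (sqblock N.+1) h1 h2 h3 h4 => s s' h1 h2 h3 h4 s0 s0'.
have := mulr_ge0 n0 s0; have := mulr_ge0 n0 s0'; lra.
Qed.

End Energy.

(* A nonnegative sequence with bounded partial sums is o(1/N) along a
   subsequence, by divergence of the harmonic series. *)
Lemma frequently_small r B e N0 : (forall n, 0 <= r n) ->
  (forall N, \sum_(n < N) r n <= B) -> 0 < e ->
  exists2 N, (N0 <= N)%N & (N%:R + 4) * r N <= e.
Proof.
move=> r0 rB e0; apply: contrapT => H.
have {}H N : (N0 <= N)%N -> e < (N%:R + 4) * r N.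
  by move=> NN; rewrite ltNge; apply/negP => h; apply: H; exists N.
apply: (@dvg_harmonic R).
apply: nondecreasing_is_cvgn.
  by apply/nondecreasing_seqP => n; rewrite /series /= big_nat_recr//= lerDl.
(* If r_n > e / (n + 4) from N0 on, then 1 / (n + 1) <= 4 / (n + 4) < (4 / e) r_n there, so the
   harmonic sums would be bounded. *)
exists (\sum_(n < N0) n.+1%:R^-1 + 4 / e * B) => _ [N _ <-].
have b M : \sum_(n < M) n.+1%:R^-1 <= \sum_(n < N0) n.+1%:R^-1 + 4 / e * \sum_(n < M) r n.
  elim: M => [|M IH]; first by rewrite !big_ord0 mulr0 addr0 sumr_ge0// => i _; rewrite invr_ge0.
  have s0 k : 0 <= \sum_(n < k) r n by rewrite sumr_ge0.
  have [MN|NM] := leqP M.+1 N0.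
    rewrite -(subnKC MN) big_split_ord /= -addrA lerDl addr_ge0//.
      by rewrite sumr_ge0// => i _; rewrite invr_ge0.
    by apply: mulr_ge0; [rewrite divr_ge0// ltW|exact: s0].
  rewrite big_ord_recr [in leRHS]big_ord_recr /=.
  have := H M NM; rewrite ltnS in NM.
  suff : e < (M%:R + 4) * r M -> M.+1%:R^-1 <= 4 / e * r M by move=> h /h {}h; rewrite mulrDr addrA; exact: lerD.
  move=> h; rewrite mulrAC ler_pdivlMr// mulrC ler_pdivrMr//.
  by have : 0 <= M%:R :> R by []; have := r0 M; rewrite -natr1; nra.
rewrite /series /= big_mkord (le_trans (b N))// lerD2l ler_wpM2l//.
by rewrite divr_ge0// ltW.
Qed.

End Recurrence.

(** * Growth comparison *)

Section Comparison.
Variable R : realType.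
Implicit Types (f g y z : R -> R) (a b s t T e : R).

Lemma gt0_deriv_lt f f' a b : a < b ->
  (forall t, a < t < b -> is_derive t (1:R) f (f' t)) ->
  {within `[a, b], continuous f} ->
  (forall t, a < t < b -> 0 < f' t) -> f a < f b.
Proof.
move=> ab fd cf f'0.
have fd' : forall x, x \in `]a, b[ -> is_derive x (1:R) f (f' x).
  by move=> x; rewrite in_itv/=; exact: fd.
have [c] := @MVT R f f' a b ab fd' cf.
rewrite in_itv/= => cab e; rewrite -subr_gt0 e mulr_gt0 ?f'0// subr_gt0//.
Qed.

Lemma ge0_deriv_le f f' a b : a <= b ->
  (forall t, a < t < b -> is_derive t (1:R) f (f' t)) ->
  {within `[a, b], continuous f} ->
  (forall t, a < t < b -> 0 <= f' t) -> f a <= f b.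
Proof.
rewrite le_eqVlt => /predU1P[->//|ab] fd cf f'0.
have fd' : forall x, x \in `]a, b[ -> is_derive x (1:R) f (f' x).
  by move=> x; rewrite in_itv/=; exact: fd.
have [c] := @MVT R f f' a b ab fd' cf.
rewrite in_itv/= => cab e; rewrite -subr_ge0 e mulr_ge0 ?f'0// subr_ge0 ltW//.
Qed.

Lemma is_derive_expRM f (k df t : R) : is_derive t (1:R) f df ->
  is_derive t (1:R) (fun s => expR (k * s) * f s) (expR (k * t) * (k * f t + df)).
Proof.
move=> fd.
have d1 : is_derive t (1:R) (fun s => k * s) k.
  by apply: (is_derive_eq (is_deriveZ k (is_derive_id t 1))); rewrite /GRing.scale/= mulr1.
have d2 : is_derive t (1:R) (fun s => expR (k * s)) (expR (k * t) * k).
  exact: (is_derive_eq (is_derive1_comp (is_derive_expR (k * t)) d1)).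
apply: (is_derive_eq (is_deriveM d2 fd)).
by rewrite /GRing.scale/=; ring.
Qed.

Lemma continuous_expRM k T f : {within `[0, T], continuous f} ->
  {within `[0, T], continuous (fun s => expR (k * s) * f s)}.
Proof.
move=> cf.
have ce : {within `[0, T], continuous (fun s => expR (k * s))}.
  apply: continuous_subspaceT => x.
  apply: (@continuous_comp _ _ _ ( *%R k) expR); last exact: continuous_expR.
  exact: mulrl_continuous.
by move=> /= x; apply: (continuousM (ce x) (cf x)).
Qed.

Lemma within_subitv (f : R -> R) T t : 0 <= t <= T -> {within `[0, T], continuous f} ->
  {within `[0, t], continuous f}.
Proof.
move=> /andP[_ tT]; apply: continuous_subspaceW.
by apply: subset_itvl; rewrite bnd_simp.
Qed.

(* With s = sqrt lam1, the difference h = y - E1 satisfies (z + s y) growing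
   strictly faster than exp (2 s t), whence h > 0. *)
Lemma growth_comparison y z z' k s T : 0 < s -> s ^+ 2 < k ->
  0 < T -> {within `[0, T], continuous y} -> {within `[0, T], continuous z} ->
  (forall t, 0 < t < T -> is_derive t (1:R) y (2 * z t)) ->
  (forall t, 0 < t < T -> is_derive t (1:R) z (z' t)) ->
  (forall t, 0 < t < T -> 2 * k * y t <= z' t) ->
  (forall t, 0 <= t <= T -> 0 <= y t) ->
  0 < y 0 -> 0 <= z 0 ->
  forall t, 0 < t < T ->
  (y 0 + s^-1 * z 0) / 2 * expR (2 * s * t) + (y 0 - s^-1 * z 0) / 2 * expR (- (2 * s * t)) < y t.
Proof.
move=> s0 sk T0 cy cz yd zd hz y0 y00 z00.
have k0 : 0 < k by apply: le_lt_trans sk; exact: sqr_ge0.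
(* The gap between s^2 and k yields a strict inequality only where y > 0; this and the next claim
   establish it. *)
have zp t : 0 <= t < T -> 0 <= z t.
  move=> /andP[t0 tT]; apply: (le_trans z00).
  apply: (@ge0_deriv_le z z') => //.
  - by move=> u /andP[u0 ut]; apply: zd; rewrite u0 (lt_trans ut).
  - by apply: within_subitv cz; rewrite t0 ltW.
  - move=> u /andP[u0 ut]; apply: (@le_trans _ _ (2 * k * y u)).
      by rewrite !mulr_ge0// ?(ltW k0)// y0// !ltW// (lt_trans ut).
    by apply: hz; rewrite u0 (lt_trans ut).
have yp t : 0 <= t < T -> 0 < y t.
  move=> /andP[t0 tT]; apply: (lt_le_trans y00).
  apply: (@ge0_deriv_le y (fun t => 2 * z t)) => //.
  - by move=> u /andP[u0 ut]; apply: yd; rewrite u0 (lt_trans ut).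
  - by apply: within_subitv cy; rewrite t0 ltW.
  - by move=> u /andP[u0 ut]; rewrite mulr_ge0// zp// (ltW u0) (lt_trans ut).
pose c := z 0 + s * y 0.
(* Factorisation D^2 - 4 s^2 = (D - 2 s) (D + 2 s): as y' = 2 z, z + s y is half of (D + 2 s) y, and
   it is integrated against exp (- 2 s t). *)
have p1 t : 0 < t < T -> c < expR (- (2 * s) * t) * (z t + s * y t).
  move=> /andP[t0 tT].
  have -> : c = expR (- (2 * s) * 0) * (z 0 + s * y 0) by rewrite mulr0 expR0 mul1r.
  apply: (@gt0_deriv_lt (fun t => expR (- (2 * s) * t) * (z t + s * y t))
     (fun t => expR (- (2 * s) * t) * (- (2 * s) * (z t + s * y t) + (z' t + s * (2 * z t))))) => //.
  - move=> u /andP[u0 ut]; apply: is_derive_expRM.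
    have uT : 0 < u < T by rewrite u0 (lt_trans ut).
    by apply: is_deriveD; [exact: zd|apply: (is_derive_eq (is_deriveZ s (yd _ uT)))].
  - apply: continuous_expRM.
    apply: (@within_subitv _ T); first by rewrite !ltW.
    move=> /= x; apply: (continuousD (cz x)).
    by apply: continuousM; [exact: cst_continuous|exact: cy].
  - move=> u /andP[u0 ut]; rewrite mulr_gt0 ?expR_gt0//.
    have uT : 0 < u < T by rewrite u0 (lt_trans ut).
    have h1 := hz _ uT; have h2 : 0 < y u by apply: yp; case/andP: uT => /ltW -> ->.
    have : s ^+ 2 * y u < k * y u by rewrite ltr_pM2r.
    by lra.
move=> t /andP[t0 tT].
(* The second factor: the derivative of exp (2 s t) y is 2 exp (2 s t) (z + s y), which exceeds 2 c
   exp (4 s t) by [p1]. *)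
have p2 : y 0 - c / (2 * s) * expR (4 * s * 0) < expR (2 * s * t) * y t - c / (2 * s) * expR (4 * s * t).
  have -> : y 0 = expR (2 * s * 0) * y 0 by rewrite mulr0 expR0 mul1r.
  have := @gt0_deriv_lt (fun t => expR (2 * s * t) * y t - c / (2 * s) * (expR (4 * s * t) * 1))
     (fun t => expR (2 * s * t) * (2 * s * y t + 2 * z t)
        - c / (2 * s) * (expR (4 * s * t) * (4 * s * 1 + 0))) 0 t t0.
  rewrite !mulr1; apply.
  - move=> u /andP[u0 ut].
    have uT : 0 < u < T by rewrite u0 (lt_trans ut).
    apply: is_deriveB; first exact: is_derive_expRM (yd _ uT).
    by apply: (is_derive_eq (is_deriveZ _ (is_derive_expRM (4 * s) (is_derive_cst (1:R) u 1)))); rewrite /= !mulr1.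
  - apply: (@within_subitv _ T); first by rewrite !ltW.
    have c1 := @continuous_expRM (2 * s) T y cy.
    have c2 : {within `[0, T], continuous (fun t => expR (4 * s * t) * 1)}.
      by apply: continuous_expRM => x'; exact: cst_continuous.
    move=> /= x; apply: (continuousB (c1 x)).
    by apply: continuousM; [exact: cst_continuous|exact: c2].
  - move=> u /andP[u0 ut].
    have uT : 0 < u < T by rewrite u0 (lt_trans ut).
    have h := p1 _ uT.
    have e1 : expR (4 * s * u) = expR (2 * s * u) * expR (2 * s * u) by rewrite -expRD; congr expR; ring.
    have e2 : expR (- (2 * s) * u) * expR (2 * s * u) = 1 by rewrite -expRD -mulrDl addNr mul0r expR0.
    have E0 := expR_gt0 (2 * s * u).
    have : c * expR (2 * s * u) < z u + s * y u.
      by move: h; rewrite -(ltr_pM2r E0) (mulrAC _ (z u + _)) e2 mul1r.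
    move=> h2; rewrite addr0 e1.
    have -> : c / (2 * s) * (expR (2 * s * u) * expR (2 * s * u) * (4 * s)) =
       expR (2 * s * u) * (2 * (c * expR (2 * s * u))) by field; rewrite gt_eqF.
    by rewrite -mulrBr mulr_gt0//; lra.
rewrite mulr0 expR0 mulr1 in p2.
have e1 : expR (4 * s * t) = expR (2 * s * t) * expR (2 * s * t) by rewrite -expRD; congr expR; ring.
have e2 : expR (- (2 * s * t)) * expR (2 * s * t) = 1 by rewrite -expRD addNr expR0.
have E0 := expR_gt0 (2 * s * t).
rewrite -(ltr_pM2l E0).
have -> : expR (2 * s * t) * ((y 0 + s^-1 * z 0) / 2 * expR (2 * s * t) +
   (y 0 - s^-1 * z 0) / 2 * expR (- (2 * s * t))) =
   (y 0 + s^-1 * z 0) / 2 * expR (4 * s * t) + (y 0 - s^-1 * z 0) / 2 * (expR (- (2 * s * t)) * expR (2 * s * t)).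
  by rewrite e1; ring.
rewrite e2 mulr1.
have -> : (y 0 + s^-1 * z 0) / 2 * expR (4 * s * t) + (y 0 - s^-1 * z 0) / 2 =
  y 0 - c / (2 * s) + c / (2 * s) * expR (4 * s * t).
  by rewrite /c; field; rewrite gt_eqF.
lra.
Qed.

End Comparison.

(** * Sine coefficients of primitives with the weight sin *)

Section SineWeight.
Variable R : realType.
Implicit Types (h F : R -> R) (x : R) (k n : nat).

Lemma continuous_sin_mul h : continuous h -> continuous (fun x => sin x * h x).
Proof. by apply: continuous_mul; exact: continuous_sin. Qed.

Lemma antideriv_Ncos k : (0 < k)%N ->
  antideriv (fun x => - (k%:R^-1 * cos (k%:R * x))) (fun x : R => sin (k%:R * x)).
Proof.
move=> k0; have kn0 : k%:R != 0 :> R by rewrite pnatr_eq0 -lt0n.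
apply: antideriv_ext (antiderivZ (- k%:R^-1) (@antideriv_cos R k%:R)) _ _ => x.
  by rewrite mulNr.
by rewrite mulrNN mulrA mulVf// mul1r.
Qed.

Lemma sincoef_by_parts F f k : (0 < k)%N -> antideriv F f -> continuous f ->
  k%:R * sincoef F k = itg 0 pi (fun x => f x * cos (k%:R * x)) + F 0 - F pi * cos (k%:R * pi).
Proof.
move=> k0 Ff cf; have kn0 : k%:R != 0 :> R by rewrite pnatr_eq0 -lt0n.
have cs := @continuous_sin_scale R k%:R; have cc := @continuous_cos_scale R k%:R.
rewrite /sincoef (itg_by_parts (pi_ge0 R) Ff (antideriv_Ncos k0) cf cs).
have -> : itg 0 pi (fun x => f x * - (k%:R^-1 * cos (k%:R * x))) =
    - k%:R^-1 * itg 0 pi (fun x => f x * cos (k%:R * x)).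
  rewrite -itgZ; last exact: continuous_mul.
  by apply: eq_itg => x _; ring.
rewrite mulr0 cos0 mulr1; move: (itg _ _ _) (F pi) (cos _) => I P c.
by field.
Qed.

Lemma sincoef0 h : sincoef h 0 = 0.
Proof.
rewrite /sincoef -[RHS](mul0r (pi - 0)) -itg_cst ?pi_ge0//.
by apply: eq_itg => x _; rewrite mul0r sin0 mulr0.
Qed.

Lemma itg_sin_mul_cos h k : (0 < k)%N -> continuous h ->
  itg 0 pi (fun x => sin x * h x * cos (k%:R * x)) = 2^-1 * (sincoef h k.+1 - sincoef h k.-1).
Proof.
case: k => // k _ ch; rewrite /sincoef.
have cs n : continuous (fun x => h x * sin (n%:R * x)).
  by apply: continuous_mul => //; exact: continuous_sin_scale.
rewrite -itgB// -itgZ; last exact: continuous_sub.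
apply: eq_itg => x _.
rewrite -[in sin x](mul1r x) mulrAC sin_mul_cos /=.
rewrite (_ : 1 * x - k.+1%:R * x = - (k%:R * x)); last by rewrite -natr1; ring.
rewrite (_ : 1 * x + k.+1%:R * x = k.+2%:R * x); last by rewrite -!natr1; ring.
by rewrite sinN; ring.
Qed.

Lemma prim_sin_pi h : prim (fun x => sin x * h x) pi = sincoef h 1.
Proof. by rewrite /prim pi_ge0; apply: eq_itg => x _; rewrite mul1r mulrC. Qed.

(** [sincoef h 1 = 0] says that the primitive vanishes at pi, which kills the boundary term of the
    integration by parts. *)
Lemma sincoef_prim_sin h k : (0 < k)%N -> continuous h -> sincoef h 1 = 0 ->
  2 * k%:R * sincoef (prim (fun x => sin x * h x)) k = sincoef h k.+1 - sincoef h k.-1.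
Proof.
move=> k0 ch h1; have cs := continuous_sin_mul ch.
rewrite -mulrA (sincoef_by_parts k0 (prim_antideriv cs) cs) prim_sin_pi h1 prim0.
by rewrite itg_sin_mul_cos//; field.
Qed.

Lemma derive1_antideriv F f x : antideriv F f -> derive1 F x = f x.
Proof. by move=> Ff; have := Ff x => -[_ <-]; rewrite derive1E. Qed.

End SineWeight.

(** * Sine coefficients of L^+ eta *)

Section LinearizedOperator.
Variable R : realType.
Variables (eta psi : R -> R) (M : R).
Hypothesis eta_psi : antideriv eta psi.
Hypothesis cpsi : continuous psi.
Hypothesis psiM : forall x, `|psi x| <= M.
Hypothesis eta_per : periodic2pi eta.
Hypothesis eta_odd : oddfun eta.
Implicit Types (x y s e : R) (j k n : nat).

Let ceta : continuous eta := antideriv_continuous eta_psi.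
Local Notation H := (hilC1 eta).

Let cH : continuous H := hilC1_continuous eta_psi cpsi psiM.

Lemma odd_periodic0 : eta 0 = 0.
Proof. by have := eta_odd 0; rewrite oppr0; lra. Qed.

Lemma odd_periodic_pi : eta pi = 0.
Proof.
have := eta_per (- pi); rewrite (_ : - pi + 2 * pi = pi); last by ring.
by rewrite eta_odd; lra.
Qed.

Lemma vfun_antideriv : antideriv (vfun eta) H.
Proof.
have -> : vfun eta = prim H; last exact: prim_antideriv.
have e : hilbert eta = H by apply/funext => x; exact: (hilbertE eta_psi cpsi psiM).
by apply/funext => x; rewrite /vfun /prim e.
Qed.

Lemma itg_hilC1_cos_half j : itg 0 pi (fun x => H x * cos (j%:R * x)) = - sincoef eta j.
Proof.
have := itg_hilC1_cos eta_psi cpsi psiM eta_per j.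
rewrite !itg_even_sym.
- by rewrite -/(sincoef eta j); lra.
- by apply: continuous_mul => //; exact: continuous_sin_scale.
- by move=> x; rewrite eta_odd mulrN sinN mulrNN.
- by apply: continuous_mul => //; exact: continuous_cos_scale.
- by move=> x; rewrite (hilC1_even eta_odd) mulrN cosN.
Qed.

Lemma vfun0 : vfun eta 0 = 0.
Proof. by rewrite /vfun lexx set_itv1 Rintegral_set1. Qed.

(** H eta has mean zero on [0, pi]: its cosine coefficient of index 0 is minus the sine coefficient
    of index 0 of eta. *)
Lemma vfun_pi : vfun eta pi = 0.
Proof.
have := ftc2 (pi_ge0 R) vfun_antideriv cH; rewrite vfun0 subr0 => h.
rewrite -h; have := itg_hilC1_cos_half 0; rewrite sincoef0 oppr0; apply: etrans.
by apply: eq_itg => x _; rewrite mul0r cos0 mulr1.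
Qed.

Definition ustream x := eta x / 2 + vfun eta x.
Definition dustream x := psi x / 2 + H x.

Lemma ustream_antideriv : antideriv ustream dustream.
Proof.
apply: antiderivD; last exact: vfun_antideriv.
by apply: antideriv_ext (antiderivZ 2^-1 eta_psi) _ _ => x; rewrite mulrC.
Qed.

Lemma dustream_continuous : continuous dustream.
Proof.
apply: continuous_add => //.
have -> : (fun x => psi x / 2) = (fun x => 2^-1 * psi x) by apply/funext => x; rewrite mulrC.
exact: continuous_scale.
Qed.

Lemma LplusE x : Lplus eta x = ustream x * (2 * cos (2 * x)) - sin (2 * x) * dustream x.
Proof.
rewrite /Lplus /bracket /dth (derive1_antideriv x (@antideriv_sin R 2)).
by rewrite (derive1_antideriv x ustream_antideriv).
Qed.

Lemma Lplus_continuous : continuous (Lplus eta).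
Proof.
have -> : Lplus eta = (fun x => ustream x * (2 * cos (2 * x)) - sin (2 * x) * dustream x).
  by apply/funext => x; exact: LplusE.
have cu := antideriv_continuous ustream_antideriv.
have cd := dustream_continuous.
apply: continuous_sub; apply: continuous_mul => //.
  by apply: continuous_scale; exact: continuous_cos_scale.
exact: continuous_sin_scale.
Qed.

Lemma Lplus_pi : Lplus eta pi = 0.
Proof.
rewrite LplusE /ustream odd_periodic_pi vfun_pi mul0r addr0 mul0r.
by rewrite (sinpin R 2) mul0r subr0.
Qed.

(** As v' = H eta and v vanishes at 0 and pi, integration by parts gives v the coefficient - 1/j
    times that of eta. *)
Lemma sincoef_ustream j : (0 < j)%N -> sincoef ustream j = (2^-1 - j%:R^-1) * sincoef eta j.
Proof.
move=> j0; have jn0 : j%:R != 0 :> R by rewrite pnatr_eq0 -lt0n.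
have h := sincoef_by_parts j0 vfun_antideriv cH.
rewrite vfun_pi vfun0 itg_hilC1_cos_half mul0r subr0 addr0 in h.
have cv := antideriv_continuous vfun_antideriv.
have cs := @continuous_sin_scale R j%:R.
have c1 := continuous_mul ceta cs; have c2 := continuous_mul cv cs.
have -> : sincoef ustream j = 2^-1 * sincoef eta j + sincoef (vfun eta) j.
  rewrite /sincoef -itgZ// -itgD//; last exact: continuous_scale.
  by apply: eq_itg => x _; rewrite /ustream; ring.
have -> : sincoef (vfun eta) j = - (j%:R^-1 * sincoef eta j).
  by rewrite -mulrN -h mulrA mulVf// mul1r.
by ring.
Qed.

(** The derivative of the stream function is moved onto sin (2 x) sin (k x), which vanishes at both
    ends. The frequencies are real numbers because k - 2 may be negative. *)
Lemma sincoef_Lplus_raw k : sincoef (Lplus eta) k =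
  (2 + k%:R / 2) * itg 0 pi (fun x => ustream x * sin ((k%:R + 2) * x)) +
  (2 - k%:R / 2) * itg 0 pi (fun x => ustream x * sin ((k%:R - 2) * x)).
Proof.
have cu := antideriv_continuous ustream_antideriv; have cd := dustream_continuous.
have s2 := @continuous_sin_scale R 2; have c2 := @continuous_cos_scale R 2.
have sk := @continuous_sin_scale R k%:R; have ck := @continuous_cos_scale R k%:R.
pose G x := sin (2 * x) * sin (k%:R * x).
pose g x := 2 * cos (2 * x) * sin (k%:R * x) + sin (2 * x) * (k%:R * cos (k%:R * x)).
have Gg : antideriv G g by exact: (antiderivM (@antideriv_sin R 2) (@antideriv_sin R k%:R)).
have cg : continuous g.
  apply: continuous_add; apply: continuous_mul => //; exact: continuous_scale.
have cG : continuous G by exact: continuous_mul.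
have ibp := itg_by_parts (pi_ge0 R) ustream_antideriv Gg cd cg.
have Gpi : G pi = 0 by rewrite /G (sinpin R 2) mul0r.
have G0 : G 0 = 0 by rewrite /G mulr0 sin0 mul0r.
rewrite Gpi G0 !mulr0 subrr sub0r in ibp.
have cu2 := continuous_mul cu (continuous_mul (@continuous_scale R 2 _ c2) sk).
have cdG := continuous_mul cd cG; have cug := continuous_mul cu cg.
have -> : sincoef (Lplus eta) k =
    itg 0 pi (fun x => ustream x * (2 * cos (2 * x) * sin (k%:R * x))) - itg 0 pi (fun x => dustream x * G x).
  rewrite -itgB//; apply: eq_itg => x _; rewrite LplusE /G; ring.
rewrite -ibp -itgD// -!itgZ.
- rewrite -itgD.
  + apply: eq_itg => x _; rewrite /g.
    have -> : sin ((k%:R + 2) * x) = sin (k%:R * x) * cos (2 * x) + cos (k%:R * x) * sin (2 * x).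
      by rewrite mulrDl sinD.
    have -> : sin ((k%:R - 2) * x) = sin (k%:R * x) * cos (2 * x) - cos (k%:R * x) * sin (2 * x).
      by rewrite mulrBl sinB.
    move: (sin (2 * x)) (cos (2 * x)) (sin (k%:R * x)) (cos (k%:R * x)) (ustream x) => s1 t1 t2 t3 u.
    by field.
  + by apply: continuous_scale; apply: continuous_mul => //; exact: continuous_sin_scale.
  + by apply: continuous_scale; apply: continuous_mul => //; exact: continuous_sin_scale.
- by apply: continuous_mul => //; exact: continuous_sin_scale.
- by apply: continuous_mul => //; exact: continuous_sin_scale.
Qed.

Lemma sincoef_Lplus1 : sincoef (Lplus eta) 1 = 5 / 12 * sincoef eta 3 + 3 / 4 * sincoef eta 1.
Proof.
rewrite sincoef_Lplus_raw.
have -> : itg 0 pi (fun x => ustream x * sin ((1%:R + 2) * x)) = sincoef ustream 3.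
  by apply: eq_itg => x _; rewrite -natrD.
have -> : itg 0 pi (fun x => ustream x * sin ((1%:R - 2) * x)) = - sincoef ustream 1.
  transitivity (-1 * sincoef ustream 1); last by rewrite mulN1r.
  rewrite /sincoef -itgZ.
    by apply: eq_itg => x _; rewrite (_ : (1 - 2) * x = - (1 * x)) ?sinN; ring.
  apply: continuous_mul; last exact: continuous_sin_scale.
  exact: antideriv_continuous ustream_antideriv.
by rewrite !sincoef_ustream//; field.
Qed.

Lemma sincoef_Lplus k : sincoef (Lplus eta) k.+2 =
  (2 + k.+2%:R / 2) * ((2^-1 - k.+4%:R^-1) * sincoef eta k.+4) +
  (2 - k.+2%:R / 2) * ((2^-1 - k%:R^-1) * sincoef eta k).
Proof.
rewrite sincoef_Lplus_raw.
have -> : itg 0 pi (fun x => ustream x * sin ((k.+2%:R + 2) * x)) = sincoef ustream k.+4.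
  by apply: eq_itg => x _; rewrite -natrD addn2.
have -> : itg 0 pi (fun x => ustream x * sin ((k.+2%:R - 2) * x)) = sincoef ustream k.
  by apply: eq_itg => x _; rewrite -natrB// subn2.
(* For [k = 0] the junk value of 0^-1 is multiplied by [sincoef eta 0 = 0]. *)
rewrite sincoef_ustream//; case: k => [|k]; first by rewrite !sincoef0 !mulr0.
by rewrite sincoef_ustream.
Qed.

Lemma vfun_odd x : vfun eta (- x) = - vfun eta x.
Proof.
have a : antideriv (fun x => vfun eta x + vfun eta (-1 * x + 0)) (fun=> 0).
  apply: antideriv_ext (antiderivD vfun_antideriv (antideriv_shift (-1) 0 vfun_antideriv)) _ _ => y //.
  by rewrite addr0 !mulN1r (hilC1_even eta_odd) subrr.
have := antideriv0_cst x 0 a; rewrite mulr0 !addr0 vfun0 addr0 mulN1r.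
by move/eqP; rewrite addrC addr_eq0 => /eqP.
Qed.

Lemma antideriv_odd_even F f : antideriv F f -> oddfun F -> forall x, f (- x) = f x.
Proof.
move=> Ff Fo x.
have h : antideriv F (fun x => f (- x)).
  apply: antideriv_ext (antiderivZ (-1) (antideriv_shift (-1) 0 Ff)) _ _ => y.
    by rewrite addr0 !mulN1r Fo opprK.
  by rewrite addr0 !mulN1r opprK.
by have [_ <-] := h x; have [_ <-] := Ff x.
Qed.

Lemma Lplus_odd : oddfun (Lplus eta).
Proof.
have uo : oddfun ustream by move=> x; rewrite /ustream eta_odd vfun_odd; ring.
move=> x; rewrite !LplusE uo (antideriv_odd_even ustream_antideriv uo).
by rewrite mulrN cosN sinN; ring.
Qed.

Section Matrix.
Variable g : R -> R.
Hypothesis cg : continuous g.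
Hypothesis psi_g : forall x, 0 <= x <= pi -> psi x = sin x * g x.

Lemma eta_prim x : 0 <= x <= pi -> eta x = prim (fun x => sin x * g x) x.
Proof.
move=> /andP[x0 xpi]; rewrite /prim x0.
have := ftc2 x0 eta_psi cpsi; rewrite odd_periodic0 subr0 => <-.
by apply: eq_itg => y /andP[y0 yx]; rewrite psi_g// y0 (le_trans yx).
Qed.

Lemma sincoef_g1 : sincoef g 1 = 0.
Proof. by rewrite -prim_sin_pi -eta_prim ?odd_periodic_pi ?pi_ge0 ?lexx. Qed.

Lemma Lmat1 : Lmat (sincoef g) 1 = 0.
Proof. 
have d2 : dcoef R 2 = 0 by rewrite /dcoef subrr expr0n /= !mul0r.
by rewrite /Lmat sincoef_g1 /= sincoef0 d2 !(mulr0, mul0r) addr0 subr0. Qed.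

Lemma sincoef_eta k : sincoef eta k.+1 = (sincoef g k.+2 - sincoef g k) / (2 * k.+1%:R).
Proof.
rewrite -(@sincoef_prim_sin R g k.+1 isT cg sincoef_g1).
rewrite (mulrC (2 * _)) mulfK; last by rewrite mulf_neq0// pnatr_eq0.
by apply: eq_itg => x x0; rewrite eta_prim.
Qed.

(** A difference of two rows in the divergence form explained at [mucoef]. Row 0 of [Lmat] has no
    meaning, hence the value 0 for [k = 0]. *)
Lemma sincoef_Lplus_Lmat k : 2 * k.+1%:R * sincoef (Lplus eta) k.+1 =
  Lmat (sincoef g) k.+2 - (if k is 0 then 0 else Lmat (sincoef g) k).
Proof.
case: k => [|[|k]].
- rewrite sincoef_Lplus1 !sincoef_eta sincoef0 /Lmat /mucoef /dcoef /= sincoef0.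
  by move: (sincoef g 2) (sincoef g 4) => a b; field.
- rewrite sincoef_Lplus sincoef0 !sincoef_eta Lmat1 subr0 /Lmat /mucoef /dcoef /= sincoef_g1.
  rewrite !mulr0 subr0 addr0.
  by move: (sincoef g 3) (sincoef g 5) => a b; field.
- rewrite sincoef_Lplus !sincoef_eta /Lmat /mucoef /dcoef /= !subn2 /=.
  rewrite -(@natr1 R k.+4) -(@natr1 R k.+3) -(@natr1 R k.+2) -(@natr1 R k.+1) -(@natr1 R k).
  have k0 : 0 <= k%:R :> R by [].
  move: (k%:R : R) k0 (sincoef g k) (sincoef g k.+2) (sincoef g k.+4) (sincoef g k.+4.+2) => x x0 a b c d.
  by field; do ?[apply/andP; split]; apply: lt0r_neq0; lra.
Qed.

(** The coefficients of [g1] and the rows of [Lmat] have the same increments at distance 2 and start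
    from 0 in both parities. *)
Lemma sincoef_Lmat g1 : continuous g1 ->
  (forall x, 0 <= x <= pi -> Lplus eta x = prim (fun x => sin x * g1 x) x) ->
  sincoef g1 1 = 0 /\ forall n, sincoef g1 n.+2 = Lmat (sincoef g) n.+2.
Proof.
move=> cg1 Lg1.
have g11 : sincoef g1 1 = 0 by rewrite -prim_sin_pi -Lg1 ?Lplus_pi ?pi_ge0 ?lexx.
have rec k : sincoef g1 k.+2 = sincoef g1 k + 2 * k.+1%:R * sincoef (Lplus eta) k.+1.
  have := @sincoef_prim_sin R g1 k.+1 isT cg1 g11.
  have -> : sincoef (prim (fun x => sin x * g1 x)) k.+1 = sincoef (Lplus eta) k.+1.
    by apply: eq_itg => x x0; rewrite Lg1.
  by move=> -> /=; ring.
split => //.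
have both m : sincoef g1 m.+2 = Lmat (sincoef g) m.+2 /\ sincoef g1 m.+3 = Lmat (sincoef g) m.+3.
  elim: m => [|m [IH1 IH2]]; split=> //; rewrite rec sincoef_Lplus_Lmat.
  - by rewrite sincoef0 add0r subr0.
  - by rewrite g11 Lmat1 add0r subr0.
  - by rewrite IH1 addrC subrK.
by move=> n; case: (both n).
Qed.

(** A converse to [sincoef_Lmat] through uniqueness of sine coefficients. It serves at time 0, where
    the coefficients are known by continuity in time while the equation is given for later times. *)
Lemma Lplus_eq_prim g1 : continuous g1 -> sincoef g1 1 = 0 ->
  (forall n, sincoef g1 n.+2 = Lmat (sincoef g) n.+2) ->
  forall x, 0 < x < pi -> Lplus eta x = prim (fun x => sin x * g1 x) x.
Proof.
move=> cg1 g11 H1 x hx; have cs := continuous_sin_mul cg1.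
have cP := antideriv_continuous (prim_antideriv cs).
apply/eqP; rewrite -subr_eq0; apply/eqP.
apply: (@sine_uniqueness R (fun x => Lplus eta x - prim (fun x => sin x * g1 x) x)) => //.
  exact: (continuous_sub Lplus_continuous cP).
case=> [|k]; first exact: sincoef0.
have sk := @continuous_sin_scale R k.+1%:R.
have c1 := continuous_mul Lplus_continuous sk; have c2 := continuous_mul cP sk.
have -> : itg 0 pi (fun x => (Lplus eta x - prim (fun x => sin x * g1 x) x) * sin (k.+1%:R * x)) =
    sincoef (Lplus eta) k.+1 - sincoef (prim (fun x => sin x * g1 x)) k.+1.
  by rewrite /sincoef -itgB//; apply: eq_itg => y _; rewrite mulrBl.
have n0 : 2 * k.+1%:R != 0 :> R by rewrite mulf_neq0// pnatr_eq0.
apply: (mulfI n0); rewrite mulr0 mulrBr sincoef_Lplus_Lmat sincoef_prim_sin//=.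
rewrite H1; case: k {sk c1 c2 n0} => [|[|k]]; first by rewrite sincoef0 !subr0 subrr.
  by rewrite g11 Lmat1 subrr.
by rewrite H1 subrr.
Qed.

End Matrix.
End LinearizedOperator.

(** * Cosine series of Sobolev functions *)

Section Sobolev.
Variable R : realType.
Local Notation mu := (@lebesgue_measure R).
Implicit Types (f g : R -> R) (m k n : nat) (c d x : R).

Definition sob_term m f k : R :=
  (1 + (k%:R : R) ^+ 2) ^+ m * (fcos f k ^+ 2 + fsin f k ^+ 2).

Lemma sob_term_ge0 m f k : 0 <= sob_term m f k.
Proof. by rewrite mulr_ge0 ?exprn_ge0 ?addr_ge0 ?sqr_ge0. Qed.

Lemma sob_term_partial_le m f n : in_Hm m f -> \sum_(k < n) sob_term m f k <= Hm_norm m f ^+ 2.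
Proof.
case=> _ _ _ fin.
have s0 : (0 <= sob_sum m f)%E by apply: nneseries_ge0 => k _ _; rewrite lee_fin sob_term_ge0.
have fn : sob_sum m f \is a fin_num by rewrite ge0_fin_numE.
rewrite /Hm_norm sqr_sqrtr; last by rewrite fine_ge0.
rewrite -lee_fin fineK// -sumEFin -(big_mkord xpredT (fun k => (sob_term m f k)%:E)).
by apply: nneseries_lim_ge => k _ _; rewrite lee_fin sob_term_ge0.
Qed.

Lemma sob_sum_lt_pinfty m f B : (forall n, \sum_(k < n) sob_term m f k <= B) -> (sob_sum m f < +oo)%E.
Proof.
move=> h; apply: (@le_lt_trans _ _ B%:E); last exact: ltry.
apply: lime_le.
  by apply: is_cvg_nneseries => k _ _; rewrite lee_fin sob_term_ge0.
apply: nearW => n; rewrite big_mkord sumEFin lee_fin; exact: h.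
Qed.

(** Induction on the stronger bound 3 - 2 / (j + 1), whose increments 2 / ((j + 1) (j + 2)) dominate
    the terms. *)
Lemma sum_inv_sqr_le n : \sum_(k < n) (1 + (k%:R : R) ^+ 2)^-1 <= 3.
Proof.
have h j : \sum_(k < j.+1) (1 + (k%:R : R) ^+ 2)^-1 <= 3 - 2 / j.+1%:R.
  elim: j => [|j IH]; first by rewrite big_ord1 expr0n addr0 invr1; lra.
  rewrite big_ord_recr /= (le_trans (lerD IH (lexx _)))//.
  rewrite -[j.+2%:R]natr1 -[j.+1%:R]natr1; have : 0 <= j%:R :> R by [].
  move: (j%:R : R) => x x0.
  have p1 : 0 < x + 1 by lra.
  have p2 : 0 < x + 1 + 1 by lra.
  have p3 : 0 < 1 + (x + 1) ^+ 2 by rewrite ltr_wpDr// sqr_ge0.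
  rewrite -subr_ge0.
  have -> : 3 - 2 / (x + 1 + 1) - (3 - 2 / (x + 1) + (1 + (x + 1) ^+ 2)^-1) =
     (x ^+ 2 + x + 2) / ((x + 1) * (x + 1 + 1) * (1 + (x + 1) ^+ 2)).
    by field; rewrite !gt_eqF.
  by rewrite divr_ge0//; [nra|rewrite !mulr_ge0// ltW].
case: n => [|n]; first by rewrite big_ord0.
by apply: (le_trans (h n)); rewrite gerBl divr_ge0.
Qed.

(* Weighted AM-GM [|a_k| <= (N r_k + T_k / N) / 2] with [r_k = (1 + k^2)^-1];
   [N] is the norm plus [e], to allow a vanishing norm. *)
Lemma sum_fcos_le m f n : (0 < m)%N -> in_Hm m f -> \sum_(k < n) `|fcos f k| <= 2 * Hm_norm m f.
Proof.
move=> m0 Hf; apply/ler_addgt0Pl => e e0.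
have N0 : 0 <= Hm_norm m f by exact: sqrtr_ge0.
have Tle := sob_term_partial_le n Hf.
move: (Hm_norm m f) N0 Tle => H H0 Tle.
have N0 : 0 < H + e / 2 by rewrite ltr_wpDl// divr_gt0.
pose N := H + e / 2.
have step k : `|fcos f k| <= (N * (1 + k%:R ^+ 2)^-1 + N^-1 * sob_term m f k) / 2.
  have q0 : 1 <= 1 + (k%:R : R) ^+ 2 by rewrite lerDl sqr_ge0.
  have T1 : (1 + (k%:R : R) ^+ 2) * fcos f k ^+ 2 <= sob_term m f k.
    rewrite /sob_term; apply: ler_pM => //; rewrite ?sqr_ge0 ?(le_trans _ q0)//.
      by rewrite -[leLHS]expr1 ler_weXn2l.
    by rewrite lerDl sqr_ge0.
  have : N * (1 + k%:R ^+ 2)^-1 + N^-1 * ((1 + (k%:R : R) ^+ 2) * fcos f k ^+ 2)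
     <= N * (1 + k%:R ^+ 2)^-1 + N^-1 * sob_term m f k.
    by rewrite lerD2l ler_pM2l// invr_gt0.
  move: (1 + (k%:R : R) ^+ 2) q0 {T1} => q q1.
  have q0 : 0 < q by lra.
  rewrite -(real_normK (num_real (fcos f k))); move: `|fcos f k| (sob_term m f k) => a T.
  have : 0 <= (N - q * a) ^+ 2 / (N * q) by rewrite divr_ge0 ?sqr_ge0// mulr_ge0// ltW.
  have -> : (N - q * a) ^+ 2 / (N * q) = N * q^-1 + N^-1 * (q * a ^+ 2) - 2 * a.
    by field; rewrite !gt_eqF.
  by lra.
apply: (le_trans (ler_sum _ (fun (k : 'I_n) _ => step k))).
rewrite -mulr_suml big_split /= -!mulr_sumr.
have h1 : N * (\sum_(k < n) (1 + (k%:R : R) ^+ 2)^-1) <= N * 3 by rewrite ler_pM2l// sum_inv_sqr_le.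
have h2 : N^-1 * (\sum_(k < n) sob_term m f k) <= N.
  rewrite mulrC ler_pdivrMr// (le_trans Tle)// -expr2 ler_sqr ?nnegrE ?(ltW N0)//.
  by rewrite lerDl ltW// divr_gt0.
by rewrite /N in h1 h2 *; lra.
Qed.

(** [fcos] integrates over a whole period, hence twice the square norm on [0, pi]. *)
Definition wcoef f k : R := fcos f k / (2 * cosnorm R k).
Definition wser f : R -> R := cosser (wcoef f).

Lemma cosnorm_ge1 k : 1 <= cosnorm R k.
Proof. by rewrite /cosnorm; have := pi_ge2 R; case: ifP; lra. Qed.

Lemma wcoef_norm_le f k : `|wcoef f k| <= `|fcos f k| / 2.
Proof.
have c1 := cosnorm_ge1 k; rewrite /wcoef normrM normfV.
rewrite ler_wpM2l// ger0_norm; last lra.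
by rewrite lef_pV2 ?posrE; lra.
Qed.

Lemma wcoef_partial_le m f n : (0 < m)%N -> in_Hm m f -> series (fun k => `|wcoef f k|) n <= Hm_norm m f.
Proof.
move=> m0 Hf; rewrite /series /= big_mkord.
apply: (le_trans (ler_sum _ (fun (k : 'I_n) _ => wcoef_norm_le f k))).
by rewrite -mulr_suml; have := sum_fcos_le n m0 Hf; lra.
Qed.

Lemma wcoef_cvg m f : (0 < m)%N -> in_Hm m f -> cvgn (series (fun k => `|wcoef f k|)).
Proof.
move=> m0 Hf; apply: nondecreasing_is_cvgn; first by apply: nondecreasing_series.
by exists (Hm_norm m f) => _ [n _ <-]; exact: wcoef_partial_le.
Qed.

(** Sobolev embedding with constant 1: the 2 of [sum_fcos_le] cancels the 1/2 of [wcoef_norm_le]. It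
    turns every H^m statement in time into a uniform one in x. *)
Lemma wser_le m f x : (0 < m)%N -> in_Hm m f -> `|wser f x| <= Hm_norm m f.
Proof.
move=> m0 Hf; have ca := wcoef_cvg m0 Hf; apply: (le_trans (cosser_bound ca x)).
by apply: limr_le => //; apply: nearW => n; exact: wcoef_partial_le.
Qed.

Lemma wser_ucos m f : (0 < m)%N -> in_Hm m f -> ucos (wser f).
Proof. by move=> m0 Hf; exact: cosser_ucos (wcoef_cvg m0 Hf). Qed.

Lemma integrable_itvD f g a b : mu.-integrable `[a, b] (EFin \o f) ->
  mu.-integrable `[a, b] (EFin \o g) -> mu.-integrable `[a, b] (EFin \o (fun x => f x + g x)).
Proof.
by move=> fi gi; have := @integrableD _ _ _ mu _ (measurable_itv _) _ _ fi gi; apply: eq_integrable.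
Qed.

Lemma integrable_itvZ (c : R) f a b : mu.-integrable `[a, b] (EFin \o f) ->
  mu.-integrable `[a, b] (EFin \o (fun x => c * f x)).
Proof.
by move=> fi; have := @integrableZl _ _ _ mu _ (measurable_itv _) c _ fi; apply: eq_integrable.
Qed.

Lemma in_Hm_integrable m f : in_Hm m f -> mu.-integrable `[- pi, pi] (EFin \o f).
Proof.
case=> _ mf f2 _.
have i1 : mu.-integrable `[- pi, pi] (EFin \o (fun x => 1 + f x ^+ 2)).
  have h1 := @continuous_integrable_itv R (fun=> 1) (- pi) pi (@continuous_const R 1).
  exact: integrable_itvD h1 f2.
apply: le_integrable i1 => //.
  exact/measurable_EFinP.
move=> x _ /=; rewrite lee_fin (@ger0_norm _ (1 + _)) ?addr_ge0 ?sqr_ge0//.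
rewrite -(real_normK (num_real (f x))); move: `|f x| => a.
by have := sqr_ge0 (a - 1); nra.
Qed.

Lemma itg_lin f g q c d : mu.-integrable `[- pi, pi] (EFin \o f) -> mu.-integrable `[- pi, pi] (EFin \o g) ->
  continuous q ->
  itg (- pi) pi (fun x => (c * f x + d * g x) * q x) =
  c * itg (- pi) pi (fun x => f x * q x) + d * itg (- pi) pi (fun x => g x * q x).
Proof.
move=> fi gi cq; have fq := integrable_mul_continuous fi cq; have gq := integrable_mul_continuous gi cq.
rewrite -!itgZint// -itgDint; [|exact: integrable_itvZ..].
by apply: eq_itg => x _; ring.
Qed.

Lemma fcos_lin m f g c d k : in_Hm m f -> in_Hm m g ->
  fcos (fun x => c * f x + d * g x) k = c * fcos f k + d * fcos g k.
Proof.
by move=> /in_Hm_integrable fi /in_Hm_integrable gi; apply: itg_lin => //; exact: continuous_cos_scale.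
Qed.

Lemma fsin_lin m f g c d k : in_Hm m f -> in_Hm m g ->
  fsin (fun x => c * f x + d * g x) k = c * fsin f k + d * fsin g k.
Proof.
by move=> /in_Hm_integrable fi /in_Hm_integrable gi; apply: itg_lin => //; exact: continuous_sin_scale.
Qed.

Lemma in_Hm_lin m f g c d : in_Hm m f -> in_Hm m g -> in_Hm m (fun x => c * f x + d * g x).
Proof.
move=> Hf Hg.
have sq (a b : R) : (c * a + d * b) ^+ 2 <= 2 * c ^+ 2 * a ^+ 2 + 2 * d ^+ 2 * b ^+ 2.
  by have := sqr_ge0 (c * a - d * b); nra.
have [fp mf f2 _] := Hf; have [gp mg g2 _] := Hg.
have mfg : measurable_fun (Tdom (R:=R)) (fun x => c * f x + d * g x).
  by apply: measurable_funD; apply: measurable_funM => //; exact: measurable_cst.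
split => //.
- by move=> x; rewrite fp gp.
- have i1 : mu.-integrable (Tdom (R:=R)) (EFin \o (fun x => 2 * c ^+ 2 * f x ^+ 2 + 2 * d ^+ 2 * g x ^+ 2)).
    have h1 := @integrable_itvZ (2 * c ^+ 2) _ _ _ f2.
    have h2 := @integrable_itvZ (2 * d ^+ 2) _ _ _ g2.
    exact: integrable_itvD h1 h2.
  apply: le_integrable i1 => //; first exact: measurable_itv.
    by apply/measurable_EFinP; apply: measurable_funX.
  have p (a b : R) : 0 <= 2 * a ^+ 2 * b ^+ 2 by rewrite -mulrA -exprMn mulr_ge0// sqr_ge0.
  by move=> x _ /=; rewrite lee_fin (ger0_norm (sqr_ge0 _)) ger0_norm// addr_ge0.
- apply: (@sob_sum_lt_pinfty _ _ (2 * c ^+ 2 * Hm_norm m f ^+ 2 + 2 * d ^+ 2 * Hm_norm m g ^+ 2)) => n.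
  have c0 : 0 <= 2 * c ^+ 2 by rewrite mulr_ge0 ?sqr_ge0.
  have d0 : 0 <= 2 * d ^+ 2 by rewrite mulr_ge0 ?sqr_ge0.
  apply: (@le_trans _ _ (2 * c ^+ 2 * (\sum_(k < n) sob_term m f k) + 2 * d ^+ 2 * (\sum_(k < n) sob_term m g k))).
    rewrite !mulr_sumr -big_split /=; apply: ler_sum => k _.
    rewrite /sob_term (fcos_lin _ _ _ Hf Hg) (fsin_lin _ _ _ Hf Hg).
    have w0 : 0 <= (1 + (k%:R : R) ^+ 2) ^+ m by rewrite exprn_ge0// addr_ge0// sqr_ge0.
    have h1 := sq (fcos f k) (fcos g k); have h2 := sq (fsin f k) (fsin g k).
    have := ler_wpM2l w0 (lerD h1 h2).
    move: (_ ^+ m) => w; move: (fcos f k) (fcos g k) (fsin f k) (fsin g k) => a1 a2 b1 b2.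
    by move=> h; apply: (le_trans h); rewrite le_eqVlt; apply/orP; left; apply/eqP; ring.
  by apply: lerD; rewrite ler_wpM2l//; exact: sob_term_partial_le.
Qed.

Lemma wser_lin m f g c d x : (0 < m)%N -> in_Hm m f -> in_Hm m g ->
  wser (fun x => c * f x + d * g x) x = c * wser f x + d * wser g x.
Proof.
move=> m0 Hf Hg.
have h := @cosser_cvg R _ (wcoef_cvg m0 (in_Hm_lin c d Hf Hg)) x.
have hf := @cosser_cvg R _ (wcoef_cvg m0 Hf) x; have hg := @cosser_cvg R _ (wcoef_cvg m0 Hg) x.
have h' : series (fun k => wcoef (fun x => c * f x + d * g x) k * cos (k%:R * x)) @ \oo
    --> c * wser f x + d * wser g x.
  have -> : series (fun k => wcoef (fun x => c * f x + d * g x) k * cos (k%:R * x)) =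
     (fun n => c * series (fun k => wcoef f k * cos (k%:R * x)) n
             + d * series (fun k => wcoef g k * cos (k%:R * x)) n).
    apply/funext => n; rewrite /series /= !mulr_sumr -big_split /=.
    by apply: eq_bigr => k _; rewrite /wcoef (fcos_lin _ _ _ Hf Hg); ring.
  exact: (cvgD (cvgM (cvg_cst c) hf) (cvgM (cvg_cst d) hg)).
exact: (cvg_unique (@Rhausdorff R) h h').
Qed.

End Sobolev.

(** * Structure of the data: eta' = |sin| g with g continuous *)

Section Structure.
Variable R : realType.
Local Notation mu := (@lebesgue_measure R).
Implicit Types (f g eta : R -> R) (m k n : nat) (a b x y : R).

Lemma eq_itg_oo f g a b : a < b -> mu.-integrable `[a, b] (EFin \o f) -> mu.-integrable `[a, b] (EFin \o g) ->
  (forall x, a < x < b -> f x = g x) -> itg a b f = itg a b g.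
Proof.
move=> ab fi gi fg; pose c := (a + b) / 2.
have ac : a < c by rewrite /c; lra.
have cb : c < b by rewrite /c; lra.
rewrite (itg_chasles (ltW ac) (ltW cb) fi) (itg_chasles (ltW ac) (ltW cb) gi); congr (_ + _).
- apply: eq_itg_co; [exact: integrable_subitv (lexx _) (ltW cb) fi|exact: integrable_subitv (lexx _) (ltW cb) gi|].
  by move=> x /andP[ax xc]; rewrite fg// ax (le_lt_trans xc).
- apply: eq_itg_oc; [exact: integrable_subitv (ltW ac) (lexx _) fi|exact: integrable_subitv (ltW ac) (lexx _) gi|].
  by move=> x /andP[cx xb]; rewrite fg// xb (lt_le_trans ac).
Qed.

Lemma itg_even_half f : mu.-integrable `[- pi, pi] (EFin \o f) -> (forall x, f (- x) = f x) ->
  itg (- pi) pi f = 2 * itg 0 pi f.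
Proof.
move=> fi fe; have p0 := pi_ge0 R.
have f0 : mu.-integrable `[0, pi] (EFin \o f) by apply: integrable_subitv fi; rewrite ?oppr_le0.
rewrite (@itg_chasles _ f (- pi) 0 pi) ?oppr_le0//.
rewrite -[in itg (- pi) 0 f]oppr0 itg_opp_measurable.
- by under eq_itg do rewrite fe; ring.
- rewrite oppr0; have /integrableP[/measurable_EFinP + _] : mu.-integrable `[- pi, 0] (EFin \o f).
    by apply: integrable_subitv fi.
  by [].
- by apply: eq_integrable f0 => // x _ /=; rewrite fe.
Qed.

(** By evenness [wcoef] gives the cosine coefficients of [f] on [0, pi]; the difference to the
    series has none, so its primitives vanish. *)
Lemma even_eq_wser m f : (0 < m)%N -> in_Hm m f -> (forall x, f (- x) = f x) ->
  {ae mu, forall x, 0 < x < pi -> f x = wser f x}.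
Proof.
move=> m0 Hf fe; have p0 := pi_ge0 R.
have fi := in_Hm_integrable Hf.
have cw : continuous (wser f) := ucos_continuous (wser_ucos m0 Hf).
have f0 : mu.-integrable `[0, pi] (EFin \o f) by apply: integrable_subitv fi; rewrite ?oppr_le0.
have wi := @continuous_integrable_itv R (wser f) 0 pi cw.
have di : mu.-integrable `[0, pi] (EFin \o (fun x => f x - wser f x)).
  have := integrable_itvD f0 (integrable_itvZ (-1) wi).
  by apply: eq_integrable => // x _ /=; rewrite mulN1r.
suff : {ae mu, forall x, 0 < x < pi -> f x - wser f x = 0}.
  by apply: ae_mono => x h /h/eqP; rewrite subr_eq0 => /eqP.
apply: itg0_ae0 => // r r0; apply: itg_cos0_itg0 => // k.
have cc := @continuous_cos_scale R k%:R.
have -> : itg 0 pi (fun x => (f x - wser f x) * cos (k%:R * x)) =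
    itg 0 pi (fun x => f x * cos (k%:R * x)) + (-1) * itg 0 pi (fun x => wser f x * cos (k%:R * x)).
  rewrite -itgZint; last by apply: continuous_integrable_itv; exact: continuous_mul.
  rewrite -itgDint.
  - by apply: eq_itg => x _; ring.
  - exact: integrable_mul_continuous.
  - by apply: integrable_itvZ; apply: continuous_integrable_itv; exact: continuous_mul.
rewrite (itg_cosser (wcoef_cvg m0 Hf)).
have : fcos f k = 2 * itg 0 pi (fun x => f x * cos (k%:R * x)).
  apply: itg_even_half; first exact: integrable_mul_continuous.
  by move=> x; rewrite fe mulrN cosN.
rewrite /wcoef => ->; have := @cosnorm_ge1 R k; move: (cosnorm R k) (itg _ _ _) => c I c1.
by field; rewrite gt_eqF//; lra.
Qed.

Lemma derivable_antideriv f : (forall x, derivable f x 1) -> antideriv f (derive1 f).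
Proof. by move=> df x; rewrite derive1E; exact/derivableP. Qed.

Lemma sqrt_rho2 x : 0 < x < pi -> Num.sqrt (rho2 x) = (2 * Num.sqrt pi * sin x)^-1.
Proof.
move=> xpi; have s0 : 0 < sin x := sin_gt0_pi xpi.
have q0 : 0 < Num.sqrt pi :> R by rewrite sqrtr_gt0 pi_gt0.
have -> : rho2 x = ((2 * Num.sqrt pi * sin x)^-1) ^+ 2.
  rewrite /rho2 exprVn; congr (_^-1).
  by rewrite !exprMn sqr_sqrtr ?pi_ge0//; ring.
by rewrite sqrtr_sqr ger0_norm// invr_ge0 !mulr_ge0// ltW.
Qed.

Lemma wder_even eta : oddfun eta -> (forall x, derivable eta x 1) -> forall x, wder eta (- x) = wder eta x.
Proof.
move=> eo ed x; rewrite /wder /dth (antideriv_odd_even (derivable_antideriv ed) eo).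
by rewrite /rho2 sinN sqrrN.
Qed.

Lemma prim_even_odd f x : continuous f -> (forall y, f (- y) = f y) -> prim f (- x) = - prim f x.
Proof.
move=> cf fe; have pf := prim_antideriv cf.
have a : antideriv (fun x => prim f x + prim f (-1 * x + 0)) (fun=> 0).
  apply: antideriv_ext (antiderivD pf (antideriv_shift (-1) 0 pf)) _ _ => y //.
  by rewrite addr0 !mulN1r fe subrr.
have := antideriv0_cst x 0 a; rewrite mulr0 !addr0 prim0 addr0 mulN1r.
by move/eqP; rewrite addrC addr_eq0 => /eqP.
Qed.

Lemma odd_periodic_eq0 f : oddfun f -> periodic2pi f -> (forall x, 0 <= x <= pi -> f x = 0) ->
  forall x, f x = 0.
Proof.
move=> fo fp f0; have p0 := pi_gt0 R.
(* Beyond pi, a translation by - 2 pi, followed by a reflection if the result is negative, leads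
   back to a shorter interval. *)
have h n : forall x, 0 <= x <= pi + n%:R * pi -> f x = 0.
  elim: n => [|n IH] x; first by rewrite mul0r addr0; exact: f0.
  rewrite -natr1 mulrDl mul1r => /andP[x0 xn].
  have [xpi|pix] := leP x pi; first by rewrite f0// x0.
  have e : f (x - 2 * pi) = f x by rewrite -(fp (x - 2 * pi)) subrK.
  have [x2|x2] := leP (2 * pi) x.
    by rewrite -e IH//; lra.
  by rewrite -e -[x - _]opprK fo f0 ?oppr0//; lra.
have g x : 0 <= x -> f x = 0.
  move=> x0; apply: (h (Num.truncn (x / pi)).+1); rewrite x0 /=.
  have : x / pi < (Num.truncn (x / pi)).+1%:R by exact: Num.Theory.truncnS_gt.
  by rewrite ltr_pdivrMr//; lra.
move=> x; have [x0|x0] := leP 0 x; first exact: g.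
by rewrite -[x]opprK fo g ?oppr0//; lra.
Qed.

(** The continuous version of eta' / |sin|; the factor 2 sqrt pi undoes the normalisation of
    [rho2]. *)
Definition gfun eta : R -> R := fun x => 2 * Num.sqrt pi * wser (wder eta) x.

Lemma continuous_abs_sin_mul f : continuous f -> continuous (fun x => `|sin x| * f x).
Proof.
move=> cf; apply: continuous_mul => // x.
by apply: (@continuous_comp _ _ _ (@sin R) Num.norm); [exact: continuous_sin|exact: norm_continuous].
Qed.

Lemma abs_sin_even f : (forall y, f (- y) = f y) -> forall x : R, `|sin (- x)| * f (- x) = `|sin x| * f x.
Proof. by move=> fe x; rewrite sinN normrN fe. Qed.

Section Datum.
Variables (m : nat) (eta : R -> R).
Hypothesis m0 : (0 < m)%N.
Hypothesis Heta : init_datum m eta.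
Local Notation g := (gfun eta).

Lemma gfun_ucos : ucos g.
Proof. by case: Heta => _ _ _ H; apply: ucosZ; exact: wser_ucos m0 H. Qed.

(** Upgrades an identity valid almost everywhere on (0, pi) to a continuous derivative at every
    point of the line, zeros of sin included. *)
Lemma datum_antideriv : antideriv eta (fun x => `|sin x| * g x).
Proof.
have [eo ep ed eH] := Heta; have p0 := pi_gt0 R.
have cg : continuous g := ucos_continuous gfun_ucos.
have cpsi := continuous_abs_sin_mul cg.
have ge := ucos_even gfun_ucos; have pe := abs_sin_even ge.
have pa := prim_antideriv cpsi.
move: (cpsi) (pa) (pe); set psi := (fun x : R => `|sin x| * g x) => cpsi' pa' pe'.
have e0 : eta 0 = 0 := odd_periodic0 eo.
have onJ x : 0 <= x <= pi -> eta x - prim psi x = 0.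
  move=> /andP[x0 xpi]; transitivity (eta 0 - prim psi 0); last by rewrite e0 prim0 subrr.
  have dd y : is_derive y (1 : R) (fun x => eta x - prim psi x) (derive1 eta y - psi y).
    exact: is_deriveB (derivable_antideriv ed y) (pa' y).
  apply: (@ae_derive0_cst R (fun x => eta x - prim psi x) 0 x x0).
    by move=> y; case: (dd y).
  have := even_eq_wser m0 eH (wder_even eo ed); apply: ae_mono => y h /andP[y0 yx].
  have ypi : 0 < y < pi by rewrite y0 (lt_le_trans yx).
  rewrite derive1E; have [_ ->] := dd y.
  have := h ypi; rewrite /wder sqrt_rho2// => hy.
  have s0 : 0 < sin y := sin_gt0_pi ypi.
  have q0 : 0 < Num.sqrt pi :> R by rewrite sqrtr_gt0 pi_gt0.
  rewrite /psi /gfun -hy gtr0_norm//= /dth.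
  move: (Num.sqrt pi) (sin y) (derive1 eta y) q0 s0 => q s d q0 s0.
  by field; rewrite !gt_eqF.
have psip : periodic2pi psi.
  by move=> x; rewrite /psi (ucos_periodic gfun_ucos) (_ : x + 2 * pi = x + pi + pi) ?sinDpi ?sinDpi ?opprK//; ring.
(* Periodicity of [psi] passes to its primitive only because [psi] has mean zero, which [eta pi = 0]
   provides. *)
have pp : prim psi pi = 0.
  have := onJ pi; rewrite (odd_periodic_pi ep eo) sub0r lexx ltW// => /(_ isT)/eqP.
  by rewrite oppr_eq0 => /eqP.
have eq0 : forall x, eta x - prim psi x = 0.
  apply: odd_periodic_eq0 onJ.
  - by move=> x; rewrite eo prim_even_odd//; ring.
  - have a : antideriv (fun x => prim psi (1 * x + 2 * pi) + (-1) * prim psi x) (fun=> 0).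
      apply: antideriv_ext (antiderivD (antideriv_shift 1 (2 * pi) pa') (antiderivZ (-1) pa')) _ _ => y //.
      by rewrite !mul1r psip mulN1r subrr.
    move=> x; rewrite ep; congr (_ - _).
    have := antideriv0_cst x (- pi) a; rewrite !mul1r.
    rewrite (_ : - pi + 2 * pi = pi :> R); last by ring.
    rewrite prim_even_odd//.
    by rewrite pp; lra.
by apply: antideriv_ext pa' _ _ => // x; apply/eqP; rewrite eq_sym -subr_eq0 eq0.
Qed.

Lemma datum_psi_bound x : `|(`|sin x| * g x)| <= 2 * Num.sqrt pi * Hm_norm m (wder eta).
Proof.
have [_ _ _ eH] := Heta.
rewrite normrM normr_id /gfun normrM ger0_norm ?mulr_ge0 ?sqrtr_ge0//.
rewrite -[leRHS]mul1r ler_pM ?mulr_ge0 ?sqrtr_ge0//.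
  by rewrite ler_norml sin_le1 sin_geN1.
by rewrite ler_wpM2l ?mulr_ge0 ?sqrtr_ge0//; exact: wser_le.
Qed.

Lemma datum_psi_half x : 0 <= x <= pi -> `|sin x| * g x = sin x * g x.
Proof. by move=> xpi; rewrite ger0_norm// sin_ge0_pi. Qed.

End Datum.
End Structure.

(** * Differentiation in time *)

Section TimeCalculus.
Variable R : realType.
Implicit Types (T : R) (f h : R -> R) (u v : R -> R -> R) (b c d e s t x : R).

(* Two-sided differentiability inside [0, T], one-sided at the ends. *)
Definition rderiv T f f' := forall t, 0 <= t <= T -> forall e, 0 < e -> exists2 d, 0 < d &
  forall s, 0 <= s <= T -> s != t -> `|s - t| < d -> `|(f s - f t) / (s - t) - f' t| <= e.

Lemma rderiv_ext T f f' h h' : rderiv T f f' -> (forall t, 0 <= t <= T -> f t = h t) ->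
  (forall t, 0 <= t <= T -> f' t = h' t) -> rderiv T h h'.
Proof.
move=> D fh fh' t tT e e0; have [d d0 hd] := D t tT e e0; exists d => // s sT st sd.
by rewrite -!fh// -fh'//; exact: hd.
Qed.

Lemma rderivD T f f' h h' : rderiv T f f' -> rderiv T h h' ->
  rderiv T (fun t => f t + h t) (fun t => f' t + h' t).
Proof.
move=> Df Dh t tT e e0; have e2 : 0 < e / 2 by rewrite divr_gt0.
have [d d0 hd] := Df t tT _ e2; have [d' d'0 hd'] := Dh t tT _ e2.
exists (Num.min d d'); first by rewrite lt_min d0.
move=> s sT st; rewrite lt_min => /andP[sd sd'].
have -> : (f s + h s - (f t + h t)) / (s - t) - (f' t + h' t) =
  ((f s - f t) / (s - t) - f' t) + ((h s - h t) / (s - t) - h' t) by ring.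
rewrite (le_trans (ler_normD _ _))//.
by have := hd s sT st sd; have := hd' s sT st sd'; lra.
Qed.

Lemma rderivZ T c f f' : rderiv T f f' -> rderiv T (fun t => c * f t) (fun t => c * f' t).
Proof.
move=> Df t tT e e0; have c0 : 0 < `|c| + 1 by rewrite ltr_wpDl.
have [|d d0 hd] := Df t tT (e / (`|c| + 1)); first by rewrite divr_gt0.
exists d => // s sT st sd.
have -> : (c * f s - c * f t) / (s - t) - c * f' t = c * ((f s - f t) / (s - t) - f' t) by ring.
rewrite normrM; have := hd s sT st sd; rewrite ler_pdivlMr// => h.
by apply: le_trans h; rewrite mulrC ler_wpM2l// lerDl.
Qed.

Lemma rderiv_is_derive T f f' t : rderiv T f f' -> 0 < t < T -> is_derive t (1 : R) f (f' t).
Proof.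
move=> D /andP[t0 tT].
have H : (fun k : R => k^-1 *: ((f \o shift t) (k *: (1 : R)) - f t)) @ 0^' --> f' t.
  apply/cvgrPdist_le => e e0.
  have [|d d0 hd] := D t _ e e0; first by rewrite !ltW.
  near=> k.
  have k0 : k != 0 by near: k; exact: nbhs_dnbhs_neq.
  have kd : `|k| < d by near: k; exact: dnbhs0_lt.
  have kt : `|k| < t by near: k; exact: dnbhs0_lt.
  have kT : `|k| < T - t by near: k; apply: dnbhs0_lt; rewrite subr_gt0.
  have {}kt := le_lt_trans (ler_norm (- k)) (etrans (congr1 (fun a => a < t) (normrN k)) kt).
  have {}kT := le_lt_trans (ler_norm k) kT.
  have e1 : k + t - t = k by ring.
  rewrite /= /shift /= (_ : k *: (1 : R) = k); last by rewrite /GRing.scale /= mulr1.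
  have := hd (k + t); rewrite e1 => hk.
  rewrite distrC /GRing.scale /= mulrC; apply: hk => //.
    by apply/andP; split; lra.
  by rewrite -subr_eq0 e1.
split; first exact: cvgP H.
exact: cvg_lim H.
Unshelve. all: by end_near. Qed.

Lemma rderiv_lipschitz T f f' t : rderiv T f f' -> 0 <= t <= T -> exists2 d, 0 < d &
  forall s, 0 <= s <= T -> `|s - t| < d -> `|f s - f t| <= `|s - t| * (`|f' t| + 1).
Proof.
move=> D tT; have [d d0 hd] := D t tT 1 ltr01; exists d => // s sT sd.
have [->|st] := eqVneq s t; first by rewrite !subrr normr0 mul0r.
have st0 : s - t != 0 by rewrite subr_eq0.
have -> : f s - f t = (s - t) * ((f s - f t) / (s - t)) by field.
rewrite normrM ler_wpM2l//.
have -> : (f s - f t) / (s - t) = f' t + ((f s - f t) / (s - t) - f' t) by ring.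
by rewrite (le_trans (ler_normD _ _))// lerD2l; exact: hd.
Qed.

Lemma rderiv_within T f f' : rderiv T f f' -> {within `[0, T], continuous f}.
Proof.
move=> D; apply/subspace_continuousP => t; rewrite /= in_itv /= => tT.
apply/cvgrPdist_le => e e0; have [d d0 hd] := rderiv_lipschitz D tT.
have c0 : 0 < `|f' t| + 1 by rewrite ltr_wpDl.
rewrite near_withinE; apply/nbhs_ballP; exists (Num.min d (e / (`|f' t| + 1))).
  by rewrite /= lt_min d0 divr_gt0.
move=> s; rewrite /ball /= distrC lt_min => /andP[sd se]; rewrite in_itv /= => sT.
rewrite distrC (le_trans (hd s sT sd))//.
by move: se; rewrite ltr_pdivlMr// => /ltW.
Qed.

(** Carries an identity known for 0 < t < T to t = 0, by continuity, and to the time derivatives. *)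
Lemma rderiv_eq0 T f f' : 0 < T -> rderiv T f f' -> (forall t, 0 < t < T -> f t = 0) ->
  f 0 = 0 /\ forall t, 0 < t < T -> f' t = 0.
Proof.
move=> T0 D f0; split.
  have [|d d0 hd] := rderiv_lipschitz D (t := 0); first by rewrite lexx ltW.
  have c0 : 0 < `|f' 0| + 1 by rewrite ltr_wpDl.
  apply: ler_eps_eq => e e0.
  pose s := Num.min (T / 2) (Num.min (d / 2) (e / (`|f' 0| + 1))).
  have s0 : 0 < s by rewrite !lt_min !divr_gt0.
  have s1 : s <= T / 2 by rewrite ge_min lexx.
  have s2 : s <= d / 2 by rewrite !ge_min lexx orbT.
  have s3 : s <= e / (`|f' 0| + 1) by rewrite !ge_min lexx !orbT.
  have := hd s; rewrite subr0 (gtr0_norm s0) f0; last by rewrite s0; lra.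
  rewrite sub0r normrN => hs; rewrite subr0 (le_trans (hs _ _))//; [by apply/andP; split; lra|lra|].
  by rewrite -ler_pdivlMr.
move=> t /andP[t0 tT]; apply: ler_eps_eq => e e0.
have [|d d0 hd] := D t _ e e0; first by rewrite !ltW.
pose s := t + Num.min (d / 2) ((T - t) / 2).
have k0 : 0 < Num.min (d / 2) ((T - t) / 2) by rewrite !lt_min !divr_gt0// subr_gt0.
have k1 : Num.min (d / 2) ((T - t) / 2) <= d / 2 by rewrite ge_min lexx.
have k2 : Num.min (d / 2) ((T - t) / 2) <= (T - t) / 2 by rewrite ge_min lexx orbT.
have := hd s; rewrite /s; move: (Num.min _ _) k0 k1 k2 => k k0 k1 k2.
rewrite !f0; [|by apply/andP; split; lra|by apply/andP; split; lra].
rewrite subrr mul0r sub0r normrN subr0 addrAC subrr add0r (gtr0_norm k0); apply; try lra.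
Qed.

(* Time derivative in the uniform norm on [0, pi]. *)
Definition supd T u u1 := [/\ forall t, 0 <= t <= T -> continuous (u t),
  forall t, 0 <= t <= T -> continuous (u1 t) &
  forall t, 0 <= t <= T -> forall e, 0 < e -> exists2 d, 0 < d &
  forall s, 0 <= s <= T -> s != t -> `|s - t| < d ->
  forall x, 0 <= x <= pi -> `|(u s x - u t x) / (s - t) - u1 t x| <= e].

Lemma supd_cst T (q : R -> R) : continuous q -> supd T (fun=> q) (fun _ _ => 0).
Proof.
move=> cq; split => //; first by move=> t _; exact: (@continuous_const R 0).
move=> t _ e e0; exists 1 => // s _ _ _ x _.
by rewrite subrr mul0r subrr normr0 ltW.
Qed.

Lemma supd_mul T u u1 v v1 : supd T u u1 -> supd T v v1 ->
  supd T (fun t x => u t x * v t x) (fun t x => u1 t x * v t x + u t x * v1 t x).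
Proof.
move=> [cu cu1 du] [cv cv1 dv]; split.
- by move=> t tT; apply: continuous_mul; [exact: cu|exact: cv].
- move=> t tT; apply: continuous_add; apply: continuous_mul;
    by [exact: cu|exact: cv|exact: cu1|exact: cv1].
move=> t tT e e0.
have [A A0 hA] := continuous_bounded_itv 0 pi (cu t tT).
have [A1 A10 hA1] := continuous_bounded_itv 0 pi (cu1 t tT).
have [B B0 hB] := continuous_bounded_itv 0 pi (cv t tT).
have [B1 B10 hB1] := continuous_bounded_itv 0 pi (cv1 t tT).
(* [e1] bounds the errors of both difference quotients and [d1] bounds the variation of v: the three
   terms of the remainder add up to at most e1 (A + B + 1) + e / 2 <= e. *)
pose e1 := Num.min 1 (e / 2 / (A + B + 1)).
have e10 : 0 < e1 by rewrite lt_min ltr01 !divr_gt0// !addr_gt0.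
have [d d0 hd] := du t tT e1 e10; have [d' d'0 hd'] := dv t tT e1 e10.
pose d1 := Num.min (1 / (B1 + 1)) (e / 2 / (A1 * (B1 + 1))).
have d10 : 0 < d1 by rewrite lt_min !divr_gt0 ?mulr_gt0 ?addr_gt0.
exists (Num.min d1 (Num.min d d')); first by rewrite lt_min d10 lt_min d0.
move=> s sT st; rewrite lt_min => /andP[sd1]; rewrite lt_min => /andP[sd sd'] x xpi.
have st0 : s - t != 0 by rewrite subr_eq0.
have hu := hd s sT st sd x xpi; have hv := hd' s sT st sd' x xpi.
move: sd1; rewrite /d1 lt_min => /andP[]; rewrite !ltr_pdivlMr ?mulr_gt0 ?addr_gt0// => sd2 sd3.
have : e1 <= 1 by rewrite ge_min lexx.
have : e1 <= e / 2 / (A + B + 1) by rewrite ge_min lexx orbT.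
rewrite ler_pdivlMr ?addr_gt0// => e1e e11.
have := hA x xpi; have := hA1 x xpi; have := hB x xpi; have := hB1 x xpi.
have dvs : `|v s x - v t x| <= `|s - t| * (B1 + 1).
  have -> : v s x - v t x = (s - t) * (((v s x - v t x) / (s - t) - v1 t x) + v1 t x) by field.
  rewrite normrM ler_wpM2l// (le_trans (ler_normD _ _))// addrC lerD ?hB1//.
  exact: le_trans hv e11.
have vs : `|v s x| <= B + 1.
  have -> : v s x = v t x + (v s x - v t x) by ring.
  rewrite (le_trans (ler_normD _ _))// lerD ?hB//.
  by rewrite (le_trans dvs)// ltW.
have -> : (u s x * v s x - u t x * v t x) / (s - t) - (u1 t x * v t x + u t x * v1 t x) =
  ((u s x - u t x) / (s - t) - u1 t x) * v s x + u1 t x * (v s x - v t x)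
   + u t x * ((v s x - v t x) / (s - t) - v1 t x) by field.
move: hu hv dvs vs; move: ((u s x - u t x) / _ - _) ((v s x - v t x) / _ - _) => qu qv.
move=> hu hv dvs vs bv1 bv bu1 bu.
rewrite (le_trans (ler_normD _ _))//.
have h1 : `|u t x * qv| <= A * e1 by rewrite normrM ler_pM.
have h2 : `|u1 t x * (v s x - v t x)| <= A1 * (`|s - t| * (B1 + 1)) by rewrite normrM ler_pM.
have h3 : `|qu * v s x| <= e1 * (B + 1) by rewrite normrM ler_pM.
have := ler_normD (qu * v s x) (u1 t x * (v s x - v t x)).
by lra.
Qed.

Lemma supd_itg T u u1 b : 0 <= b <= pi -> supd T u u1 ->
  rderiv T (fun t => itg 0 b (u t)) (fun t => itg 0 b (u1 t)).
Proof.
move=> /andP[b0 bpi] [cu cu1 du] t tT e e0.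
have [|d d0 hd] := du t tT (e / pi); first by rewrite divr_gt0// pi_gt0.
exists d => // s sT st sd.
have cd : continuous (fun x => u s x - u t x) by apply: continuous_sub; exact: cu.
have cq := @continuous_scale R (s - t)^-1 _ cd.
have c1 := cu1 t tT.
have -> : (itg 0 b (u s) - itg 0 b (u t)) / (s - t) - itg 0 b (u1 t) =
    itg 0 b (fun x => (s - t)^-1 * (u s x - u t x) - u1 t x).
  by rewrite itgB// itgZ// itgB ?[LHS]mulrC//; [rewrite mulrC|exact: cu|exact: cu].
apply: (@le_trans _ _ (e / pi * (b - 0))).
  apply: itg_bound => //; first exact: continuous_sub.
  move=> x /andP[x0 xb]; rewrite mulrC; apply: hd => //.
  by rewrite x0 (le_trans xb).
by rewrite subr0 -mulrA ger_pMr// mulrC ler_pdivrMr ?pi_gt0// mul1r.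
Qed.

Lemma deriv_Hm_supd m T (u u1 : R -> R -> R) : (0 < m)%N -> cont_Hm m u T -> cont_Hm m u1 T ->
  deriv_Hm m u u1 T -> supd T (fun t => wser (u t)) (fun t => wser (u1 t)).
Proof.
move=> m0 [Hu _] [Hu1 _] D; split.
- by move=> t tT; exact: ucos_continuous (wser_ucos m0 (Hu t tT)).
- by move=> t tT; exact: ucos_continuous (wser_ucos m0 (Hu1 t tT)).
move=> t tT e e0; have [d d0 hd] := D t tT e e0; exists d => // s sT st sd x _.
pose k := (s - t)^-1.
pose q x := 1 * (k * u s x + (- k) * u t x) + (-1) * u1 t x.
have H1 := in_Hm_lin k (- k) (Hu s sT) (Hu t tT).
(* Membership matters: outside H^m, [fine] sends +oo to 0, and a small [Hm_norm] would bound
   nothing. *)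
have Hq : in_Hm m q := in_Hm_lin 1 (-1) H1 (Hu1 t tT).
have qE : q = (fun x => (u s x - u t x) / (s - t) - u1 t x).
  by apply/funext => y; rewrite /q /k; ring.
have := hd s sT st sd; rewrite -qE => hn.
have -> : (wser (u s) x - wser (u t) x) / (s - t) - wser (u1 t) x = wser q x.
  by rewrite (wser_lin _ _ _ m0 H1 (Hu1 t tT)) (wser_lin _ _ _ m0 (Hu s sT) (Hu t tT)) /k; ring.
exact: le_trans (wser_le x m0 Hq) (ltW hn).
Qed.

End TimeCalculus.

(** * The weighted inner product as a plain integral on [0, pi] *)

Section WeightedForm.
Variable R : realType.
Local Notation mu := (@lebesgue_measure R).
Implicit Types (f g a b xi eta F : R -> R) (x y : R).

Lemma ipH2E xi eta a b : continuous a -> continuous b ->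
  (forall x, a (- x) = a x) -> (forall x, b (- x) = b x) ->
  (forall x, - pi < x < pi -> x != 0 -> dth xi x = `|sin x| * a x) ->
  (forall x, - pi < x < pi -> x != 0 -> dth eta x = `|sin x| * b x) ->
  ipH2 xi eta = (2 * pi)^-1 * itg 0 pi (fun x => a x * b x).
Proof.
move=> ca cb ae be xa eb; have p0 := pi_gt0 R.
pose q x := (4 * pi)^-1 * (a x * b x).
have cab := continuous_mul ca cb.
have cq : continuous q by apply: continuous_scale.
(* At the zeros of sin the weight [rho2] takes the junk value 0, so the integrand equals [q] only on
   [U]. *)
pose U : set R := `]- pi, 0[ `|` `]0, pi[.
pose phi x := q x * \1_U x.
have qi := @continuous_integrable_itv R q (- pi) pi cq.
have mphi : measurable_fun `[- pi, pi] phi.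
  apply: measurable_funM; first by apply: measurable_funTS; exact: continuous_measurable_fun.
  by apply: measurable_indic; apply: measurableU; exact: measurable_itv.
have [M M0 qM] := @continuous_bounded_itv R q (- pi) pi cq.
have phii : mu.-integrable `[- pi, pi] (EFin \o phi).
  apply: (bounded_measurable_integrable mphi (M := M)) => x xp.
  rewrite /phi normrM indicE; case: (x \in U); rewrite ?normr1 ?mulr1 ?normr0 ?mulr0 ?(ltW M0)//.
  exact: qM.
have phiU x : - pi < x < pi -> x != 0 -> phi x = q x.
  move=> /andP[xp px] x0; rewrite /phi indicE mem_set ?mulr1// /U /= !in_itv /= xp px.
  by case: ltgtP x0 => // _ _; [left|right].
have phiE x : - pi <= x <= pi -> rho2 x * dth xi x * dth eta x = phi x.
  move=> /andP[xp px].
  have [s0|s0] := eqVneq (sin x) 0.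
    rewrite /rho2 s0 expr0n mulr0 invr0 !mul0r /phi indicE memNset ?mulr0//.
    rewrite /U /= !in_itv /= => -[/andP[h1 h2]|xpi].
      have : 0 < sin (- x) by apply: sin_gt0_pi; apply/andP; split; lra.
      by rewrite sinN s0 oppr0 ltxx.
    by have := sin_gt0_pi xpi; rewrite s0 ltxx.
  have x0 : x != 0 by apply: contra_neq s0 => ->; exact: sin0.
  have xpi : x != pi by apply: contra_neq s0 => ->; exact: sinpi.
  have xmpi : x != - pi by apply: contra_neq s0 => ->; rewrite sinN sinpi oppr0.
  have xx : - pi < x < pi by rewrite !lt_neqAle xp px xpi eq_sym xmpi.
  rewrite phiU// xa// eb// /rho2 /q.
  have -> : (4 * pi * sin x ^+ 2)^-1 * (`|sin x| * a x) * (`|sin x| * b x) =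
     (4 * pi * sin x ^+ 2)^-1 * (`|sin x| ^+ 2 * (a x * b x)) by ring.
  rewrite real_normK ?num_real//; move: (@pi R) p0 (sin x) s0 => p p0 s s0.
  by field; rewrite s0 gt_eqF.
have -> : ipH2 xi eta = itg (- pi) pi phi by apply: eq_itg => x; exact: phiE.
have -> : itg (- pi) pi phi = itg (- pi) pi q.
  have hp : - pi <= 0 :> R by rewrite oppr_le0 ltW.
  rewrite (itg_chasles hp (ltW p0) phii) (itg_chasles hp (ltW p0) qi); congr (_ + _).
    apply: eq_itg_oo; [by rewrite oppr_lt0|exact: integrable_subitv (lexx _) (ltW p0) phii|
      exact: integrable_subitv (lexx _) (ltW p0) qi|].
    by move=> x /andP[h1 h2]; rewrite phiU ?lt_eqF// h1 (lt_trans h2).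
  apply: eq_itg_oo; [exact: p0|exact: integrable_subitv hp (lexx _) phii|
    exact: integrable_subitv hp (lexx _) qi|].
  by move=> x /andP[h1 h2]; rewrite phiU ?gt_eqF// h2 (lt_trans _ h1)// oppr_lt0.
rewrite itg_even_sym//; last by move=> x; rewrite /q ae be.
rewrite /q itgZ// mulrA; congr (_ * _); move: (@pi R) p0 => p p0.
by field; rewrite gt_eqF.
Qed.

Lemma normH2E eta : normH2 eta = Num.sqrt (ipH2 eta eta).
Proof. by congr Num.sqrt; apply: eq_itg => x _; rewrite -mulrA expr2. Qed.

Lemma dth_of_prim F g x : continuous g -> (forall y, g (- y) = g y) -> oddfun F ->
  (forall y, 0 < y < pi -> F y = prim (fun z => sin z * g z) y) ->
  - pi < x < pi -> dth F x = `|sin x| * g x.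
Proof.
move=> cg ge Fo Fp xpi; have p0 := pi_gt0 R.
have cpsi := continuous_abs_sin_mul cg; have pe := abs_sin_even ge.
have FP y : 0 < y < pi -> F y = prim (fun z => `|sin z| * g z) y.
  move=> /andP[y0 ypi]; rewrite Fp ?y0// /prim (ltW y0); apply: eq_itg => z /andP[z0 zy].
  by rewrite ger0_norm// sin_ge0_pi// z0 (le_trans zy)// ltW.
have FE y : - pi < y < pi -> F y = prim (fun z => `|sin z| * g z) y.
  move=> /andP[y1 y2]; have [y0|y0|->] := ltgtP y 0.
  - by rewrite -[y]opprK Fo prim_even_odd// FP//; lra.
  - by rewrite FP// y0.
  - by rewrite prim0 (odd_periodic0 Fo).
rewrite -(derive1_antideriv x (prim_antideriv cpsi)) /dth !derive1E.
apply: near_eq_derive.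
have /near_in_itvoo : x \in `]- pi, pi[ by rewrite in_itv.
by apply: filterS => y; rewrite in_itv /=; exact: FE.
Qed.

End WeightedForm.

(** * The energy inequality for functions *)

Section Energy.
Variable R : realType.
Implicit Types (f : nat -> R) (g : R -> R) (n k N : nat).

Lemma sum_shift_le f k N : (forall n, 0 <= f n) -> \sum_(n < N) f (n + k)%N <= \sum_(n < k + N) f n.
Proof.
move=> f0; rewrite big_split_ord /= ler_wpDl ?sumr_ge0//.
by apply: ler_sum => i _; rewrite addnC.
Qed.

Lemma bessel g : ucos g -> exists B, forall N, \sum_(n < N) sincoef g n ^+ 2 <= B.
Proof.
move=> ug; have cg := ucos_continuous ug; have p0 := pi_gt0 R.
have h := sine_parseval ug cg.
exists (pi / 2 * itg 0 pi (fun x => g x * g x)) => N.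
have nd : {homo (fun N => 2 / pi * (\sum_(n < N) sincoef g n * sincoef g n)) : n k / (n <= k)%N >-> n <= k}.
  move=> i j ij; rewrite ler_wpM2l ?divr_ge0 ?(ltW p0)//.
  by rewrite -(subnKC ij) big_split_ord /= lerDl sumr_ge0// => k _; rewrite -expr2 sqr_ge0.
have := nondecreasing_cvgn_le nd (cvgP _ h) N; rewrite (cvg_lim _ h)//.
under eq_bigr do rewrite -expr2.
move: (\sum_(n < N) _) (itg _ _ _) => S I.
by rewrite mulrAC ler_pdivrMr//; lra.
Qed.

Lemma energy_inequality g g1 g2 : ucos g -> ucos g1 -> ucos g2 ->
  sincoef g 1 = 0 -> sincoef g1 1 = 0 ->
  (forall n, sincoef g1 n.+2 = Lmat (sincoef g) n.+2) ->
  (forall n, sincoef g2 n.+2 = Lmat (sincoef g1) n.+2) ->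
  1 / 5 * itg 0 pi (fun x => g x * g x) <=
  itg 0 pi (fun x => g1 x * g1 x) + itg 0 pi (fun x => g x * g2 x).
Proof.
move=> ug ug1 ug2 C1 D1 DE EE; have p0 := pi_gt0 R; have p2 := pi_ge2 R.
have hA := sine_parseval ug (ucos_continuous ug).
have hB := sine_parseval ug1 (ucos_continuous ug1).
have hC := sine_parseval ug (ucos_continuous ug2).
move: hA hB hC; move: (itg _ _ _) (itg _ _ _) (itg _ _ _) => A B K hA hB hC.
apply/ler_addgt0Pl => e e0.
(* Three Parseval errors and one boundary term each contribute at most e / 10. *)
have e10 : 0 < e / 10 by rewrite divr_gt0.
have /cvgrPdist_le/(_ _ e10)[NA _ hA'] := hA.
have /cvgrPdist_le/(_ _ e10)[NB _ hB'] := hB.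
have /cvgrPdist_le/(_ _ e10)[NC _ hC'] := hC.
pose C := sincoef g; pose D := sincoef g1; pose E := sincoef g2.
have [BC hBC] := bessel ug; have [BD hBD] := bessel ug1.
pose r n := sqblock C D n + sqblock C D n.+1.
have r0 n : 0 <= r n by rewrite addr_ge0// sqblock_ge0.
have rB N : \sum_(n < N) r n <= 4 * (BC + BD).
  have sC k := le_trans (@sum_shift_le (fun n => C n ^+ 2) k N (fun n => sqr_ge0 _)) (hBC _).
  have sD k := le_trans (@sum_shift_le (fun n => D n ^+ 2) k N (fun n => sqr_ge0 _)) (hBD _).
  have -> : \sum_(n < N) r n =
     (\sum_(n < N) C (n + 0)%N ^+ 2 + \sum_(n < N) C (n + 2)%N ^+ 2 + \sum_(n < N) D (n + 0)%N ^+ 2 + \sum_(n < N) D (n + 2)%N ^+ 2) +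
     (\sum_(n < N) C (n + 1)%N ^+ 2 + \sum_(n < N) C (n + 3)%N ^+ 2 + \sum_(n < N) D (n + 1)%N ^+ 2 + \sum_(n < N) D (n + 3)%N ^+ 2).
    rewrite -!big_split /=; apply: eq_bigr => i _.
    by rewrite /r /sqblock addn0 addn1 addn2 addn3.
  have := sC 0%N; have := sC 1%N; have := sC 2%N; have := sC 3%N.
  have := sD 0%N; have := sD 1%N; have := sD 2%N; have := sD 3%N.
  by lra.
have [N NN hN] := frequently_small (NA + NB + NC)%N r0 rB e10.
have NA' : (NA <= N.+2)%N.
  by rewrite !leqW// (leq_trans _ NN)// -addnA leq_addr.
have NB' : (NB <= N.+2)%N.
  by rewrite !leqW// (leq_trans _ NN)// addnAC leq_addl.
have NC' : (NC <= N.+2)%N.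
  by rewrite !leqW// (leq_trans _ NN)// leq_addl.
have {hA'} := hA' N.+2 NA'; have {hB'} := hB' N.+2 NB'; have {hC'} := hC' N.+2 NC'.
have lower := @energy_sum_lower R C D E (sincoef0 g) C1 (sincoef0 g1) D1 DE EE N.
(* Parseval is used with N + 2 terms: the first two vanish, which leaves the N terms of
   [energy_sum_lower]. *)
rewrite !(big_ord_recl N.+1) !(big_ord_recl N) /= /bump /= C1 D1 !sincoef0 !(mul0r, add0r).
rewrite big_split /= -/(r N) in lower.
rewrite (eq_bigr (fun n : 'I_N => C n.+2 * C n.+2)) in lower; last by move=> n _; rewrite expr2.
pose S3 := \sum_(i < N) C i.+2 * C i.+2; pose S2 := \sum_(i < N) D i.+2 * D i.+2.
pose S1 := \sum_(i < N) C i.+2 * E i.+2; rewrite -/S1 -/S2 -/S3 in lower.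
rewrite -[\sum_(i < N) _]/S1 -[\sum_(i < N) sincoef g1 _ * _]/S2 -[\sum_(i < N) sincoef g _ * sincoef g _]/S3.
have q1 : 2 / pi <= 1 :> R by rewrite ler_pdivrMr// mul1r.
have q0 : 0 <= 2 / pi :> R by rewrite divr_ge0// ltW.
have := ler_wpM2l q0 (le_trans (lerB (lexx _) hN) lower).
have : 2 / pi * (e / 10) <= e / 10 by rewrite ger_pMl.
rewrite !ler_norml => h1 h2 /andP[h3 _] /andP[h4 _] /andP[_ h5].
by move: S1 S2 S3 {lower} h2 h3 h4 h5 => s1 s2 s3; lra.
Qed.

End Energy.

(** * Growth of solutions *)

Section Solution.
Variable R : realType.
Implicit Types (m n : nat) (eta : R -> R) (T t x s : R) (u : R -> R -> R).

Lemma supd_scale T c u u1 : supd T u u1 -> supd T (fun t x => c * u t x) (fun t x => c * u1 t x).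
Proof.
move=> D; have := supd_mul (@supd_cst R T (fun=> c) (@continuous_const R c)) D.
suff -> : (fun t x => 0 * u t x + c * u1 t x) = (fun t x => c * u1 t x) by [].
by apply/funext => t; apply/funext => x; rewrite mul0r add0r.
Qed.

Lemma supd_sin T u u1 : supd T u u1 -> supd T (fun t x => sin x * u t x) (fun t x => sin x * u1 t x).
Proof.
move=> D; have := supd_mul (@supd_cst R T _ (@continuous_sin R)) D.
suff -> : (fun t x => 0 * u t x + sin x * u1 t x) = (fun t x => sin x * u1 t x) by [].
by apply/funext => t; apply/funext => x; rewrite mul0r add0r.
Qed.

Lemma rderiv_sincoef T u u1 n : supd T u u1 ->
  rderiv T (fun t => sincoef (u t) n) (fun t => sincoef (u1 t) n).
Proof.
move=> D; have := supd_mul D (@supd_cst R T _ (@continuous_sin_scale R n%:R)).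
have -> : (fun t x => u1 t x * sin (n%:R * x) + u t x * 0) = (fun t x => u1 t x * sin (n%:R * x)).
  by apply/funext => t; apply/funext => x; rewrite mulr0 addr0.
by apply: supd_itg; rewrite pi_ge0 lexx.
Qed.

Lemma rderiv_Lmat T (C C' : R -> nat -> R) n : (forall k, rderiv T (fun t => C t k) (fun t => C' t k)) ->
  rderiv T (fun t => Lmat (C t) n) (fun t => Lmat (C' t) n).
Proof.
move=> D; have := rderivD (rderivD (rderivZ (mucoef R n) (D n)) (rderivZ (dcoef R n.+1 / 2) (D n.+2)))
  (rderivZ (- (dcoef R n.-1 / 2)) (D (n - 2)%N)).
by move=> h; apply: (rderiv_ext h) => t _; rewrite /Lmat mulNr.
Qed.

(** The expression is y cosh (2 s t) + (z / s) sinh (2 s t). *)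
Lemma hyperbolic_gt0 (y z s t : R) : 0 < y -> 0 <= z -> 0 < s -> 0 < t ->
  0 < (y + s^-1 * z) / 2 * expR (2 * s * t) + (y - s^-1 * z) / 2 * expR (- (2 * s * t)).
Proof.
move=> y0 z0 s0 t0.
have e1 : expR (- (2 * s * t)) <= expR (2 * s * t).
  have w : 0 <= 2 * s * t by rewrite !mulr_ge0// ltW.
  by rewrite ler_expR (le_trans _ w)// oppr_le0.
have e2 : 0 < expR (- (2 * s * t)) by exact: expR_gt0.
have k0 : 0 <= s^-1 * z by rewrite mulr_ge0// invr_ge0 ltW.
move: (s^-1 * z) k0 (expR (2 * s * t)) (expR (- _)) e1 e2 => k k0 a b ba b0.
have h1 : 0 <= k * (a - b) by rewrite mulr_ge0// subr_ge0.
have h2 : 0 < y * (a + b) by rewrite mulr_gt0// addr_gt0// (lt_le_trans b0).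
by lra.
Qed.

Variables (m : nat) (eta0p eta0m : R -> R) (etap etam : R -> R -> R).
Hypothesis m3 : (3 < m)%N.
Hypothesis sol : lin_solution m eta0p eta0m etap etam.

Let m0 : (0 < m)%N. Proof. exact: leq_ltn_trans m3. Qed.
Let m20 : (0 < m - 2)%N. Proof. by rewrite subn_gt0 (leq_trans _ m3). Qed.

Lemma solution_datum t : 0 <= t -> init_datum m (etap t).
Proof.
move=> t0; case: sol => _ _ reg _ H.
have [ [od p d] _] := reg t t0; have [|[HW _] _ _ _] := H (t + 1); first lra.
by split => //; apply: HW; rewrite t0 lerDl ler01.
Qed.

Lemma ipH2_datum t : 0 <= t ->
  ipH2 (etap t) (etap t) = (2 * pi)^-1 * itg 0 pi (fun x => gfun (etap t) x * gfun (etap t) x).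
Proof.
move=> t0; have Ht := solution_datum t0; have ug := gfun_ucos m0 Ht.
have de x : dth (etap t) x = `|sin x| * gfun (etap t) x := derive1_antideriv x (datum_antideriv m0 Ht).
apply: ipH2E; by [exact: ucos_continuous|exact: ucos_even|].
Qed.

Lemma energy_growth T : 0 < T -> 0 < ipH2 eta0p eta0p -> 0 <= ipH2 (Lplus eta0p) eta0p ->
  forall t, 0 < t < T -> E1 (1 / 25) eta0p t < ipH2 (etap t) (etap t).
Proof.
(* z' >= y / 5 is the case k = 1/10 of [growth_comparison], and s = 1/5 is the square root of
   1/25. *)
have q5 : (1 / 5) ^+ 2 < 1 / 10 :> R by lra.
have q10 (k I1 I2 I3 : R) : k * (1 / 5 * I1) <= k * (I2 + I3) ->
    2 * (1 / 10) * (k * I1) <= k * (I2 + I3).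
  by move=> h; lra.
move=> T0 y0 z0; have p0 := pi_gt0 R.
have e0 : etap 0 = eta0p by case: sol.
have C2 : C2_Hm (m - 2) (fun t => wder (etap t)) T.
  by case: sol => _ _ _ _ /(_ T T0)[].
have [u1 [u2 [Hw Hu1 Hu2 Dw Du1]]] := C2.
pose c : R := 2 * Num.sqrt pi.
pose g t := gfun (etap t).
pose g1 t x := c * wser (u1 t) x; pose g2 t x := c * wser (u2 t) x.
have D1 : supd T g g1 by apply: supd_scale; exact: deriv_Hm_supd m20 Hw Hu1 Dw.
have D2 : supd T g1 g2 by apply: supd_scale; exact: deriv_Hm_supd m20 Hu1 Hu2 Du1.
have ug t : 0 <= t -> ucos (g t) by move=> t0; exact: gfun_ucos m0 (solution_datum t0).
have ug1 t : 0 <= t <= T -> ucos (g1 t).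
  by case: Hu1 => H _ tT; apply: ucosZ; exact: wser_ucos m20 (H t tT).
have ug2 t : 0 <= t <= T -> ucos (g2 t).
  by case: Hu2 => H _ tT; apply: ucosZ; exact: wser_ucos m20 (H t tT).
have etaE t x : 0 <= t -> 0 <= x <= pi -> etap t x = prim (fun x => sin x * g t x) x.
  move=> t0; have Ht := solution_datum t0; have cg := ucos_continuous (ug t t0).
  have [od _ _ _] := Ht.
  exact: (eta_prim (datum_antideriv m0 Ht) (continuous_abs_sin_mul cg) od (@datum_psi_half _ _)).
(* [etap t x] is the integral of sin times g, so its time derivative is the integral of sin times
   [g1]; the equation equates this with L eta. *)
have PDE t x : 0 < t < T -> 0 <= x <= pi -> Lplus (etap t) x = prim (fun x => sin x * g1 t x) x.
  move=> tT xpi; have /andP[t0 _] := tT.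
  have [_ _ _ /(_ t x t0)[_ _ <- _] _] := sol.
  have := supd_itg xpi (supd_sin D1).
  move/rderiv_ext => /(_ (fun t => etap t x) (fun t => prim (fun x => sin x * g1 t x) x)).
  have h1 s : 0 <= s <= T -> itg 0 x (fun x => sin x * g s x) = etap s x.
    by move=> /andP[s0 _]; rewrite etaE// /prim; case/andP: xpi => ->.
  have h2 s : 0 <= s <= T -> itg 0 x (fun x => sin x * g1 s x) = prim (fun x => sin x * g1 s x) x.
    by move=> _; rewrite /prim; case/andP: xpi => ->.
  by move=> /(_ h1 h2)/rderiv_is_derive/(_ tT)[_ <-]; rewrite derive1E.
have static t : 0 < t < T -> sincoef (g1 t) 1 = 0 /\ forall n, sincoef (g1 t) n.+2 = Lmat (sincoef (g t)) n.+2.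
  move=> tT; have /andP[t0 tT'] := tT; have Ht := solution_datum (ltW t0).
  have [od p _ _] := Ht; have cg := ucos_continuous (ug t (ltW t0)).
  have cg1 : continuous (g1 t) by apply: ucos_continuous; apply: ug1; rewrite !ltW.
  apply: (sincoef_Lmat (datum_antideriv m0 Ht) (continuous_abs_sin_mul cg) (datum_psi_bound m0 Ht) p od cg
     (@datum_psi_half _ _) cg1).
  by move=> x; exact: PDE.
have [G11 _] := rderiv_eq0 T0 (rderiv_sincoef 1 D2) (fun t tT => proj1 (static t tT)).
(* The function D - LC vanishes for 0 < t < T; [rderiv_eq0] yields at once D = LC at time 0 and E =
   LD inside. *)
have Z n : sincoef (g1 0) n.+2 = Lmat (sincoef (g 0)) n.+2 /\
    forall t, 0 < t < T -> sincoef (g2 t) n.+2 = Lmat (sincoef (g1 t)) n.+2.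
  have := rderivD (rderiv_sincoef n.+2 D2) (rderivZ (-1) (rderiv_Lmat n.+2 (fun k => rderiv_sincoef k D1))).
  move=> /(rderiv_eq0 T0)[].
    by move=> t tT; have [_ ->] := static t tT; rewrite mulN1r subrr.
  by move=> h h'; split; [move: h|move=> t /h']; rewrite mulN1r => /subr0_eq.
have g11 t : 0 <= t -> sincoef (g t) 1 = 0.
  move=> t0; have Ht := solution_datum t0; have cg := ucos_continuous (ug t t0).
  have [od p _ _] := Ht.
  exact: (sincoef_g1 (datum_antideriv m0 Ht) (continuous_abs_sin_mul cg) p od (@datum_psi_half _ _)).
pose y t := (2 * pi)^-1 * itg 0 pi (fun x => g t x * g t x).
pose z t := (2 * pi)^-1 * itg 0 pi (fun x => g1 t x * g t x).
pose z' t := (2 * pi)^-1 * itg 0 pi (fun x => g2 t x * g t x + g1 t x * g1 t x).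
have yE t : 0 <= t -> ipH2 (etap t) (etap t) = y t by exact: ipH2_datum.
have T00 : 0 <= (0 : R) <= T by rewrite lexx ltW.
(* L eta_0 is known at time 0 only through its coefficients; [Lplus_eq_prim] recovers the function,
   and with it the derivative that enters the inner product. *)
have zE : ipH2 (Lplus eta0p) eta0p = z 0.
  have Ht := solution_datum (lexx 0); rewrite -e0.
  have [od p _ _] := Ht; have cg := ucos_continuous (ug 0 (lexx 0)).
  have cg1 := ucos_continuous (ug1 0 T00).
  have cpsi := continuous_abs_sin_mul cg.
  apply: ipH2E; [exact: cg1|exact: cg|exact: ucos_even (ug1 0 T00)|exact: ucos_even (ug 0 (lexx 0))| |].
    move=> x xpi _; apply: dth_of_prim => //; first exact: ucos_even (ug1 0 T00).
      exact: (Lplus_odd (datum_antideriv m0 Ht) cpsi (datum_psi_bound m0 Ht) od).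
    apply: (Lplus_eq_prim (datum_antideriv m0 Ht) cpsi (datum_psi_bound m0 Ht) p od cg
     (@datum_psi_half _ _) cg1 G11) => n.
    by case: (Z n).
  by move=> x _ _; exact: derive1_antideriv (datum_antideriv m0 Ht).
have pp : 0 <= (pi : R) <= pi by rewrite pi_ge0 lexx.
have Dy : rderiv T y (fun t => 2 * z t).
  have h := rderivZ (2 * pi)^-1 (supd_itg pp (supd_mul D1 D1)).
  apply: (rderiv_ext h) => t tT; first exact: erefl.
  have [cg cg1 _] := D1; have c1 := continuous_mul (cg1 t tT) (cg t tT).
  have -> : itg 0 pi (fun x => g1 t x * g t x + g t x * g1 t x) = 2 * itg 0 pi (fun x => g1 t x * g t x).
    rewrite -itgZ; last exact: c1.
    by apply: eq_itg => x _; move: (g1 t x) (g t x) => p q; ring.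
  exact: mulrCA.
have Dz : rderiv T z z' by exact: rderivZ (supd_itg pp (supd_mul D2 D1)).
have s0 : Num.sqrt (1 / 25 : R) = 1 / 5.
  by rewrite (_ : 1 / 25 = (1 / 5) ^+ 2) ?sqrtr_sqr ?ger0_norm//; field.
move=> t tT; rewrite yE; last by case/andP: tT => /ltW.
rewrite /E1 s0 zE -e0 yE//.
apply: (@growth_comparison R y z z' (1 / 10) (1 / 5) T) tT => //.
- exact: rderiv_within Dy.
- exact: rderiv_within Dz.
- by move=> s sT; exact: rderiv_is_derive Dy sT.
- by move=> s sT; exact: rderiv_is_derive Dz sT.
- move=> s sT; have /andP[s1 s2] := sT.
  have sT' : 0 <= s <= T by rewrite !ltW.
  have cg := ucos_continuous (ug s (ltW s1)); have cg1 := ucos_continuous (ug1 s sT').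
  have cg2 := ucos_continuous (ug2 s sT').
  have [d1 dE] := static s sT.
  have eE n : sincoef (g2 s) n.+2 = Lmat (sincoef (g1 s)) n.+2.
    by case: (Z n) => _; apply.
  have := energy_inequality (ug s (ltW s1)) (ug1 s sT') (ug2 s sT') (g11 s (ltW s1)) d1 dE eE.
  have zs : z' s = (2 * pi)^-1 * (itg 0 pi (fun x => g1 s x * g1 s x) + itg 0 pi (fun x => g s x * g2 s x)).
    rewrite /z' -itgD; [|exact: continuous_mul|exact: continuous_mul].
    apply: (congr1 ( *%R (2 * pi)^-1)); apply: eq_itg => x _.
    by rewrite addrC [X in _ + X]mulrC.
  rewrite zs.
  have q0 : 0 <= (2 * pi)^-1 :> R by rewrite invr_ge0 mulr_ge0// ltW.
  by move/(ler_wpM2l q0); exact: q10.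
- move=> s /andP[s1 _]; rewrite /y mulr_ge0//; first by rewrite invr_ge0 mulr_ge0// ltW.
  by apply: itg_ge0 => x _; rewrite -expr2 sqr_ge0.
- by rewrite -(yE 0 (lexx 0)) e0; exact: y0.
- by rewrite -zE; exact: z0.
Qed.

End Solution.

Theorem theorem3p3 (R : realType) :
  exists2 lam1 : R, 0 < lam1 &
  forall (m : nat) (eta0p eta0m : R -> R) (etap etam : R -> R -> R),
    (3 < m)%N ->
    init_datum m eta0p -> init_datum m eta0m ->
    lin_solution m eta0p eta0m etap etam ->
    normH2 eta0p != 0 ->
    0 <= ipH2 (Lplus eta0p) eta0p ->
    forall t : R, 0 < t ->
      0 < Num.sqrt (E1 lam1 eta0p t) /\
      Num.sqrt (E1 lam1 eta0p t) < normH2 (etap t) + normH2 (etam t).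
Proof.
exists (1 / 25) => [|m eta0p eta0m etap etam m3 _ _ sol]; first by rewrite divr_gt0.
rewrite normH2E => n0 z0 t t0.
(* The square root of a nonpositive real is 0, so a nonzero norm forces a positive square. *)
have y0 : 0 < ipH2 eta0p eta0p by rewrite -sqrtr_gt0 lt_neqAle eq_sym n0 sqrtr_ge0.
(* The horizon T = t + 1 makes [t] an interior time. *)
have tT : 0 < t < t + 1 by rewrite t0 ltrDl ltr01.
have T0 : 0 < t + 1 by rewrite addr_gt0.
have lt1 := energy_growth m3 sol T0 y0 z0 tT.
have E0 : 0 < E1 (1 / 25) eta0p t.
  by apply: hyperbolic_gt0 y0 z0 _ t0; rewrite sqrtr_gt0 divr_gt0.
split; first by rewrite sqrtr_gt0.
rewrite !normH2E (@lt_le_trans _ _ (Num.sqrt (ipH2 (etap t) (etap t))))//.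
  by rewrite ltr_sqrt; [exact: lt1|exact: lt_trans E0 lt1].
by rewrite lerDl sqrtr_ge0.
Qed.
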